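(* Let $n\ge 1$ and $1\le p\le 2$, let $X$ be uniformly distributed on $B_p^n$, and let $R\ge 0$ be a random variable independent of $X$ with $\mathbb{E}R^2<\infty$. Let $a,b\in\mathbb{R}^n$ satisfy $(a_1^2,\ldots,a_n^2)\succ(b_1^2,\ldots,b_n^2)$. Then $$\langle b,RX\rangle^2\preceq_{\mathrm{cx}}\langle a,RX\rangle^2 .$$ Consequently, the same conclusion holds for every probability measure on $\mathbb{R}^n$ with finite second moment and density $x\mapsto\rho(\|x\|_p)$, where $\rho:[0,\infty)\to[0,\infty)$ is nonincreasing: if $Y$ is distributed according to such a measure, then $$\langle b,Y\rangle^2\preceq_{\mathrm{cx}}\langle a,Y\rangle^2 .$$
   Context: $\|x\|_p=(\sum_{i=1}^n|x_i|^p)^{1/p}$ and $B_p^n=\{x\in\mathbb{R}^n:\sum_{i=1}^n|x_i|^p\le 1\}$; densities are with respect to Lebesgue measure; $\langle\cdot,\cdot\rangle$ is the standard inner product. Majorization: for $u,v\in\mathbb{R}^n$ with the same coordinate sum, $u\succ v$ means $\sum_{i=1}^k u_i^\downarrow\ge\sum_{i=1}^k v_i^\downarrow$ for all $1\le k<n$, where $u^\downarrow$ is the rearrangement of the coordinates of $u$ in nonincreasing order. In particular $u\succ v$ includes equality of coordinate sums. Convex order: for integrable real random variables $U,V$, $U\preceq_{\mathrm{cx}}V$ means $\mathbb{E}\Phi(U)\le\mathbb{E}\Phi(V)$ for every convex function $\Phi$ for which the expectations exist. *)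

(* Defs.v *)
From HB Require Import structures.
From mathcomp Require Import all_boot all_order all_algebra.
From mathcomp Require Import interval_inference.
From mathcomp Require Import all_classical all_reals all_analysis.

Set Implicit Arguments.
Unset Strict Implicit.
Unset Printing Implicit Defensive.

Import Order.TTheory GRing.Theory Num.Theory.
Import numFieldNormedType.Exports.

Local Open Scope classical_set_scope.
Local Open Scope ring_scope.

(* R^n is [n.-tuple R], with the product (= Borel) sigma-algebra that
   MathComp-Analysis puts on tuples. *)

(* [lebesgue_measure] lives on [measurableTypeR R], whose measurable structure
   differs from that of [R] by its display only. *)
Definition tuple_cons (R : realType) (n : nat)
    (xt : measurableTypeR R * n.-tuple R) : n.+1.-tuple R :=
  [tuple of (xt.1 : R) :: xt.2].

Section cons_measure.
Local Open Scope ereal_scope.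
Context (R : realType) (n : nat).
Variable m : {sigma_finite_measure set (n.-tuple R) -> \bar R}.

Lemma measurable_tuple_cons : measurable_fun setT (@tuple_cons R n).
Proof.
apply: measurable_cons; last exact: measurable_snd.
exact: (@measurable_fst _ _ (measurableTypeR R) (n.-tuple R)).
Qed.

Let uncons (t : n.+1.-tuple R) : measurableTypeR R * n.-tuple R :=
  (thead t, [tuple of behead t]).

Let tuple_consK : cancel (@tuple_cons R n) uncons.
Proof. by case=> x t; congr (_, _); exact/val_inj. Qed.

Let measurable_uncons : measurable_fun setT uncons.
Proof.
apply/measurable_fun_pairP; split; last exact: measurable_behead.
exact: (measurable_tnth (T := R) (ord0 : 'I_n.+1)).
Qed.

Definition cons_measure : set (n.+1.-tuple R) -> \bar R :=
  pushforward (@lebesgue_measure R \x m) (@tuple_cons R n).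

Let cons_measure0 : cons_measure set0 = 0.
Proof. by rewrite /cons_measure /pushforward preimage_set0 measure0. Qed.

Let cons_measure_ge0 A : 0 <= cons_measure A.
Proof. by rewrite /cons_measure /pushforward; exact: measure_ge0. Qed.

Let cons_measure_sigma_additive : semi_sigma_additive cons_measure.
Proof.
move=> F mF tF mUF; rewrite /cons_measure /pushforward preimage_bigcup.
apply: measure_semi_sigma_additive.
- by move=> k; rewrite -[X in measurable X]setTI; exact: measurable_tuple_cons.
- apply/trivIsetP => /= i j _ _ ij; rewrite -preimage_setI.
  by move/trivIsetP : tF => /(_ _ _ _ _ ij) ->//; rewrite preimage_set0.
- rewrite -preimage_bigcup -[X in measurable X]setTI.
  exact: measurable_tuple_cons.
Qed.

HB.instance Definition _ := isMeasure.Build _ _ _ cons_measure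
  cons_measure0 cons_measure_ge0 cons_measure_sigma_additive.

Let cons_measure_sigma_finite : sigma_finite setT cons_measure.
Proof.
have /sigma_finiteP[F [TF ndF Foo]] := sigma_finiteT (@lebesgue_measure R).
have /sigma_finiteP[G [TG ndG Goo]] := sigma_finiteT m.
exists (fun k => uncons @^-1` (F k `*` G k)) => [|k].
  rewrite -preimage_bigcup; apply/esym/seteqP; split => // t _ /=.
  have : setT (uncons t).1 by [].
  rewrite TF => -[k1 _ Fk1].
  have : setT (uncons t).2 by [].
  rewrite TG => -[k2 _ Gk2].
  exists (maxn k1 k2) => //; split.
    by move: Fk1; exact/subsetPset/ndF/leq_maxl.
  by move: Gk2; exact/subsetPset/ndG/leq_maxr.
have [mF Fkoo] := Foo k; have [mG Gkoo] := Goo k.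
split.
  by rewrite -[X in measurable X]setTI; apply: measurable_uncons => //;
    exact: measurableX.
rewrite /cons_measure /pushforward.
rewrite (_ : tuple_cons (n:=n) @^-1` _ = F k `*` G k); last first.
  by apply/funext => xt; rewrite /preimage /mkset tuple_consK.
by rewrite product_measure1E// lte_mul_pinfty// ge0_fin_numE.
Qed.

HB.instance Definition _ := Measure_isSigmaFinite.Build _ _ _ cons_measure
  cons_measure_sigma_finite.

End cons_measure.

(* n-dimensional Lebesgue measure, as an n-fold product measure; see
   [lebesgue_tuple_box]. *)
Fixpoint lebesgue_tuple (R : realType) (n : nat) :
    {sigma_finite_measure set (n.-tuple R) -> \bar R} :=
  match n with
  | 0%N => dirac ([tuple] : 0.-tuple R)
  | k.+1 => cons_measure (lebesgue_tuple R k)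
  end.

Lemma lebesgue_tuple_box (R : realType) (n : nat) (A : 'I_n -> set R) :
  (forall i, measurable (A i)) ->
  lebesgue_tuple R n [set t | forall i, A i (tnth t i)] =
  (\prod_(i < n) lebesgue_measure (A i))%E.
Proof.
elim: n A => [|n IHn] A mA.
  by rewrite big_ord0 /= diracE mem_set// => -[].
set B := [set t : n.-tuple R | forall i, A (lift ord0 i) (tnth t i)].
have mB : measurable B.
  have -> : B = \big[setI/setT]_(i < n)
      ((fun t : n.-tuple R => tnth t i) @^-1` A (lift ord0 i)).
    apply/seteqP; split => [t Bt|t].
      by apply: (big_ind (fun C : set _ => C t)) => // i _; exact: Bt.
    by move=> + i; rewrite (bigD1 i)//= => -[].
  apply: bigsetI_measurable => i _; rewrite -[X in measurable X]setTI.
  exact: measurable_tnth.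
rewrite big_ord_recl -IHn// -/B.
have mA0 : measurable (A ord0 : set (measurableTypeR R)) by exact: mA.
rewrite -(product_measure1E _ _ mA0 mB).
rewrite /= /cons_measure /pushforward.
congr (product_measure1 _ _ _); apply/seteqP; split => -[x t] /=.
  move=> At; split; first by have := At ord0; rewrite tnth0.
  by move=> i; have := At (lift ord0 i); rewrite tnthS.
move=> [Ax Bt] i; have [j ->|->] := unliftP ord0 i; last by rewrite tnth0.
by rewrite tnthS; exact: Bt.
Qed.

(* B_p^n *)
Definition lp_ball (R : realType) (n : nat) (p : R) : set (n.-tuple R) :=
  [set x | \sum_(i < n) `|tnth x i| `^ p <= 1].
Arguments lp_ball {R} n p.

Definition lp_norm (R : realType) (n : nat) (p : R) (x : n.-tuple R) : R :=
  (\sum_(i < n) `|tnth x i| `^ p) `^ p^-1.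

Definition inner (R : realType) (n : nat) (x y : n.-tuple R) : R :=
  \sum_(i < n) tnth x i * tnth y i.

Definition scale_tuple (R : realType) (n : nat) (r : R) (x : n.-tuple R) :
  n.-tuple R := [tuple r * tnth x i | i < n].

Definition sqr_tuple (R : realType) (n : nat) (x : n.-tuple R) :
  n.-tuple R := [tuple tnth x i ^+ 2 | i < n].

Definition majorizes (R : realType) (n : nat) (u v : n.-tuple R) : Prop :=
  \sum_(i < n) tnth u i = \sum_(i < n) tnth v i /\
  forall k : nat, (1 <= k < n)%N ->
    \sum_(i < k) (sort >=%R v)`_i <= \sum_(i < k) (sort >=%R u)`_i.

(* [K] is meant to be measurable with positive finite volume. *)
Definition uniform_on (R : realType) (n : nat) (K : set (n.-tuple R))
    (mu : set (n.-tuple R) -> \bar R) : Prop :=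
  forall A, measurable A ->
    mu A = (fine (lebesgue_tuple R n (A `&` K)) /
            fine (lebesgue_tuple R n K))%:E.

Definition has_density (R : realType) (n : nat) (f : n.-tuple R -> R)
    (mu : set (n.-tuple R) -> \bar R) : Prop :=
  forall A, measurable A ->
    mu A = (\int[lebesgue_tuple R n]_(x in A) (f x)%:E)%E.

Definition independent_RVs (R : realType) (d d1 d2 : measure_display)
    (T : measurableType d) (T1 : measurableType d1) (T2 : measurableType d2)
    (P : probability T R) (X : {RV P >-> T1}) (Y : {RV P >-> T2}) : Prop :=
  forall A B, measurable A -> measurable B ->
    P (X @^-1` A `&` Y @^-1` B) = (P (X @^-1` A) * P (Y @^-1` B))%E.

(* The expectation, as an element of [-oo, +oo], is not of the form oo - oo. *)
Definition expectation_exists (R : realType) (d : measure_display)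
    (T : measurableType d) (P : probability T R) (U : T -> R) : Prop :=
  ('E_P[U^\+] < +oo)%E \/ ('E_P[U^\-] < +oo)%E.

(* The order is one between integrable random variables, hence the first two
   conjuncts. *)
Definition convex_le (R : realType) (d d' : measure_display)
    (T : measurableType d) (T' : measurableType d')
    (P : probability T R) (U : T -> R)
    (P' : probability T' R) (V : T' -> R) : Prop :=
  [/\ P.-integrable setT (EFin \o U),
      P'.-integrable setT (EFin \o V) &
      forall Phi : R -> R, convex_function [set: R^o] Phi ->
        expectation_exists P (Phi \o U) ->
        expectation_exists P' (Phi \o V) ->
        ('E_P[Phi \o U] <= 'E_P'[Phi \o V])%E].

(* Main.v *)
Require Import Defs.
From mathcomp Require Import all_boot all_order all_algebra.
From mathcomp Require Import all_classical all_reals all_analysis.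
From mathcomp Require Import measurable_realfun interval_inference ring lra.

Set Implicit Arguments.
Unset Strict Implicit.
Unset Printing Implicit Defensive.

Import Order.TTheory GRing.Theory Num.Theory.
Import numFieldNormedType.Exports.

Local Open Scope classical_set_scope.
Local Open Scope ring_scope.

(** Let [X] be uniform on the ball and write N x for the sum of the
    [`|x_i| `^ p]. The theorem rests on the fact that [<a, X>^2] has the same law
    as

      (1 - N X) * C * \sum_i a_i ^+ 2 * `|X_i| `^ (2 - p) * L_i,

    where [C] is the squared cosine of a uniform angle, the [L_i] are independent
    copies of a nonnegative bounded variable, and [C], the [L_i] and [X] are
    independent. The right-hand side is linear in the squares [a_i ^+ 2], so the
    expectation of a convex function of it is a convex function of these squares;
    it is also symmetric, since [X] is exchangeable. A symmetric convex function
    is monotone for majorization ([majorize_le]), which is the claim for the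
    uniform law.

    This is carried out with moments. Integrating even powers of a linear form
    against [expR (- N x)] gives, up to an explicit factor, the moments of a sum
    of independent variables ([inner_moment]), and so does integrating the powers
    of [\sum_i a_i ^+ 2 * `|x_i| `^ (2 - p) * L_i], averaged over the [L_i]
    ([weight_moment]); homogeneity converts integrals against the exponential
    weight into integrals over the ball ([layer_cake]). The two results agree
    when the moments of [L] are [lseq], which is a quotient of Gamma functions.
    That these numbers are the moments of a variable on an interval [0, D] is
    used in the form that the functional ['X^m |-> lseq m] is nonnegative on
    polynomials that are nonnegative on [0, D] ([hausdorff]).

    This positivity is where [1 <= p <= 2] enters. The Gamma quotient is a limit
    of quotients of finite products ([hausdorff_gamma]); the logarithm of the
    q-analogue of such a quotient is a series of geometric sequences in [m],
    whose coefficients are differences of exponential sums over the zeros and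
    the poles ([hausdorff_qratio]). They are nonnegative thanks to an inequality
    between hyperbolic functions ([csch_le_cothB]) with parameter [2 / p], which
    lies between 1 and 2.

    It follows that the integrals over the ball compare for every polynomial that
    is convex on a large interval ([ballpoly_le]), hence for convex functions,
    which are limits of convex Bernstein polynomials ([ball_convex_le]). By
    dilation the comparison holds on all centered balls. The law of the product
    of [X] with an independent radius is a mixture of uniform laws on balls, and
    so is a law with nonincreasing radial density, by the layer cake formula in
    the values of the density ([radial_density_le]). Finally, both sides have the
    same mean, so a convex test function can be replaced by its difference with
    an affine minorant, which is nonnegative and has a well-defined integral
    ([convex_le_nonneg]). *)

(** * Moment functionals nonnegative on an interval *)

Section moment_functional.
Context {R : realType}.
Implicit Types (P Q : {poly R}) (m : nat -> R) (D : R).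

(** The expectation of [P] at a variable with moments [m], when there is one. *)
Definition momentf m P : R := \sum_(i < size P) P`_i * m i.

Lemma momentf_widen m P K : (size P <= K)%N ->
  momentf m P = \sum_(i < K) P`_i * m i.
Proof.
move=> PK; rewrite /momentf (big_ord_widen K (fun i => P`_i * m i) PK).
rewrite big_mkcond; apply: eq_bigr => i _; case: ifPn => //.
by rewrite -leqNgt => Pi; rewrite nth_default// mul0r.
Qed.

Lemma momentfD m P Q : momentf m (P + Q) = momentf m P + momentf m Q.
Proof.
pose K := maxn (size P) (size Q).
have PK : (size P <= K)%N by rewrite leq_maxl.
have QK : (size Q <= K)%N by rewrite leq_maxr.
have PQK : (size (P + Q)%R <= K)%N by exact: size_polyD.
rewrite (momentf_widen _ PK) (momentf_widen _ QK) (momentf_widen _ PQK).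
by rewrite -big_split/=; apply: eq_bigr => i _; rewrite coefD mulrDl.
Qed.

Lemma momentfZ m c P : momentf m (c *: P) = c * momentf m P.
Proof.
rewrite (@momentf_widen m (c *: P) (size P)) ?size_scale_leq// mulr_sumr.
by apply: eq_bigr => i _; rewrite coefZ mulrA.
Qed.

Lemma momentf0 m : momentf m 0 = 0.
Proof. by rewrite /momentf size_poly0 big_ord0. Qed.

Lemma momentf_sum m (I : Type) (r : seq I) (F : I -> {poly R}) :
  momentf m (\sum_(i <- r) F i) = \sum_(i <- r) momentf m (F i).
Proof.
elim: r => [|i r IH]; first by rewrite !big_nil momentf0.
by rewrite !big_cons momentfD IH.
Qed.

Lemma momentf_Xn m i : momentf m 'X^i = m i.
Proof.
rewrite /momentf size_polyXn big_ord_recr/= big1 ?add0r.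
  by rewrite coefXn eqxx mul1r.
by move=> j _; rewrite coefXn ltn_eqF// mul0r.
Qed.

Lemma momentf_poly m n (E : nat -> R) :
  momentf m (\poly_(i < n) E i) = \sum_(i < n) E i * m i.
Proof.
rewrite (momentf_widen _ (size_poly _ _)).
by apply: eq_bigr => i _; rewrite coef_poly ltn_ord.
Qed.

(** By the Hausdorff moment problem these are the moment sequences of the finite
    measures on [0, D]; keeping only the positivity of the functional makes the
    closure properties below elementary. *)
Definition hausdorff D m := forall P,
  (forall x, 0 <= x <= D -> 0 <= P.[x]) -> 0 <= momentf m P.

Lemma hausdorff_pow D w x : 0 <= w -> 0 <= x <= D ->
  hausdorff D (fun i => w * x ^+ i).
Proof.
move=> w0 xD P P0; rewrite /momentf.
under eq_bigr do rewrite mulrCA.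
by rewrite -mulr_sumr -horner_coef mulr_ge0// P0.
Qed.

Lemma hausdorff_eq D m1 m2 : m1 =1 m2 -> hausdorff D m1 -> hausdorff D m2.
Proof. by move=> /funext ->. Qed.

Lemma hausdorff_lim D (u : nat -> nat -> R) m :
  (forall k, hausdorff D (u k)) ->
  (forall i, (fun k => u k i) @ \oo --> m i) -> hausdorff D m.
Proof.
move=> hu um P P0.
have cP : (fun k => momentf (u k) P) @ \oo --> momentf m P.
  apply: cvg_big => [|i _]; first exact: add_continuous.
  by apply: cvgM; [exact: cvg_cst|exact: um].
rewrite -(cvg_lim _ cP)//; apply: limr_ge; first by apply/cvg_ex; eexists; exact: cP.
by apply: nearW => k; exact: hu.
Qed.

Lemma hausdorffD D m1 m2 : hausdorff D m1 -> hausdorff D m2 ->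
  hausdorff D (fun i => m1 i + m2 i).
Proof.
move=> h1 h2 P P0.
rewrite /momentf; under eq_bigr do rewrite mulrDr.
by rewrite big_split addr_ge0// ?h1 ?h2.
Qed.

Lemma hausdorff_sum D (I : Type) (r : seq I) (m : I -> nat -> R) :
  (forall i, hausdorff D (m i)) -> hausdorff D (fun j => \sum_(i <- r) m i j).
Proof.
move=> hm; elim: r => [|i r IH].
  move=> P P0; rewrite /momentf big1// => i _; by rewrite big_nil mulr0.
have -> : (fun j => \sum_(k <- i :: r) m k j) =
    (fun j => m i j + \sum_(k <- r) m k j).
  by apply/funext => j; rewrite big_cons.
exact: hausdorffD.
Qed.

(** The product of independent variables: the second functional is applied to
    [P (x y)] as a polynomial in [y], then the first one to the result, which is
    nonnegative on [0, D1]. *)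
Lemma hausdorffM D1 D2 m1 m2 : 0 <= D2 ->
  hausdorff D1 m1 -> hausdorff D2 m2 ->
  hausdorff (D1 * D2) (fun i => m1 i * m2 i).
Proof.
move=> D20 h1 h2 P P0.
have -> : momentf (fun i => m1 i * m2 i) P =
    momentf m1 (\poly_(i < size P) (P`_i * m2 i)).
  by rewrite momentf_poly; apply: eq_bigr => i _; rewrite mulrA mulrAC.
apply: h1 => x /andP[x0 xD1].
rewrite horner_poly.
have -> : \sum_(i < size P) P`_i * m2 i * x ^+ i =
    momentf m2 (\poly_(i < size P) (P`_i * x ^+ i)).
  by rewrite momentf_poly; apply: eq_bigr => i _; rewrite mulrAC.
apply: h2 => y /andP[y0 yD2].
rewrite horner_poly.
under eq_bigr do rewrite -mulrA -exprMn.
rewrite -horner_coef; apply: P0.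
by rewrite mulr_ge0//= ler_pM.
Qed.

Lemma hausdorffZ D c m : 0 <= c -> hausdorff D m ->
  hausdorff D (fun i => c * m i).
Proof.
move=> c0 hm P P0.
rewrite /momentf; under eq_bigr do rewrite mulrCA.
by rewrite -mulr_sumr mulr_ge0// hm.
Qed.

Lemma hausdorff_dilate D d m : 0 <= d -> hausdorff D m ->
  hausdorff (D * d) (fun i => d ^+ i * m i).
Proof.
move=> d0 hm.
have hd : hausdorff d (fun i => 1 * d ^+ i).
  by apply: hausdorff_pow => //; rewrite d0 lexx.
apply: hausdorff_eq (hausdorffM d0 hm hd) => i.
by rewrite mul1r mulrC.
Qed.

(** The exponential is a power series with nonnegative coefficients, and powers
    of moment sequences are moment sequences. *)
Lemma hausdorff_expR m : hausdorff 1 m -> hausdorff 1 (fun i => expR (m i)).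
Proof.
move=> hm.
have hpow k : hausdorff 1 (fun i => m i ^+ k).
  elim: k => [|k IH].
    by have := @hausdorff_pow 1 1 1 ler01; rewrite ler01 lexx => /(_ isT);
       apply: hausdorff_eq => i; rewrite expr1n mulr1.
  rewrite -[X in hausdorff X _]mulr1.
  by apply: hausdorff_eq (hausdorffM ler01 hm IH) => i; rewrite exprS.
apply: (@hausdorff_lim _ (fun n i => series (exp_coeff (m i)) n)) => [n|i].
  apply: hausdorff_eq (@hausdorff_sum _ _ (index_iota 0 n)
    (fun k i => (k`!%:R)^-1 * m i ^+ k) _) => [i|k].
    by rewrite /series/=; apply: eq_bigr => k _; rewrite exp_coeffE.
  by apply: hausdorffZ => //; rewrite invr_ge0.
exact: is_cvg_series_exp_coeff.
Qed.

End moment_functional.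

(** * Quotients of finite products as moment sequences *)

Section log_series.
Context {R : realType}.

(** The derivative of the remainder is [t ^+ K / (1 - t)], so the mean value
    theorem gives both bounds. *)
Lemma log_remainder (x : R) K : 0 <= x < 1 ->
  0 <= - ln (1 - x) - \sum_(k < K) x ^+ k.+1 / k.+1%:R <= x ^+ K / (1 - x).
Proof.
move=> /andP[x0 x1].
pose p : {poly R} := \sum_(k < K) (k.+1%:R^-1 *: 'X^(k.+1)).
have px t : p.[t] = \sum_(k < K) t ^+ k.+1 / k.+1%:R.
  by rewrite horner_sum; apply: eq_bigr => k _; rewrite hornerZ hornerXn mulrC.
have p'x t : (p^`()).[t] = \sum_(k < K) t ^+ k.
  rewrite raddf_sum /= horner_sum; apply: eq_bigr => k _.
  by rewrite derivZ derivXn hornerZ hornerMn hornerXn /= -[X in _ * X]mulr_natl mulrA mulVf ?mul1r.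
pose f (t : R) := - ln (1 - t) - p.[t].
pose df (t : R) := (1 - t)^-1 - (p^`()).[t].
have dfE (t : R) : t < 1 -> df t = t ^+ K / (1 - t).
  move=> t1; have t1' : 1 - t != 0 by rewrite subr_eq0 gt_eqF.
  rewrite /df p'x; apply: (mulIf t1').
  rewrite mulrBl mulVf// divfK//.
  have := subrXX 1 t K; rewrite expr1n.
  under eq_bigr do rewrite expr1n mul1r.
  by rewrite mulrC => <-; rewrite opprB addrC subrK.
have isd (t : R) : t < 1 -> is_derive t 1 f (df t).
  move=> t1; apply: is_deriveB.
  have := @is_derive1_comp R (fun u => - ln u) (fun t => 1 - t) t (- (1 - t)^-1) (-1).
  rewrite mulrNN mulr1; apply.
    by apply: is_deriveN; apply: is_derive1_ln; rewrite subr_gt0.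
  by rewrite -[X in is_derive _ _ _ X]sub0r; apply: is_deriveB.
have fc : {within `[0, x], continuous f}.
  apply: derivable_within_continuous => t /itvP tx.
  by apply: ex_derive; apply: isd; rewrite (le_lt_trans _ x1)// tx.
have fd t : t \in `]0, x[%R -> is_derive t 1 f (df t).
  by move=> /itvP tx; apply: isd; rewrite (lt_trans _ x1)// tx.
have [c + +] := MVT_segment x0 fd fc.
rewrite in_itv/= => /andP[c0 cx].
have c1 : c < 1 by rewrite (le_lt_trans cx).
have f0 : f 0 = 0.
  rewrite /f subr0 ln1 oppr0 px big1 ?subr0// => i _.
  by rewrite expr0n mul0r.
rewrite f0 !subr0 dfE// /f px => ->.
rewrite !mulr_ge0 ?exprn_ge0 ?invr_ge0 ?subr_ge0 ?(ltW c1)//=.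
have h : c ^+ K / (1 - c) <= x ^+ K / (1 - x).
  apply: ler_pM; rewrite ?exprn_ge0 ?invr_ge0 ?subr_ge0 ?(ltW c1)//.
    by rewrite lerXn2r ?nnegrE.
  by rewrite lef_pV2 ?posrE ?subr_gt0// lerB.
apply: le_trans h; rewrite ler_piMr ?(ltW x1)//.
by rewrite mulr_ge0 ?exprn_ge0 ?invr_ge0 ?subr_ge0 ?(ltW c1).
Qed.

Lemma cvg_log_series (x : R) : 0 <= x < 1 ->
  (fun K => \sum_(k < K) x ^+ k.+1 / k.+1%:R) @ \oo --> - ln (1 - x).
Proof.
move=> x01; have /andP[x0 x1] := x01.
have xK : (fun K => - ln (1 - x) - x ^+ K / (1 - x)) @ \oo --> - ln (1 - x) - 0 / (1 - x).
  apply: cvgB; first exact: cvg_cst.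
  by apply: cvgM; [apply: cvg_expr; rewrite ger0_norm|exact: cvg_cst].
rewrite mul0r subr0 in xK.
apply: (squeeze_cvgr _ xK (cvg_cst (- ln (1 - x)))).
apply: nearW => K /=; have /andP[h1 h2] := log_remainder K x01.
by apply/andP; split; lra.
Qed.

Lemma cvg_one_sub_expR_div (x : R) : 0 <= x ->
  (fun n => (1 - expR (- (n.+1%:R^-1 * x))) / n.+1%:R^-1) @ \oo --> x.
Proof.
move=> x0.
have lo : (fun n => x / (1 + n.+1%:R^-1 * x)) @ \oo --> x / (1 + 0 * x).
  apply: cvgM; first exact: cvg_cst.
  apply: cvgV; first by rewrite mul0r addr0 oner_neq0.
  apply: cvgD; first exact: cvg_cst.
  by apply: cvgM; [exact: cvg_harmonic|exact: cvg_cst].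
rewrite mul0r addr0 divr1 in lo.
apply: (squeeze_cvgr _ lo (cvg_cst x)).
apply: nearW => n /=.
set h : R := n.+1%:R^-1.
have h0 : 0 < h by rewrite invr_gt0.
have hx0 : 0 <= h * x by rewrite mulr_ge0// ltW.
have e1 : 0 < 1 + h * x by rewrite ltr_pwDl.
apply/andP; split; last first.
  rewrite ler_pdivrMr// mulrC lerBlDr addrC -lerBlDr.
  exact: expR_ge1Dx.
rewrite ler_pdivlMr// mulrAC ler_pdivrMr//.
have : expR (- (h * x)) <= (1 + h * x)^-1.
  by rewrite expRN lef_pV2 ?posrE ?expR_gt0// expR_ge1Dx.
move=> H; rewrite mulrC mulrBl mul1r lerBrDr -lerBrDl addrK.
by rewrite -ler_pdivlMr// div1r.
Qed.

End log_series.

Section finite_products.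
Context {R : realType}.
Implicit Types (zs ps : seq R).

Lemma expR_sum_ln (s : seq R) (f : R -> R) : (forall z, z \in s -> 0 < f z) ->
  expR (\sum_(z <- s) ln (f z)) = \prod_(z <- s) f z.
Proof.
move=> f0; rewrite expR_sum; apply: eq_big_seq => z zs.
by rewrite lnK// posrE f0.
Qed.

(** Expand each logarithm of a factor as a power series in
    [expR (- (h * (m%:R + c + z)))]. The logarithm of the quotient becomes a
    series in the geometric sequences [m |-> expR (- (k h)) ^+ m], whose
    coefficients carry the difference of the two exponential sums at [k h]; when
    these differences are nonnegative the logarithm is a moment sequence, and so
    is its exponential. *)
Lemma hausdorff_qratio zs ps (h c : R) : 0 < h -> 0 < c ->
  (forall z, z \in zs -> 0 <= z) -> (forall z, z \in ps -> 0 <= z) ->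
  (forall u : R, 0 < u ->
     \sum_(z <- zs) expR (- (u * z)) <= \sum_(z <- ps) expR (- (u * z))) ->
  hausdorff 1 (fun m => \prod_(z <- zs) (1 - expR (- (h * (m%:R + c + z)))) /
                        \prod_(z <- ps) (1 - expR (- (h * (m%:R + c + z))))).
Proof.
move=> h0 c0 zs0 ps0 S0.
have Epos (z : R) (m : nat) : 0 <= z -> 0 < 1 - expR (- (h * (m%:R + c + z))).
  by move=> z0; rewrite subr_gt0 expR_lt1 oppr_lt0 mulr_gt0// ltr_wpDr// ltr_wpDl.
pose g (m : nat) (z : R) : R := - ln (1 - expR (- (h * (m%:R + c + z)))).
pose G (m : nat) : R := \sum_(z <- ps) g m z - \sum_(z <- zs) g m z.
apply: (@hausdorff_eq _ _ (fun m => expR (G m))) => [m|].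
  pose f (z : R) : R := 1 - expR (- (h * (m%:R + c + z))).
  have f0 (t : seq R) : (forall z, z \in t -> 0 <= z) -> forall z, z \in t -> 0 < f z.
    by move=> t0 z /t0; exact: Epos.
  rewrite -[in RHS](expR_sum_ln (f0 _ zs0)) -[in RHS](expR_sum_ln (f0 _ ps0)).
  rewrite -expRN -expRD; congr expR.
  by rewrite /G /g 2!sumrN opprK addrC.
apply: hausdorff_expR.
(* The index [k] stands for the power [k.+1] of the logarithmic series. *)
pose s k : R := \sum_(z <- ps) expR (- (k.+1%:R * h * z)) -
                \sum_(z <- zs) expR (- (k.+1%:R * h * z)).
have s0 k : 0 <= s k by rewrite subr_ge0 S0// mulr_gt0.
apply: (@hausdorff_lim _ _ (fun K m => \sum_(0 <= k < K)
   (s k * expR (- (k.+1%:R * h * c)) / k.+1%:R) *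
   expR (- (k.+1%:R * h)) ^+ m)) => [K|m].
  apply: hausdorff_sum => k; apply: hausdorff_pow.
    by rewrite !mulr_ge0 ?expR_ge0 ?invr_ge0.
  by rewrite expR_ge0/= expR_le1 oppr_le0 mulr_ge0// ltW.
have lim1 (t : seq R) : (forall z, z \in t -> 0 <= z) ->
   (fun K => \sum_(z <- t) \sum_(k < K) expR (- (h * (m%:R + c + z))) ^+ k.+1 / k.+1%:R) @ \oo
     --> \sum_(z <- t) g m z.
  elim: t => [|z t IH] t0.
    by rewrite big_nil; under eq_cvg do rewrite big_nil; exact: cvg_cst.
  rewrite big_cons; under eq_cvg do rewrite big_cons.
  apply: cvgD; last by apply: IH => y yt; rewrite t0// inE yt orbT.
  apply: cvg_log_series; rewrite expR_ge0 -subr_gt0 Epos//.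
  by rewrite t0// mem_head.
apply: cvg_trans _ (cvgB (lim1 _ ps0) (lim1 _ zs0)).
apply: near_eq_cvg; apply: nearW => K /=.
rewrite !fctE/= big_mkord.
rewrite exchange_big [X in _ - X = _]exchange_big -sumrB; apply: eq_bigr => k _.
have E (t : seq R) :
    \sum_(z <- t) expR (- (h * (m%:R + c + z))) ^+ k.+1 =
    (\sum_(z <- t) expR (- (k.+1%:R * h * z))) *
    (expR (- (k.+1%:R * h * c)) * expR (- (k.+1%:R * h)) ^+ m).
  rewrite mulr_suml; apply: eq_bigr => z _.
  by rewrite -!expRM_natl -!expRD; congr expR; ring.
rewrite -!mulr_suml -mulrBl !E -mulrBl -/(s k).
by rewrite -!mulrA; congr (_ * (_ * _)); rewrite mulrC.
Qed.

Lemma cvg_prod_qratio (t : seq R) (m : nat) (c : R) : 0 < c ->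
  (forall z, z \in t -> 0 <= z) ->
  (fun n => \prod_(z <- t) ((1 - expR (- (n.+1%:R^-1 * (m%:R + c + z)))) / n.+1%:R^-1))
    @ \oo --> \prod_(z <- t) (m%:R + c + z).
Proof.
move=> c0; elim: t => [|z t IH] t0.
  by rewrite big_nil; under eq_cvg do rewrite big_nil; exact: cvg_cst.
rewrite big_cons; under eq_cvg do rewrite big_cons.
apply: cvgM; last by apply: IH => y yt; rewrite t0// inE yt orbT.
apply: cvg_one_sub_expR_div.
by rewrite !addr_ge0// ?(ltW c0)// t0// mem_head.
Qed.

(** The factor [1 - expR (- (h x))] divided by [h] tends to [x] as [h] tends to
    0, so that this is a limit of the sequences of [hausdorff_qratio]. *)
Lemma hausdorff_ratio zs ps (c : R) : 0 < c ->
  (forall z, z \in zs -> 0 <= z) -> (forall z, z \in ps -> 0 <= z) ->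
  (forall u : R, 0 < u ->
     \sum_(z <- zs) expR (- (u * z)) <= \sum_(z <- ps) expR (- (u * z))) ->
  hausdorff 1 (fun m => \prod_(z <- zs) (m%:R + c + z) /
                        \prod_(z <- ps) (m%:R + c + z)).
Proof.
move=> c0 zs0 ps0 S0.
pose F n (t : seq R) m := \prod_(z <- t)
   ((1 - expR (- (n.+1%:R^-1 * (m%:R + c + z)))) / n.+1%:R^-1).
apply: (@hausdorff_lim _ _ (fun n m => F n zs m / F n ps m)) => [n|m].
  have h0 : (0 : R) < n.+1%:R^-1 by rewrite invr_gt0.
  have K0 (t : seq R) : 0 < \prod_(z <- t) (n.+1%:R^-1 : R) by rewrite prodr_gt0.
  pose C : R := (\prod_(z <- ps) n.+1%:R^-1) / (\prod_(z <- zs) n.+1%:R^-1).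
  have C0 : 0 <= C by rewrite divr_ge0// ltW.
  apply: hausdorff_eq (hausdorffZ C0 (hausdorff_qratio h0 c0 zs0 ps0 S0)).
  move=> m; rewrite /F /C !prodf_div.
  rewrite invfM invrK; set A := \prod_(z <- zs) (1 - _); set B := (\prod_(z <- ps) (1 - _))^-1.
  ring.
apply: cvgM; first exact: cvg_prod_qratio.
apply: cvgV; last exact: cvg_prod_qratio.
rewrite gt_eqF//; rewrite big_seq prodr_gt0// => z /ps0 z0.
by rewrite ltr_wpDr// ltr_wpDl.
Qed.

End finite_products.

(** * A hyperbolic inequality *)

Section hyperbolic.
Context {R : realType}.

Lemma sub_exp_mono (P Q S T : R) j : 0 <= S -> 0 <= T -> S <= P -> T <= Q ->
  T <= S -> P - Q = S - T -> S ^+ j - T ^+ j <= P ^+ j - Q ^+ j.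
Proof.
move=> S0 T0 SP TQ TS PQ; rewrite !subrXX PQ ler_wpM2l ?subr_ge0//.
apply: ler_sum => i _; apply: ler_pM; rewrite ?exprn_ge0//.
all: by rewrite lerXn2r ?nnegrE// (le_trans _ SP, le_trans _ TQ).
Qed.

(** The function [expR z + expR (- z)] is a power series in [z ^+ 2] with
    nonnegative coefficients, hence its increments over intervals of the same
    length in [z ^+ 2] increase with the position of the interval. *)
Lemma cosh_sqr_mono (p q s t : R) : p ^+ 2 - q ^+ 2 = s ^+ 2 - t ^+ 2 ->
  t ^+ 2 <= s ^+ 2 -> s ^+ 2 <= p ^+ 2 -> t ^+ 2 <= q ^+ 2 ->
  (expR s + expR (- s)) - (expR t + expR (- t)) <=
  (expR p + expR (- p)) - (expR q + expR (- q)).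
Proof.
move=> pqst ts sp tq.
have cE (z : R) : (fun n => series (exp_coeff z) n + series (exp_coeff (- z)) n) @ \oo -->
    expR z + expR (- z).
  by apply: cvgD; exact: is_cvg_series_exp_coeff.
rewrite -subr_ge0.
pose u (z : R) n := series (exp_coeff z) n + series (exp_coeff (- z)) n.
have c : (fun n => (u p n - u q n) - (u s n - u t n)) @ \oo -->
   (expR p + expR (- p) - (expR q + expR (- q))) -
   (expR s + expR (- s) - (expR t + expR (- t))).
  by apply: cvgB; apply: cvgB; exact: cE.
rewrite -(cvg_lim _ c)//.
apply: limr_ge; first by apply/cvg_ex; eexists; exact: c.
apply: nearW => n; rewrite /u /series/= -!big_split -!sumrB/=.
apply: sumr_ge0 => k _; rewrite !exp_coeffE/=.
rewrite -!mulrDr -!mulrBr mulr_ge0 ?invr_ge0//.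
have [kodd|keven] := boolP (odd k).
  have N (z : R) : z ^+ k + (- z) ^+ k = 0.
    by rewrite exprNn -signr_odd kodd expr1 mulN1r subrr.
  by rewrite !N !subrr.
have N (z : R) : z ^+ k + (- z) ^+ k = 2 * (z ^+ 2) ^+ k./2.
  rewrite exprNn -signr_odd (negbTE keven) expr0 mul1r -exprM mul2n.
  by rewrite even_halfK// mulr_natl mulr2n.
by rewrite !N -!mulrBr mulr_ge0// subr_ge0 sub_exp_mono ?sqr_ge0.
Qed.

(** With [x = u / (2 b)], [y = u / 2] and [z = u / (2 (b - 1))] this reads
    csch z <= coth x - coth y, that is,
    sinh x sinh y <= sinh (y - x) sinh z. The choice of [z] makes
    [(y - x) * z = x * y], so that after writing the products of sinh as
    differences of cosh, both sides are increments of cosh over intervals of the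
    same length in the squared variable. The bound [b <= 2] puts the right one
    above the left one. *)
Lemma csch_le_cothB (u b : R) : 0 < u -> 1 < b -> b <= 2 ->
  (1 - expR (- u))^-1 +
    expR (- (u / (b - 1) / 2)) / (1 - expR (- (u / (b - 1)))) <=
  (1 - expR (- (u / b)))^-1.
Proof.
move=> u0 b1 b2.
have d0 : 0 < b - 1 by rewrite subr_gt0.
have b0 : 0 < b by rewrite (lt_trans ltr01).
pose x := u / b / 2; pose y := u / 2; pose z := u / (b - 1) / 2.
have x0 : 0 < x by rewrite !divr_gt0.
have y0 : 0 < y by rewrite !divr_gt0.
have z0 : 0 < z by rewrite !divr_gt0.
have -> : u / b = x + x by rewrite /x; lra.
have -> : u / (b - 1) / 2 = z by [].
have -> : u / (b - 1) = z + z by rewrite /z; lra.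
have -> : u = y + y by rewrite /y; lra.
have xb : x * b = y by rewrite /x /y mulrAC divfK// gt_eqF.
have zd : z * (b - 1) = y by rewrite /z /y mulrAC divfK// gt_eqF.
have yxz : (y - x) * z = x * y.
  by rewrite -[in LHS]xb -zd; ring.
(* From here on only the three exponentials matter: the products of sinh become
   Laurent polynomials in them. *)
pose A := expR x; pose B := expR y; pose C := expR z.
have A1 : 1 < A by rewrite expR_gt1.
have B1 : 1 < B by rewrite expR_gt1.
have C1 : 1 < C by rewrite expR_gt1.
have A0 : 0 < A := expR_gt0 _; have B0 : 0 < B := expR_gt0 _.
have C0 : 0 < C := expR_gt0 _.
rewrite !opprD !expRD !expRN -/A -/B -/C.
have key : (A - A^-1) * (B - B^-1) <= (B / A - A / B) * (C - C^-1).
  have zy : y <= z by rewrite -zd ler_piMr// ?(ltW z0)//; lra.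
  have yx : y <= 2 * x by rewrite -xb mulrC ler_pM2r.
  have := @cosh_sqr_mono (z + (y - x)) (z - (y - x)) (x + y) (y - x).
  have -> : (z + (y - x)) ^+ 2 - (z - (y - x)) ^+ 2 = 4 * ((y - x) * z) by ring.
  have -> : (x + y) ^+ 2 - (y - x) ^+ 2 = 4 * (x * y) by ring.
  rewrite yxz => /(_ erefl).
  have xy0 : 0 < x * y by rewrite mulr_gt0.
  have -> : (y - x) ^+ 2 <= (x + y) ^+ 2.
    have -> : ((y - x) ^+ 2 <= (x + y) ^+ 2) = (0 <= 4 * (x * y)).
      by rewrite -subr_ge0; congr (_ <= _); ring.
    by rewrite mulr_ge0// ltW.
  have h : (x + y) ^+ 2 <= (z + (y - x)) ^+ 2.
    rewrite -subr_ge0 (_ : _ - _ = z * (z - 2 * (y - x))); last first.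
      transitivity (z ^+ 2 + 2 * ((y - x) * z) - 4 * (x * y)); first by ring.
      rewrite -yxz; ring.
    by rewrite mulr_ge0 ?(ltW z0)//; lra.
  have h' : (y - x) ^+ 2 <= (z - (y - x)) ^+ 2.
    have : (z + (y - x)) ^+ 2 - (z - (y - x)) ^+ 2 = (x + y) ^+ 2 - (y - x) ^+ 2.
      transitivity (4 * ((y - x) * z)); first by ring.
      by rewrite yxz; ring.
    by move: h; lra.
  move=> /(_ isT h h').
  have -> : - (z + (y - x)) = - z - y + x by ring.
  have -> : - (z - (y - x)) = - z + y - x by ring.
  have -> : z - (y - x) = z - y + x by ring.
  have -> : z + (y - x) = z + y - x by ring.
  have -> : - (x + y) = - x - y by ring.
  have -> : - (y - x) = x - y by ring.
  rewrite !expRD !expRN -/A -/B -/C => H.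
  have -> : (A - A^-1) * (B - B^-1) =
      A * B + A^-1 / B - (B / A + A / B) by ring.
  apply: le_trans H _.
  by rewrite le_eqVlt; apply/orP; left; apply/eqP; ring.
have A2 : 0 < A - A^-1 by rewrite subr_gt0 (lt_trans _ A1)// invf_lt1.
have B2 : 0 < B - B^-1 by rewrite subr_gt0 (lt_trans _ B1)// invf_lt1.
have C2 : 0 < C - C^-1 by rewrite subr_gt0 (lt_trans _ C1)// invf_lt1.
have E (w : R) : 1 < w -> (1 - w^-1 / w)^-1 = w / (w - w^-1).
  move=> w1; have w0 : 0 < w by rewrite (lt_trans _ w1).
  have w2 : 0 < w - w^-1 by rewrite subr_gt0 (lt_trans _ w1)// invf_lt1.
  rewrite -[RHS]invrK; congr (_^-1); rewrite invf_div mulrBl mulfV// gt_eqF//.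
rewrite !E//.
have -> : C^-1 * (C / (C - C^-1)) = (C - C^-1)^-1.
  by rewrite mulrA mulVf ?mul1r// gt_eqF.
rewrite addrC -lerBrDr.
have -> : A / (A - A^-1) - B / (B - B^-1) =
   (B / A - A / B) / ((A - A^-1) * (B - B^-1)).
  rewrite -mulNr addf_div ?gt_eqF//; congr (_ / _); field.
  by rewrite !gt_eqF.
rewrite ler_pdivlMr ?mulr_gt0// mulrC ler_pdivrMr//.
Qed.

End hyperbolic.

(** * Quotients of Gamma functions as moment sequences *)

Section rising_factorial.
Context {R : realType}.
Implicit Types (x : R) (m n : nat).

Definition rise x n : R := \prod_(i < n) (x + i%:R).

Lemma rise0 x : rise x 0 = 1. Proof. by rewrite /rise big_ord0. Qed.

Lemma riseS x n : rise x n.+1 = rise x n * (x + n%:R).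
Proof. by rewrite /rise big_ord_recr. Qed.

Lemma rise_gt0 x n : 0 < x -> 0 < rise x n.
Proof. by move=> x0; apply: prodr_gt0 => i _; rewrite ltr_pwDl. Qed.

Lemma riseD x m n : rise x (m + n) = rise x m * rise (x + m%:R) n.
Proof.
elim: n => [|n IH]; first by rewrite addn0 rise0 mulr1.
by rewrite addnS !riseS IH natrD addrA mulrA.
Qed.

Lemma cvg_rise x m :
  (fun n => rise (x + n.+1%:R) m / n.+1%:R ^+ m) @ \oo --> (1 : R).
Proof.
elim: m => [|m IH].
  by under eq_cvg do rewrite rise0 expr0 divr1; exact: cvg_cst.
have c : (fun n => (x + n.+1%:R + m%:R) / n.+1%:R) @ \oo --> (1 : R).
  have h : (fun n => 1 + (x + m%:R) * n.+1%:R^-1) @ \oo --> 1 + (x + m%:R) * 0.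
    apply: cvgD; first exact: cvg_cst.
    by apply: cvgM; [exact: cvg_cst|exact: cvg_harmonic].
  rewrite mulr0 addr0 in h; apply: cvg_trans h.
  apply: near_eq_cvg; apply: nearW => n.
  by rewrite [in RHS]addrAC [in RHS]mulrDl mulfV ?pnatr_eq0// [RHS]addrC.
rewrite -[X in _ --> X]mulr1; apply: cvg_trans _ (cvgM IH c).
by apply: near_eq_cvg; apply: nearW => n; rewrite riseS exprSr -mulf_div.
Qed.

End rising_factorial.

Section exponential_sums.
Context {R : realType}.

Lemma big_iota0 (T : Type) (op : T -> T -> T) (x : T) N (F : nat -> T) :
  \big[op/x]_(k <- iota 0 N) F k = \big[op/x]_(k < N) F k.
Proof. by rewrite -(big_mkord xpredT) /index_iota subn0. Qed.

(** The opposites of the first poles of Gamma (y) and of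
    Gamma ((b - 1) y + 1/2), as functions of [y]. *)
Definition gzeros (b : R) (N1 N2 : nat) : seq R :=
  [seq k%:R | k <- iota 0 N1] ++ [seq (k%:R + 2^-1) / (b - 1) | k <- iota 0 N2].

(** The opposites of the first poles of Gamma (b y), as a function of [y]. *)
Definition gpoles (b : R) (N : nat) : seq R := [seq k%:R / b | k <- iota 0 N].

Lemma sum_expR_geo (u v w : R) N : 0 < u * v ->
  \sum_(z <- [seq k%:R * v + w | k <- iota 0 N]) expR (- (u * z)) =
  expR (- (u * w)) * (1 - expR (- (u * (N%:R * v)))) / (1 - expR (- (u * v))).
Proof.
move=> uv.
have D0 : 1 - expR (- (u * v)) != 0.
  by rewrite gt_eqF// subr_gt0 expR_lt1 oppr_lt0.
rewrite big_map big_iota0.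
have -> : \sum_(i < N) expR (- (u * (i%:R * v + w))) =
    expR (- (u * w)) * \sum_(i < N) expR (- (u * v)) ^+ i.
  rewrite mulr_sumr; apply: eq_bigr => i _.
  by rewrite -expRM_natl -expRD; congr expR; ring.
rewrite -mulrA; congr (_ * _); apply: (mulIf D0); rewrite divfK//.
have := subrXX 1 (expR (- (u * v))) N; rewrite expr1n.
under eq_bigr do rewrite expr1n mul1r.
move=> H; rewrite mulrC -H; congr (_ - _).
by rewrite -expRM_natl; congr expR; ring.
Qed.

(** The three arithmetic progressions have densities 1, b - 1 and b. Cutting
    them near a common height [X] gives every geometric sum the same truncation
    factor [1 - expR (- (u X))], up to roundings that go in the right direction,
    and leaves the inequality between the full series. *)
Lemma gzeros_le_gpoles (b : R) (X u : R) (N1 N2 N3 : nat) :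
  1 < b -> b <= 2 -> 0 < u -> N1%:R <= X -> N2%:R <= (b - 1) * X ->
  b * X <= N3%:R ->
  \sum_(z <- gzeros b N1 N2) expR (- (u * z)) <=
  \sum_(z <- gpoles b N3) expR (- (u * z)).
Proof.
move=> b1 b2 u0 N1X N2X N3X.
have d0 : 0 < b - 1 by rewrite subr_gt0.
have b0 : 0 < b by rewrite (lt_trans ltr01).
have -> : gzeros b N1 N2 = [seq k%:R * 1 + 0 | k <- iota 0 N1] ++
    [seq k%:R * (b - 1)^-1 + (b - 1)^-1 / 2 | k <- iota 0 N2].
  by congr (_ ++ _); apply: eq_map => k; [rewrite mulr1 addr0|rewrite mulrDl [2^-1 * _]mulrC].
have -> : gpoles b N3 = [seq k%:R * b^-1 + 0 | k <- iota 0 N3].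
  by apply: eq_map => k; rewrite addr0.
rewrite big_cat/= !sum_expR_geo ?mulr1 ?mulr0 ?oppr0 ?expR0 ?mul1r ?divr_gt0//.
have := csch_le_cothB u0 b1 b2.
set P := (1 - expR (- u))^-1; set Q := (1 - expR (- (u / (b - 1))))^-1.
set S := (1 - expR (- (u / b)))^-1; set e := expR (- (u / (b - 1) / 2)).
have P0 : 0 <= P by rewrite invr_ge0 subr_ge0 expR_le1 oppr_le0 ltW.
have Q0 : 0 <= Q by rewrite invr_ge0 subr_ge0 expR_le1 oppr_le0 divr_ge0// ltW.
have S0 : 0 <= S by rewrite invr_ge0 subr_ge0 expR_le1 oppr_le0 divr_ge0// ltW.
have e0 : 0 <= e := expR_ge0 _.
rewrite [u * (_ / 2)]mulrA -/e => H.
pose E := 1 - expR (- (u * X)).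
have X0 : 0 <= X by apply: le_trans N1X.
have E0 : 0 <= E by rewrite subr_ge0 expR_le1 oppr_le0 mulr_ge0// ltW.
apply: (@le_trans _ _ (E * (P + e * Q))); last first.
  apply: (@le_trans _ _ (E * S)); first exact: ler_wpM2l.
  apply: ler_wpM2r => //; rewrite lerB// ler_expR lerN2 ler_pM2l//.
  by rewrite ler_pdivlMr// mulrC.
rewrite [leRHS]mulrDr; apply: lerD.
  by apply: ler_wpM2r => //; rewrite lerB// ler_expR lerN2 ler_pM2l.
rewrite -[leLHS]mulrA [leRHS]mulrCA; apply: ler_wpM2l => //; apply: ler_wpM2r => //.
by rewrite lerB// ler_expR lerN2 ler_pM2l// ler_pdivrMr// mulrC.
Qed.

End exponential_sums.

Section gamma_ratio.
Context {R : realType}.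
Variable G : R -> R.
Hypothesis G_gt0 : forall t : R, 0 < t -> 0 < G t.
Hypothesis GS : forall t : R, 0 < t -> G (t + 1) = t * G t.
Hypothesis G_lo : forall s t : R, 2 < s -> 0 <= t -> (s - 1) `^ t * G s <= G (s + t).
Hypothesis G_hi : forall s t : R, 2 < s -> 0 <= t -> G (s + t) <= (s + t) `^ t * G s.

Lemma gamma_rise t n : 0 < t -> G (t + n%:R) = rise t n * G t.
Proof.
move=> t0; elim: n => [|n IH]; first by rewrite addr0 rise0 mul1r.
by rewrite -natr1 addrA GS ?ltr_wpDr// IH riseS mulrCA mulrA.
Qed.

Lemma cvg_powR (u : nat -> R) (k t : R) : 0 < k -> u @ \oo --> k ->
  (fun n => u n `^ t) @ \oo --> k `^ t.
Proof.
move=> k0 uk.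
have u0 : \forall n \near \oo, 0 < u n by exact: cvgr_gt uk _ k0.
have h : (fun n => expR (t * ln (u n))) @ \oo --> expR (t * ln k).
  apply: continuous_cvg; first exact: continuous_expR.
  apply: cvgM; first exact: cvg_cst.
  by apply: continuous_cvg => //; exact: continuous_ln.
rewrite {2}/powR gt_eqF//; apply: cvg_trans h; apply: near_eq_cvg.
by near=> n; rewrite /powR gt_eqF//; near: n.
Unshelve. all: by end_near. Qed.

(** Squeezed between the two Jensen bounds [G_lo] and [G_hi]. *)
Lemma cvg_gamma_ratio (s : nat -> R) (k t : R) : 0 < k -> 0 <= t ->
  (fun n => s n / n.+1%:R) @ \oo --> k ->
  (fun n => G (s n + t) / G (s n) / n.+1%:R `^ t) @ \oo --> k `^ t.
Proof.
move=> k0 t0 sk.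
have shift (c : R) : (fun n => (s n + c) / n.+1%:R) @ \oo --> k.
  have h : (fun n => s n / n.+1%:R + c * n.+1%:R^-1) @ \oo --> k + c * 0.
    by apply: cvgD => //; apply: cvgM; [exact: cvg_cst|exact: cvg_harmonic].
  rewrite mulr0 addr0 in h; apply: cvg_trans h.
  by apply: near_eq_cvg; apply: nearW => n; rewrite mulrDl.
have s2 : \forall n \near \oo, 2 < s n.
  near=> n; rewrite -subr_gt0 -(@pmulr_lgt0 _ n.+1%:R^-1) ?invr_gt0//.
  by near: n; exact: (cvgr_gt _ (shift (-2)) _ k0).
have lo := @cvg_powR _ _ t k0 (shift (-1)).
have hi := @cvg_powR _ _ t k0 (shift t).
apply: (squeeze_cvgr _ lo hi).
near=> n.
have sn2 : 2 < s n by near: n.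
have sn1 : 1 < s n by rewrite (lt_trans _ sn2)// ltr1n.
have sn0 : 0 < s n by rewrite (lt_trans ltr01).
have Gs := G_gt0 sn0.
have n0 : (0 : R) <= n.+1%:R^-1 by rewrite invr_ge0.
have nt : (0 : R) < n.+1%:R `^ t by rewrite powR_gt0.
have inv : (n.+1%:R^-1 : R) `^ t = (n.+1%:R `^ t)^-1.
  by apply: (mulIf (lt0r_neq0 nt)); rewrite mulVf ?lt0r_neq0// -powRM// mulVf ?powR1// pnatr_eq0.
rewrite !powRM// ?subr_ge0 ?(ltW sn1) ?addr_ge0 ?(ltW sn0)// inv.
rewrite !ler_pM2r ?invr_gt0//.
by rewrite ler_pdivlMr// G_lo//= ler_pdivrMr// G_hi.
Unshelve. all: by end_near. Qed.

Lemma cvg_truncn (c k e : R) : 0 < k ->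
  (fun n => (c + (Num.truncn (k * n.+1%:R))%:R + e) / n.+1%:R) @ \oo --> k.
Proof.
move=> k0.
have L (x : R) : (fun n => k + x * n.+1%:R^-1) @ \oo --> k.
  rewrite -[X in _ --> X]addr0 -[X in _ + X](mulr0 x).
  apply: cvgD; first exact: cvg_cst.
  by apply: cvgM; [exact: cvg_cst|exact: cvg_harmonic].
apply: (squeeze_cvgr _ (L (c + e - 1)) (L (c + e))).
apply: nearW => n.
have kn0 : 0 <= k * n.+1%:R by rewrite mulr_ge0// ltW.
have /andP[h1 h2] := truncn_itv kn0.
have n0 : (0 : R) < n.+1%:R by [].
rewrite ler_pdivlMr// ler_pdivrMr// !mulrDl -!mulrA mulVf ?pnatr_eq0// !mulr1.
by move: h1 h2; rewrite -natr1 => h1 h2; apply/andP; split; lra.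
Qed.

(** For [G] the Gamma function, [rise 2^-1 m] is
    G (m + 1/2) / G (1/2): up to a constant this is the value at [y = m + 1/2] of
    G (b y) / (G (y) G ((b - 1) y + 1/2)). *)
Definition gamma_seq (b : R) (m : nat) : R :=
  G (b * (m%:R + 2^-1)) / (G ((b - 1) * (m%:R + 2^-1) + 2^-1) * rise 2^-1 m).

Lemma prod_gzeros (b : R) m N1 N2 : b - 1 != 0 ->
  \prod_(z <- gzeros b N1 N2) (m%:R + 2^-1 + z) =
  rise (m%:R + 2^-1) N1 *
  (((b - 1)^-1) ^+ N2 * rise ((b - 1) * (m%:R + 2^-1) + 2^-1) N2).
Proof.
move=> d0; rewrite big_cat/= !big_map.
rewrite !big_iota0; congr (_ * _).
rewrite -[X in _ ^+ X]card_ord -prodr_const -big_split/=.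
apply: eq_bigr => i _; field.
by rewrite d0.
Qed.

Lemma prod_gpoles (b : R) m N : b != 0 ->
  \prod_(z <- gpoles b N) (m%:R + 2^-1 + z) =
  (b^-1) ^+ N * rise (b * (m%:R + 2^-1)) N.
Proof.
move=> b0; rewrite big_map big_iota0.
rewrite -[X in _ ^+ X]card_ord -prodr_const -big_split/=.
by apply: eq_bigr => i _; field.
Qed.

(** The quotient of the products over [gzeros] and [gpoles] is a moment
    sequence by [hausdorff_ratio]. By the functional equation it is
    [gamma_seq b m] times Gamma quotients at points moved up by about [n + 1]
    times 1, b - 1 and b; as [n] grows these behave like powers of [n + 1] that
    cancel, leaving [D ^- m]. *)
Lemma hausdorff_gamma (b : R) : 1 < b -> b <= 2 ->
  exists2 D, 0 <= D & hausdorff D (gamma_seq b).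
Proof.
move=> b1 b2.
have d0 : 0 < b - 1 by rewrite subr_gt0.
have b0 : 0 < b by rewrite (lt_trans ltr01).
have h0 : 0 < 2^-1 :> R by rewrite invr_gt0.
set d := b - 1 in d0.
(* The exponential growth rate of [gamma_seq b], by Stirling. *)
pose D := b `^ b / d `^ d.
have D0 : 0 < D by rewrite divr_gt0// powR_gt0.
exists D; first exact: ltW.
pose N2 n := Num.truncn (d * n.+1%:R).
pose N3 n := (Num.truncn (b * n.+1%:R)).+1.
pose s2 n := d / 2 + 2^-1 + (N2 n)%:R.
pose s3 n := b / 2 + (N3 n)%:R.
pose K n := rise 2^-1 n.+1 * (d^-1 ^+ N2 n * G (s2 n)) / (b^-1 ^+ N3 n * G (s3 n)).
have s20 n : 0 < s2 n by rewrite ltr_wpDr// addr_gt0// divr_gt0.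
have s30 n : 0 < s3 n by rewrite ltr_wpDr// divr_gt0.
have K0 n : 0 < K n.
  by rewrite divr_gt0 ?mulr_gt0 ?rise_gt0 ?exprn_gt0 ?invr_gt0 ?G_gt0.
pose F n m := \prod_(z <- gzeros b n.+1 (N2 n)) (m%:R + 2^-1 + z) /
              \prod_(z <- gpoles b (N3 n)) (m%:R + 2^-1 + z).
apply: (@hausdorff_lim _ _ (fun n m => D ^+ m * ((K n)^-1 * F n m))) => [n|m].
  rewrite -[X in hausdorff X _]mul1r.
  apply: hausdorff_dilate; first exact: ltW.
  apply: hausdorffZ; first by rewrite invr_ge0 ltW.
  apply: hausdorff_ratio => //.
  - move=> z; rewrite mem_cat => /orP[] /mapP[k _ ->]//.
    by apply: divr_ge0; [rewrite addr_ge0//|exact: ltW d0].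
  - by move=> z /mapP[k _ ->]; rewrite divr_ge0 ?(ltW b0).
  - move=> u u0; apply: (@gzeros_le_gpoles _ _ n.+1%:R) => //.
      have dn : 0 <= d * n.+1%:R by rewrite mulr_ge0// ltW.
      by have /andP[] := truncn_itv dn.
    have bn : 0 <= b * n.+1%:R by rewrite mulr_ge0// ltW.
    by have /andP[_ /ltW] := truncn_itv bn.
pose A n := rise (2^-1 + n.+1%:R) m / n.+1%:R ^+ m : R.
pose B n := G (s2 n + d * m%:R) / G (s2 n) / n.+1%:R `^ (d * m%:R).
pose C n := G (s3 n + b * m%:R) / G (s3 n) / n.+1%:R `^ (b * m%:R).
have cB : B @ \oo --> d `^ (d * m%:R).
  apply: cvg_gamma_ratio => //; first by rewrite mulr_ge0// ltW.
  have := @cvg_truncn (d / 2 + 2^-1) d 0 d0.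
  by under eq_cvg do rewrite addr0.
have cC : C @ \oo --> b `^ (b * m%:R).
  apply: cvg_gamma_ratio => //; first by rewrite mulr_ge0// ltW.
  have := @cvg_truncn (b / 2) b 1 b0.
  by apply: cvg_trans; apply: near_eq_cvg; apply: nearW => n; rewrite /s3 /N3 -[(Num.truncn _).+1%:R]natr1 addrA.
have c : (fun n => D ^+ m * (gamma_seq b m * (A n * B n / C n))) @ \oo -->
    D ^+ m * (gamma_seq b m * (1 * d `^ (d * m%:R) / b `^ (b * m%:R))).
  apply: cvgM; first exact: cvg_cst.
  apply: cvgM; first exact: cvg_cst.
  apply: cvgM; first by apply: cvgM => //; exact: cvg_rise.
  by apply: cvgV => //; rewrite gt_eqF// powR_gt0.
have L : D ^+ m * (gamma_seq b m * (1 * d `^ (d * m%:R) / b `^ (b * m%:R))) = gamma_seq b m.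
  rewrite !powRrM !powR_mulrn ?powR_ge0// mul1r /D.
  rewrite expr_div_n mulrCA; set x := d `^ d ^+ m; set y := b `^ b ^+ m.
  rewrite -[RHS]mulr1; congr (_ * _).
  have x0 : x != 0 by rewrite gt_eqF// exprn_gt0// powR_gt0.
  have y0 : y != 0 by rewrite gt_eqF// exprn_gt0// powR_gt0.
  by field; rewrite x0 y0.
rewrite L in c; apply: cvg_trans c; apply: near_eq_cvg; apply: nearW => n.
congr (_ * _).
have dne : b - 1 != 0 by rewrite gt_eqF.
have bne : b != 0 by rewrite gt_eqF.
rewrite /F prod_gzeros// prod_gpoles//.
have m0 : 0 < m%:R + 2^-1 :> R by rewrite ltr_wpDl.
have E1 : rise (m%:R + 2^-1) n.+1 = rise 2^-1 n.+1 * rise (2^-1 + n.+1%:R) m / rise 2^-1 m :> R.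
  have r0 : rise (2^-1 : R) m != 0 by rewrite gt_eqF// rise_gt0.
  by apply: (mulIf r0); rewrite divfK// -riseD [LHS]mulrC [m%:R + _]addrC -riseD addnC.
have E2 : G (s2 n + d * m%:R) =
    rise (d * (m%:R + 2^-1) + 2^-1) (N2 n) * G (d * (m%:R + 2^-1) + 2^-1).
  rewrite -gamma_rise; last by rewrite addr_gt0// mulr_gt0.
  by congr G; rewrite /s2; ring.
have E3 : G (s3 n + b * m%:R) =
    rise (b * (m%:R + 2^-1)) (N3 n) * G (b * (m%:R + 2^-1)).
  rewrite -gamma_rise; last by rewrite mulr_gt0.
  by congr G; rewrite /s3; ring.
rewrite /A /B /C E1 E2 E3 /K /gamma_seq -/d.
have X0 : n.+1%:R ^+ m * n.+1%:R `^ (d * m%:R) = n.+1%:R `^ (b * m%:R) :> R.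
  rewrite -powR_mulrn// -powRD; last by rewrite pnatr_eq0 implybT.
  by congr (_ `^ _); rewrite /d; ring.
rewrite -X0.
have n1 : n.+1%:R ^+ m != 0 :> R by rewrite expf_neq0// pnatr_eq0.
have n2 : n.+1%:R `^ (d * m%:R) != 0 :> R by rewrite gt_eqF// powR_gt0.
have g1 : G (s2 n) != 0 by rewrite gt_eqF// G_gt0.
have g2 : G (s3 n) != 0 by rewrite gt_eqF// G_gt0.
have g3 : G (d * (m%:R + 2^-1) + 2^-1) != 0.
  by rewrite gt_eqF// G_gt0// addr_gt0// mulr_gt0.
have g4 : G (b * (m%:R + 2^-1)) != 0 by rewrite gt_eqF// G_gt0// mulr_gt0.
have r1 : rise (2^-1 : R) m != 0 by rewrite gt_eqF// rise_gt0.
have r2 : rise (2^-1 : R) n.+1 != 0 by rewrite gt_eqF// rise_gt0.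
have r3 : rise (b * (m%:R + 2^-1)) (N3 n) != 0 by rewrite gt_eqF// rise_gt0// mulr_gt0.
have p1 : d^-1 ^+ N2 n != 0 by rewrite expf_neq0// invr_neq0.
have p2 : b^-1 ^+ N3 n != 0 by rewrite expf_neq0// invr_neq0.
have r4 : rise (2^-1 + n.+1%:R : R) m != 0 by rewrite gt_eqF// rise_gt0.
field.
by rewrite n1 n2 g1 g2 g3 g4 r1 r2 r3 p1 p2.
Qed.

End gamma_ratio.

(** * The squared cosine of a uniform angle *)

Section arcsine_moments.
Context {R : realType}.

Lemma rise1_fact n : rise (1 : R) n = n`!%:R.
Proof.
elim: n => [|n IH]; first by rewrite rise0.
by rewrite riseS IH addrC natr1 factS natrM mulrC.
Qed.

(** These are the moments of the squared cosine of a uniform angle. As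
    [rise 1 m = m`!], the same argument as in [hausdorff_gamma] applies, with
    zeros at the half-integers and poles at the integers, and here the
    comparison of the exponential sums is termwise. *)
Lemma hausdorff_arcsine : hausdorff 1 (fun m => rise (2^-1 : R) m / m`!%:R).
Proof.
pose zs n := [seq k%:R * 1 + 2^-1 : R | k <- iota 0 n.+1].
pose ps n := [seq k%:R * 1 + 0 : R | k <- iota 0 n.+1].
have h0 : 0 < 2^-1 :> R by rewrite invr_gt0.
pose K n : R := rise 1 n.+1 / rise 2^-1 n.+1.
have K0 n : 0 < K n by rewrite divr_gt0// rise_gt0.
pose F n m := \prod_(z <- zs n) (m%:R + 2^-1 + z) /
              \prod_(z <- ps n) (m%:R + 2^-1 + z).
apply: (@hausdorff_lim _ _ (fun n m => (K n)^-1 * F n m)) => [n|m].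
  apply: hausdorffZ; first by rewrite invr_ge0 ltW.
  apply: hausdorff_ratio => //.
  - by move=> z /mapP[k _ ->]; rewrite addr_ge0// mulr1.
  - by move=> z /mapP[k _ ->]; rewrite addr0 mulr1.
  - move=> u u0; rewrite !sum_expR_geo ?mulr1// mulr0 oppr0 expR0 mul1r.
    by rewrite -mulrA ler_piMl// ?divr_ge0 ?subr_ge0 ?expR_le1 ?oppr_le0 ?mulr_ge0 ?(ltW u0)//.
pose A n : R := rise (1 + n.+1%:R) m / n.+1%:R ^+ m.
pose B n : R := rise (2^-1 + n.+1%:R) m / n.+1%:R ^+ m.
have c : (fun n => rise (2^-1 : R) m / m`!%:R * (A n / B n)) @ \oo -->
    rise (2^-1 : R) m / m`!%:R * (1 / 1).
  apply: cvgM; first exact: cvg_cst.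
  by apply: cvgM; [exact: cvg_rise|apply: cvgV; [exact: oner_neq0|exact: cvg_rise]].
rewrite divr1 mulr1 in c; apply: cvg_trans c.
apply: near_eq_cvg; apply: nearW => n.
have -> : F n m = rise (1 + m%:R) n.+1 / rise (2^-1 + m%:R) n.+1.
  by rewrite /F !big_map !big_iota0; congr (_ / _); apply: eq_bigr => k _; field.
have E (x : R) : 0 < x -> rise (x + m%:R) n.+1 = rise x n.+1 * rise (x + n.+1%:R) m / rise x m.
  move=> x0; have r0 : rise x m != 0 by rewrite gt_eqF// rise_gt0.
  by apply: (mulIf r0); rewrite divfK// -riseD mulrC -riseD addnC.
rewrite !E// /A /B /K -rise1_fact.
have n1 : n.+1%:R ^+ m != 0 :> R by rewrite expf_neq0// pnatr_eq0.
have r1 : rise (2^-1 : R) m != 0 by rewrite gt_eqF// rise_gt0.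
have r2 : rise (2^-1 : R) n.+1 != 0 by rewrite gt_eqF// rise_gt0.
have r3 : rise (1 : R) m != 0 by rewrite gt_eqF// rise_gt0.
have r4 : rise (1 : R) n.+1 != 0 by rewrite gt_eqF// rise_gt0.
have r5 : rise (2^-1 + n.+1%:R : R) m != 0 by rewrite gt_eqF// rise_gt0.
by field; rewrite n1 r1 r2 r3 r4 r5.
Qed.

End arcsine_moments.

(** * Formal sums of independent variables *)

Section independent_sums.
Context {R : realType}.
Implicit Types (l : nat -> R) (P Q : {poly R}) (c d : R) (s t : seq R).

(** The formal expectation of [P (x + c * L)], as a polynomial in [x], for a
    variable [L] with moments [l]; this is Taylor expansion in [c * L]. *)
Definition addmom l c P : {poly R} :=
  \sum_(i < size P) (c ^+ i * l i) *: P^`N(i).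

Lemma nderivn_size P i : (size P <= i)%N -> P^`N(i) = 0.
Proof.
move=> Pi; apply/polyP => k; rewrite coef_nderivn coef0 nth_default ?mul0rn//.
exact: leq_trans Pi (leq_addr _ _).
Qed.

Lemma addmom_widen l c P K : (size P <= K)%N ->
  addmom l c P = \sum_(i < K) (c ^+ i * l i) *: P^`N(i).
Proof.
move=> PK; rewrite /addmom.
rewrite (big_ord_widen K (fun i => (c ^+ i * l i) *: P^`N(i)) PK).
rewrite big_mkcond; apply: eq_bigr => i _; case: ifPn => //.
by rewrite -leqNgt => /nderivn_size ->; rewrite scaler0.
Qed.

Lemma addmomD l c P Q : addmom l c (P + Q) = addmom l c P + addmom l c Q.
Proof.
pose K := maxn (size P) (size Q).
have PK : (size P <= K)%N by rewrite leq_maxl.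
have QK : (size Q <= K)%N by rewrite leq_maxr.
have PQK : (size (P + Q)%R <= K)%N by exact: size_polyD.
rewrite (addmom_widen _ _ PK) (addmom_widen _ _ QK) (addmom_widen _ _ PQK).
by rewrite -big_split/=; apply: eq_bigr => i _; rewrite nderivnD scalerDr.
Qed.

Lemma addmomZ l c (a : R) P : addmom l c (a *: P) = a *: addmom l c P.
Proof.
rewrite (@addmom_widen l c (a *: P) (size P)) ?size_scale_leq// scaler_sumr.
by apply: eq_bigr => i _; rewrite nderivnZ !scalerA mulrC.
Qed.

Lemma addmom_size l c P : (size (addmom l c P) <= size P)%N.
Proof.
apply/leq_sizeP => k Pk; rewrite coef_sum big1// => i _.
rewrite coefZ coef_nderivn nth_default ?mul0rn ?mulr0//.
exact: leq_trans Pk (leq_addl _ _).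
Qed.

(** Both sides expand [P (x + c * L + d * L')]; on coefficients this is the
    symmetry of a trinomial coefficient. *)
Lemma addmomC l c d P : addmom l c (addmom l d P) = addmom l d (addmom l c P).
Proof.
have sc e : (size (addmom l e P) <= size P)%N := addmom_size l e P.
rewrite (addmom_widen _ _ (sc d)) (addmom_widen _ _ (sc c)).
rewrite /addmom.
under eq_bigr do rewrite linear_sum scaler_sumr.
under [RHS]eq_bigr do rewrite linear_sum scaler_sumr.
rewrite exchange_big; apply: eq_bigr => i _; apply: eq_bigr => j _.
rewrite /= !nderivnZ !scalerA [in RHS]mulrC; congr (_ *: _).
apply/polyP => k; rewrite !coef_nderivn -!mulrnA.
rewrite addnCA; congr (_ *+ _).
have B (a e : nat) : ('C(a + e, a) * (a`! * e`!) = (a + e)`!)%N.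
  by have := bin_fact (leq_addr e a); rewrite addKn.
have H (a b : nat) :
    ('C(a + k, a) * 'C(b + (a + k), b) * (a`! * b`! * k`!) = (b + (a + k))`!)%N.
  by rewrite -(B b) -(B a); ring.
apply/eqP; rewrite -(eqn_pmul2r (_ : 0 < i`! * j`! * k`!)%N) ?muln_gt0 ?fact_gt0//.
have h1 := H j i; have h2 := H i j; rewrite addnCA in h1.
by apply/eqP; transitivity (j + (i + k))`!; [rewrite -h1|rewrite -h2]; ring.
Qed.

(** The formal expectation of [P (\sum_i s_i * L_i)] for independent variables
    [L_i] with moments [l]. *)
Fixpoint summom l P s : R :=
  if s is c :: s' then summom l (addmom l c P) s' else P.[0].

Lemma summomD l P Q s : summom l (P + Q) s = summom l P s + summom l Q s.
Proof.
by elim: s P Q => [|c s IH] P Q/=; rewrite ?hornerD// addmomD IH.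
Qed.

Lemma summomZ l a P s : summom l (a *: P) s = a * summom l P s.
Proof. by elim: s P => [|c s IH] P/=; rewrite ?hornerZ// addmomZ IH. Qed.

Lemma summom0 l s : summom l 0 s = 0.
Proof. by rewrite -[0](scale0r 0) summomZ mul0r. Qed.

Lemma summom_sum l (I : Type) (r : seq I) (F : I -> {poly R}) s :
  summom l (\sum_(i <- r) F i) s = \sum_(i <- r) summom l (F i) s.
Proof.
elim: r => [|i r IH]; first by rewrite !big_nil summom0.
by rewrite !big_cons summomD IH.
Qed.

Lemma summomE l P s : summom l P s = \sum_(i < size P) P`_i * summom l 'X^i s.
Proof.
rewrite -{1}[P]coefK poly_def summom_sum.
by apply: eq_bigr => i _; rewrite summomZ.
Qed.

Lemma summom_Xn_cons l j c s : summom l 'X^j (c :: s) =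
  \sum_(i < j.+1) 'C(j, i)%:R * c ^+ i * l i * summom l 'X^(j - i) s.
Proof.
rewrite /= /addmom size_polyXn summom_sum; apply: eq_bigr => i _.
rewrite nderivnXn summomZ -scaler_nat summomZ; ring.
Qed.

Lemma summom_perm l P s t : perm_eq s t -> summom l P s = summom l P t.
Proof.
move=> st; move: P.
apply: (@catCA_perm_ind _ (fun t => forall P, summom l P s = summom l P t) _ _ _ st) => //.
move=> s1 s2 s3 H P; rewrite {}H; elim: s1 P => [//|c s1 IH] P.
have push (Q : {poly R}) : summom l Q (s2 ++ c :: s1 ++ s3) =
    summom l (addmom l c Q) (s2 ++ s1 ++ s3).
  by elim: s2 Q {IH} => [//|e s2 IH2] Q /=; rewrite IH2 addmomC.
by rewrite /= IH push.
Qed.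

End independent_sums.

(** * Convexity in the coefficients of a sum of independent variables *)

Section positivity.
Context {R : realType}.
Implicit Types (l : nat -> R) (P : {poly R}) (s v : seq R).

Fixpoint dot s v : R :=
  match s, v with c :: s', x :: v' => c * x + dot s' v' | _, _ => 0 end.

Lemma dot_map (I : Type) (f : I -> R) (r : seq I) v : size v = size r ->
  dot [seq f i | i <- r] v = \sum_(x <- zip r v) f x.1 * x.2.
Proof.
elim: r v => [|i r IH] [|x v]//=; first by rewrite big_nil.
by move=> [rv]; rewrite big_cons IH.
Qed.

Lemma addmom_momentf l c P u : (addmom l c P).[u] =
  momentf l (\poly_(i < size P) (P^`N(i).[u] * c ^+ i)).
Proof.
rewrite momentf_poly /addmom horner_sum; apply: eq_bigr => i _.
by rewrite hornerZ; ring.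
Qed.

Lemma taylor_poly P (c u x : R) :
  (\poly_(i < size P) (P^`N(i).[u] * c ^+ i)).[x] = P.[u + c * x].
Proof.
rewrite horner_poly (nderiv_taylor _ (mulrC _ _)); apply: eq_bigr => i _.
by rewrite exprMn mulrA.
Qed.

(** Each step applies the functional of [l] to one coordinate and turns a family
    of linear forms in [n.+1] variables into a family in [n] variables. A whole
    family of pairs is needed because convexity compares three linear forms at
    once. *)
Lemma summom_ge0 D l n (F : seq ({poly R} * seq R)) : hausdorff D l ->
  (forall q, q \in F -> size q.2 = n) ->
  (forall v, size v = n -> (forall x, x \in v -> 0 <= x <= D) ->
     0 <= \sum_(q <- F) q.1.[dot q.2 v]) ->
  0 <= \sum_(q <- F) summom l q.1 q.2.
Proof.
move=> hl; elim: n F => [|n IH] F Fn F0.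
  have nil0 x : x \in [::] -> 0 <= x <= D by rewrite in_nil.
  have := F0 [::] erefl nil0.
  rewrite !big_seq => H; rewrite (eq_bigr (fun q => q.1.[dot q.2 [::]]))//.
  by move=> [P s] /Fn /size0nil /= ->.
pose F' := [seq (addmom l (head 0 q.2) q.1, behead q.2) | q <- F].
have -> : \sum_(q <- F) summom l q.1 q.2 = \sum_(q <- F') summom l q.1 q.2.
  rewrite big_map big_seq [RHS]big_seq; apply: eq_bigr => q /Fn.
  by case: q => P [|c s].
apply: IH => [q /mapP[q' /Fn q'n ->]|v vn vD]; first by rewrite size_behead q'n.
rewrite big_map.
under eq_bigr do rewrite addmom_momentf.
rewrite -momentf_sum; apply: hl => x xD; rewrite horner_sum.
under eq_bigr do rewrite taylor_poly.
have := F0 (x :: v); rewrite /= vn => /(_ erefl).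
have xvD : forall y, y \in x :: v -> 0 <= y <= D.
  by move=> y; rewrite inE => /orP[/eqP ->//|/vD].
move=> /(_ xvD).
rewrite !big_seq => H; rewrite (eq_bigr (fun q => q.1.[dot q.2 (x :: v)]))//.
by move=> [P [|c s]] /Fn //= _; rewrite addrC.
Qed.

Lemma summom_Xn_scale l j k s :
  summom l 'X^j [seq k * c | c <- s] = k ^+ j * summom l 'X^j s.
Proof.
elim: s j => [|c s IH] j.
  by rewrite /= hornerXn; case: j => [|j]; rewrite ?expr0 ?mulr1// expr0n mulr0.
rewrite map_cons !summom_Xn_cons mulr_sumr; apply: eq_bigr => i _.
have -> : k ^+ j = k ^+ i * k ^+ (j - i) by rewrite -exprD subnKC// -ltnS.
by rewrite IH exprMn; ring.
Qed.

Lemma summom_scale l P k s :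
  summom l P [seq k * c | c <- s] =
  \sum_(j < size P) P`_j * (k ^+ j * summom l 'X^j s).
Proof.
by rewrite summomE; apply: eq_bigr => j _; rewrite summom_Xn_scale.
Qed.

(** The formal expectation of [P (C * \sum_i s_i * L_i)] for a variable [C] with
    moments [tau], independent of the [L_i]. *)
Definition mixmom (tau l : nat -> R) P s : R :=
  momentf tau (\poly_(j < size P) (P`_j * summom l 'X^j s)).

Lemma mixmomE tau l P s : mixmom tau l P s =
  \sum_(j < size P) P`_j * tau j * summom l 'X^j s.
Proof. by rewrite /mixmom momentf_poly; apply: eq_bigr => j _; rewrite mulrAC. Qed.

Definition convex_on (M : R) (f : R -> R) := forall x y t,
  0 <= x <= M -> 0 <= y <= M -> 0 <= t <= 1 ->
  f (t * x + (1 - t) * y) <= t * f x + (1 - t) * f y.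

(** For fixed values of [C] and of the [L_i], all between 0 and their upper
    bounds, the argument of [P] is affine in the coefficients and lies in [0, M],
    where [P] is convex; both functionals preserve the resulting inequality. *)
Lemma mixmom_convex (I : eqType) (tau l : nat -> R) P D M (r : seq I)
    (f g : I -> R) t : hausdorff 1 tau -> hausdorff D l ->
  convex_on M (horner P) ->
  (forall i, 0 <= f i) -> (forall i, 0 <= g i) ->
  D * \sum_(i <- r) f i <= M -> D * \sum_(i <- r) g i <= M -> 0 <= t <= 1 ->
  mixmom tau l P [seq t * f i + (1 - t) * g i | i <- r] <=
  t * mixmom tau l P [seq f i | i <- r] +
  (1 - t) * mixmom tau l P [seq g i | i <- r].
Proof.
move=> htau hl cP f0 g0 fM gM /[dup] t01 /andP[t0 t1].
pose S (h : I -> R) (j : nat) := summom l 'X^j [seq h i | i <- r].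
pose h i := t * f i + (1 - t) * g i.
pose Q := \poly_(j < size P) (P`_j * (t * S f j + (1 - t) * S g j - S h j)).
have QE : momentf tau Q = t * mixmom tau l P [seq f i | i <- r] +
    (1 - t) * mixmom tau l P [seq g i | i <- r] - mixmom tau l P [seq h i | i <- r].
  rewrite momentf_poly !mixmomE !mulr_sumr -big_split -sumrB/=.
  by apply: eq_bigr => j _; rewrite /S; ring.
(* [k] is a value of [C]. *)
rewrite -subr_ge0 -QE; apply: htau => k /andP[k0 k1].
pose fam : seq ({poly R} * seq R) :=
  [:: (t *: P, [seq k * c | c <- [seq f i | i <- r]]);
      ((1 - t) *: P, [seq k * c | c <- [seq g i | i <- r]]);
      ((- 1) *: P, [seq k * c | c <- [seq h i | i <- r]])].
have -> : Q.[k] = \sum_(q <- fam) summom l q.1 q.2.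
  rewrite /fam !big_cons big_nil/= addr0 !summomZ !summom_scale horner_poly.
  rewrite mulN1r !mulr_sumr -sumrB -big_split/=.
  by apply: eq_bigr => j _; rewrite /S; ring.
apply: (@summom_ge0 D l (size r)) => // [q|v vr vD].
  by rewrite !inE => /or3P[] /eqP ->; rewrite /= !size_map.
rewrite /fam !big_cons big_nil/= addr0 !hornerZ.
have dotE (e : I -> R) : dot [seq k * c | c <- [seq e i | i <- r]] v =
    k * \sum_(x <- zip r v) e x.1 * x.2.
  rewrite -map_comp dot_map// mulr_sumr; apply: eq_bigr => x _.
  by rewrite /= mulrA.
have mem_zip x : x \in zip r v -> 0 <= x.2 <= D.
  move=> xrv; apply: vD; have -> : v = unzip2 (zip r v) by rewrite unzip2_zip// vr.
  exact: map_f.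
have bnd (e : I -> R) : (forall i, 0 <= e i) -> D * \sum_(i <- r) e i <= M ->
    0 <= k * \sum_(x <- zip r v) e x.1 * x.2 <= M.
  move=> e0 eM.
  have S0 : 0 <= \sum_(x <- zip r v) e x.1 * x.2.
    by rewrite big_seq sumr_ge0// => x /mem_zip/andP[x0 _]; rewrite mulr_ge0.
  rewrite mulr_ge0//=; apply: le_trans eM.
  apply: (@le_trans _ _ (\sum_(x <- zip r v) e x.1 * x.2)); first by rewrite ler_piMl.
  have -> : D * \sum_(i <- r) e i = \sum_(x <- zip r v) e x.1 * D.
    rewrite -{1}(@unzip1_zip _ _ r v) ?vr// big_map mulr_sumr.
    by apply: eq_bigr => x _; rewrite mulrC.
  rewrite big_seq [leRHS]big_seq; apply: ler_sum => x /mem_zip/andP[_ xD].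
  exact: ler_wpM2l.
rewrite !dotE mulN1r addrA subr_ge0.
have -> : k * \sum_(x <- zip r v) h x.1 * x.2 =
    t * (k * \sum_(x <- zip r v) f x.1 * x.2) +
    (1 - t) * (k * \sum_(x <- zip r v) g x.1 * x.2).
  rewrite !mulr_sumr -big_split/=; apply: eq_bigr => x _; rewrite /h; ring.
exact: cP (bnd _ f0 fM) (bnd _ g0 gM) t01.
Qed.

End positivity.

(** * Symmetric convex functions respect majorization *)

Section schur.
Context {R : realType}.
Variables (n : nat) (G : seq R -> R) (C : R).
Hypothesis G_perm : forall s t, perm_eq s t -> G s = G t.
Hypothesis G_convex : forall (f g : nat -> R) (t : R),
  (forall i, (i < n)%N -> 0 <= f i) -> (forall i, (i < n)%N -> 0 <= g i) ->
  \sum_(i < n) f i = C -> \sum_(i < n) g i = C -> 0 <= t <= 1 ->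
  G (mkseq (fun i => t * f i + (1 - t) * g i) n) <=
  t * G (mkseq f n) + (1 - t) * G (mkseq g n).

Definition transfer (u : nat -> R) (j k : nat) (e : R) : nat -> R :=
  fun i => if i == j then u j - e else if i == k then u k + e else u i.

Lemma sum_transfer (u : nat -> R) j k (e : R) q : j != k ->
  \sum_(i < q) transfer u j k e i =
  \sum_(i < q) u i - e *+ (j < q)%N + e *+ (k < q)%N.
Proof.
move=> jk; elim: q => [|q IH]; first by rewrite !big_ord0 !mulr0n addr0 subr0.
rewrite !big_ord_recr/= IH /transfer !ltnS [(j <= q)%N]leq_eqVlt [(k <= q)%N]leq_eqVlt.
have [->|qj] := eqVneq q j; rewrite ?[k == j]eq_sym ?(negbTE jk)/= ?ltnn.
  by rewrite mulr0n mulr1n; ring.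
rewrite eq_sym in qj; rewrite ?(negbTE qj).
have [->|qk] := eqVneq q k; rewrite /= ?ltnn ?mulr1n ?mulr0n.
  by ring.
by ring.
Qed.

Lemma perm_swap (u : nat -> R) j k : (j < n)%N -> (k < n)%N ->
  perm_eq (mkseq (fun i => u (if i == j then k else if i == k then j else i)) n)
          (mkseq u n).
Proof.
move=> jn kn; pose w (i : nat) := if i == j then k else if i == k then j else i.
have wK : involutive w.
  move=> i; rewrite /w; have [->|ij] := eqVneq i j.
    by have [->|kj] := eqVneq k j; rewrite ?eqxx.
  have [->|ik] := eqVneq i k; first by rewrite eqxx.
  by rewrite (negbTE ij) (negbTE ik).
rewrite /mkseq (map_comp u w); apply: perm_map.
apply: uniq_perm; rewrite ?iota_uniq// ?(map_inj_uniq (inv_inj wK)) ?iota_uniq//.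
have wn i : (i < n)%N -> (w i < n)%N by rewrite /w; case: ifP => // _; case: ifP.
move=> i; rewrite mem_iota/= add0n; apply/mapP/idP => [[i' + ->]|in_].
  by rewrite mem_iota/= add0n => /wn.
by exists (w i); rewrite ?wK// mem_iota/= add0n wn.
Qed.

(** A transfer from a larger to a smaller entry by at most their difference is
    a convex combination of [u] and of [u] with the two entries exchanged, where
    [G] takes the same value. *)
Lemma transfer_le (u : nat -> R) j k (e : R) : (forall i, (i < n)%N -> 0 <= u i) ->
  \sum_(i < n) u i = C -> (j < n)%N -> (k < n)%N -> j != k ->
  0 <= e -> e <= u j - u k -> G (mkseq (transfer u j k e) n) <= G (mkseq u n).
Proof.
move=> u0 uC jn kn jk e0 ejk.
have [E|uE] := eqVneq (u j) (u k).
  have -> : e = 0 by apply/eqP; rewrite eq_le e0 andbT; move: ejk; rewrite E subrr.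
  suff -> : mkseq (transfer u j k 0) n = mkseq u n by [].
  apply: eq_map => i; rewrite /transfer subr0 addr0.
  by case: eqP => [->//|_]; case: eqP => [->|].
have D0 : 0 < u j - u k by rewrite lt_neqAle (le_trans e0 ejk) andbT eq_sym subr_eq0.
pose w (i : nat) := if i == j then k else if i == k then j else i.
(* The weight for which the [j]-th entry of the combination is [u j - e]. *)
pose t := 1 - e / (u j - u k).
have e1 : 0 <= e / (u j - u k) <= 1.
  by rewrite divr_ge0 ?(ltW D0)//= ler_pdivrMr// mul1r.
have t01 : 0 <= t <= 1 by move: e1; rewrite /t => /andP[]; lra.
have wn i : (i < n)%N -> (w i < n)%N by rewrite /w; case: ifP => // _; case: ifP.
have sumw : \sum_(i < n) u (w i) = C.
  have : \sum_(x <- mkseq (u \o w) n) x = \sum_(x <- mkseq u n) x.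
    exact: perm_big (perm_swap u jn kn).
  by rewrite !big_map !big_iota0 -uC.
have := @G_convex u (u \o w) t u0 (fun i ni => u0 _ (wn i ni)) uC sumw t01.
rewrite (G_perm (perm_swap u jn kn)) => H; apply: (le_trans (le_trans _ H)); last first.
  by rewrite -mulrDl addrC subrK mul1r.
rewrite le_eqVlt; apply/orP; left; apply/eqP.
congr (G _); apply: eq_map => i; rewrite /transfer /w /=.
have te : (1 - t) * (u j - u k) = e by rewrite /t subKr divfK// gt_eqF.
case: eqP => [->|_]; first by rewrite -te; ring.
by case: eqP => [->|_]; [rewrite -te; ring|ring].
Qed.

(** The argument of Hardy, Littlewood and Polya. Let [k] be the first index with
    [u k < v k]. Some earlier [j] has [v j < u j], and moving the smaller of the
    excess and the deficit from [j] to [k] makes one more entry agree with [v],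
    keeps all partial sums above those of [v], and does not increase [G]. *)
Lemma majorize_le (u v : nat -> R) :
  (forall i, (i < n)%N -> 0 <= u i) -> (forall i, (i < n)%N -> 0 <= v i) ->
  (forall i j, (i <= j < n)%N -> v j <= v i) ->
  \sum_(i < n) u i = C -> \sum_(i < n) v i = C ->
  (forall q, (q <= n)%N -> \sum_(i < q) v i <= \sum_(i < q) u i) ->
  G (mkseq v n) <= G (mkseq u n).
Proof.
move=> + v0 vs + vC.
pose c (u : nat -> R) := (\sum_(i < n) (u i != v i))%N.
have [N] := ubnP (c u); elim: N u => // N IH u; rewrite ltnS => cuN u0 uC uv.
have [/forallP E|] := boolP [forall i : 'I_n, u i == v i].
  suff -> : mkseq v n = mkseq u n by [].
  apply/eq_in_map => i; rewrite mem_iota/= add0n => ni.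
  by have /eqP := E (Ordinal ni).
rewrite negb_forall => /existsP[i0 ui0].
have : exists k, (k < n)%N && (u k < v k).
  apply: contrapT => H.
  have vu (i : 'I_n) : v i <= u i.
    by rewrite leNgt; apply/negP => ui; apply: H; exists i; rewrite ltn_ord.
  have : \sum_(i < n) (u i - v i) == 0 by rewrite sumrB uC vC subrr.
  rewrite psumr_eq0 => [/allP /(_ i0)|i _]; last by rewrite subr_ge0.
  by rewrite mem_index_enum => /(_ isT); rewrite /= subr_eq0 (negbTE ui0).
move=> /ex_minnP[k /andP[kn ukv] kmin].
have before i : (i < k)%N -> v i <= u i.
  move=> ik; rewrite leNgt; apply/negP => uiv.
  by have := kmin i; rewrite (ltn_trans ik kn) uiv => /(_ isT); rewrite leqNgt ik.
have [j jk ujv] : exists2 j, (j < k)%N & v j < u j.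
  apply: contrapT => H.
  have := uv k.+1 kn; rewrite !big_ord_recr/= leNgt => /negP; apply.
  apply: ler_ltD => //; apply: ler_sum => i _.
  by rewrite leNgt; apply/negP => vui; apply: H; exists i.
have jn : (j < n)%N := ltn_trans jk kn.
have jkne : j != k by rewrite ltn_eqF.
pose e := Num.min (u j - v j) (v k - u k).
have e0 : 0 < e by rewrite lt_min !subr_gt0 ujv.
have e1 : e <= u j - v j by rewrite ge_min lexx.
have e2 : e <= v k - u k by rewrite ge_min lexx orbT.
have vjk : v k <= v j by apply: vs; rewrite (ltnW jk).
pose u' := transfer u j k e.
have u'j : u' j = u j - e by rewrite /u' /transfer eqxx.
have u'k : u' k = u k + e by rewrite /u' /transfer eq_sym (negbTE jkne) eqxx.
have u'i i : i != j -> i != k -> u' i = u i.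
  by move=> ij ik; rewrite /u' /transfer (negbTE ij) (negbTE ik).
apply: (@le_trans _ _ (G (mkseq u' n))); last first.
  by apply: transfer_le => //; lra.
apply: IH.
- apply: leq_trans cuN; rewrite /c.
  have jk' : Ordinal kn != Ordinal jn by rewrite -val_eqE/= eq_sym.
  rewrite (bigD1 (Ordinal jn))//= (bigD1 (Ordinal kn))//=.
  rewrite [X in (_ < X)%N](bigD1 (Ordinal jn))//= [X in (_ < _ + X)%N](bigD1 (Ordinal kn))//=.
  rewrite (gt_eqF ujv) (lt_eqF ukv)/= u'j u'k !addnA.
  rewrite (eq_bigr (fun i : 'I_n => (u i != v i : nat))); last first.
    by move=> i /andP[ij ik]; rewrite u'i.
  rewrite ltn_add2r; rewrite /e /Num.min; case: ifP => _.
    by rewrite subKr eqxx/= ltnS leq_b1.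
  by rewrite [u k + _]addrC subrK eqxx addn0/= ltnS leq_b1.
- move=> i ni; have [->|ij] := eqVneq i j; first by rewrite u'j; have := v0 j jn; lra.
  have [->|ik] := eqVneq i k; first by rewrite u'k; have := u0 k kn; lra.
  by rewrite u'i// u0.
- by rewrite sum_transfer// jn kn mulr1n subrK.
- move=> q qn; rewrite sum_transfer//; have := uv q qn.
  have [kq|qk] := ltnP k q; first by rewrite (ltn_trans jk kq) subrK.
  have [jq|qj] := ltnP j q; last by rewrite subr0 addr0.
  rewrite mulr1n mulr0n addr0 => _; rewrite lerBrDr -lerBrDl -sumrB.
  rewrite (bigD1 (Ordinal jq))//=; apply: (le_trans e1); rewrite lerDl.
  by apply: sumr_ge0 => i _; rewrite subr_ge0 before// (leq_trans _ qk).
Qed.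

End schur.

(** * Convex approximation by Bernstein polynomials *)

Definition convex_fun (R : realType) (f : R -> R) := forall x y t : R, 0 <= t <= 1 ->
  f (t * x + (1 - t) * y) <= t * f x + (1 - t) * f y.

Section convex_functions.
Context {R : realType}.
Variable f : R -> R.
Hypothesis f_convex : convex_fun f.

Lemma convex_slopes a b c : a < b -> b < c ->
  (f b - f a) * (c - b) <= (f c - f b) * (b - a).
Proof.
move=> ab bc; have ac : 0 < c - a by rewrite subr_gt0 (lt_trans ab).
pose t := (c - b) / (c - a).
have t01 : 0 <= t <= 1.
  by rewrite divr_ge0 ?subr_ge0 ?(ltW bc) ?(ltW (lt_trans ab bc))// ler_pdivrMr// mul1r lerB// ltW.
have tE : t * (c - a) = c - b by rewrite divfK// gt_eqF.
have bE : t * a + (1 - t) * c = b.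
  have -> : t * a + (1 - t) * c = c - t * (c - a) by ring.
  by rewrite tE subKr.
have := f_convex a c t01; rewrite bE -(ler_pM2l ac).
have -> : (c - a) * (t * f a + (1 - t) * f c) =
   (t * (c - a)) * f a + ((c - a) - t * (c - a)) * f c by ring.
rewrite tE => H; rewrite -subr_ge0.
have -> : (f c - f b) * (b - a) - (f b - f a) * (c - b) =
  (c - b) * f a + (c - a - (c - b)) * f c - (c - a) * f b by ring.
by rewrite subr_ge0.
Qed.

(** The slopes are bounded by those of the chords over [-1, 0] and
    [M, M + 1], because convexity is assumed on the whole line. *)
Lemma convex_lipschitz M : exists2 L, 0 <= L &
  forall x y, 0 <= x <= M -> 0 <= y <= M -> `|f x - f y| <= L * `|x - y|.
Proof.
pose s := f (M + 1) - f M; pose s' := f 0 - f (-1).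
exists (`|s| + `|s'|); first by rewrite addr_ge0.
suff H x y : 0 <= x -> x < y -> y <= M -> `|f x - f y| <= (`|s| + `|s'|) * `|x - y|.
  move=> x y /andP[x0 xM] /andP[y0 yM].
  have [xy|yx|->] := ltgtP x y; [exact: H| |by rewrite !subrr normr0 mulr0].
  by rewrite distrC [X in _ * X]distrC; exact: H.
move=> x0 xy yM.
have y1 : y < M + 1 by rewrite (le_lt_trans yM)// ltrDl.
have up1 : f M - f y <= s * (M - y).
  move: yM; rewrite le_eqVlt => /predU1P[->|yM]; first by rewrite !subrr mulr0.
  have := @convex_slopes y M (M + 1) yM; rewrite ltrDl ltr01 => /(_ isT).
  by rewrite [M + 1 - M]addrAC subrr add0r mulr1.
have up : f y - f x <= s * (y - x).
  have := convex_slopes xy y1.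
  have D : 0 < M + 1 - y by rewrite subr_gt0.
  move=> /le_trans H; rewrite -(ler_pM2r D) mulrAC; apply: H.
  rewrite ler_wpM2r ?subr_ge0 ?(ltW xy)//.
  have -> : f (M + 1) - f y = s + (f M - f y) by rewrite /s; ring.
  have -> : s * (M + 1 - y) = s + s * (M - y) by ring.
  by rewrite lerD2l.
have lo1 : s' * x <= f x - f 0.
  move: x0; rewrite le_eqVlt => /predU1P[<-|x0]; first by rewrite !subrr mulr0.
  have := @convex_slopes (-1) 0 x; rewrite oppr_lt0 ltr01 => /(_ isT x0).
  by rewrite subr0 opprK add0r mulr1.
have lo : s' * (y - x) <= f y - f x.
  have x1 : -1 < x by rewrite (lt_le_trans _ x0)// oppr_lt0.
  have := convex_slopes x1 xy; rewrite opprK.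
  have D : 0 < x + 1 by rewrite ltr_wpDl.
  move=> H; rewrite -(ler_pM2r D); apply: le_trans H.
  rewrite mulrAC ler_wpM2r ?subr_ge0 ?(ltW xy)//.
  have -> : f x - f (-1) = s' + (f x - f 0) by rewrite /s'; ring.
  have -> : s' * (x + 1) = s' + s' * x by ring.
  by rewrite lerD2l.
have yx0 : 0 <= y - x by rewrite subr_ge0 ltW.
rewrite distrC [X in _ * X]distrC (ger0_norm yx0) ler_norml; apply/andP; split.
  apply: le_trans lo; rewrite -mulNr ler_wpM2r//.
  by have := ler_norm (- s'); rewrite normrN; have := normr_ge0 s; lra.
apply: (le_trans up); rewrite ler_wpM2r//.
by have := ler_norm s; have := normr_ge0 s'; lra.
Qed.

End convex_functions.

Section bernstein.
Context {R : realType}.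
Implicit Types (m : nat -> R) (P Q : {poly R}) (x y z : R).

Definition nonneg_coefs Q := forall k, 0 <= Q`_k.

Lemma nonneg_coefsD P Q : nonneg_coefs P -> nonneg_coefs Q -> nonneg_coefs (P + Q).
Proof. by move=> hP hQ k; rewrite coefD addr_ge0. Qed.

Lemma nonneg_coefsM P Q : nonneg_coefs P -> nonneg_coefs Q -> nonneg_coefs (P * Q).
Proof. by move=> hP hQ k; rewrite coefM sumr_ge0// => i _; rewrite mulr_ge0. Qed.

Lemma nonneg_coefsX P n : nonneg_coefs P -> nonneg_coefs (P ^+ n).
Proof.
move=> hP; elim: n => [|n IH]; last by rewrite exprS; exact: nonneg_coefsM.
by move=> k; rewrite expr0 coef1.
Qed.

(** The generating polynomial of a Bernoulli variable; its powers are those of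
    the binomial variables that define Bernstein polynomials. *)
Definition bernoulli_gf x : {poly R} := (1 - x)%:P + x *: 'X.

Lemma bernoulli_gf_ge0 x : 0 <= x <= 1 -> nonneg_coefs (bernoulli_gf x).
Proof.
move=> /andP[x0 x1] k; rewrite coefD coefC coefZ coefX.
by rewrite addr_ge0//; [case: ifP => // _; rewrite subr_ge0|rewrite mulr_ge0].
Qed.

Definition bernstein (f : R -> R) K : {poly R} :=
  \sum_(k < K.+1) (f (k%:R / K%:R) *+ 'C(K, k)) *: ('X^k * (1 - 'X) ^+ (K - k)).

Lemma horner_bernstein f K x : (bernstein f K).[x] =
  momentf (fun k => f (k%:R / K%:R)) (bernoulli_gf x ^+ K).
Proof.
have -> : bernoulli_gf x ^+ K =
    \poly_(k < K.+1) (((1 - x) ^+ (K - k) * x ^+ k) *+ 'C(K, k)).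
  rewrite exprDn poly_def; apply: eq_bigr => k _.
  by rewrite exprZn -rmorphXn/= mul_polyC scalerA scalerMnl.
rewrite momentf_poly /bernstein horner_sum; apply: eq_bigr => k _.
rewrite hornerZ hornerM hornerXn horner_exp !hornerE.
rewrite -[f _ *+ _]mulr_natr -[(_ * _) *+ _]mulr_natr /=; ring.
Qed.

Lemma momentf_cst a Q : momentf (fun=> a) Q = a * Q.[1].
Proof.
rewrite horner_coef mulr_sumr; apply: eq_bigr => i _.
by rewrite expr1n mulr1 mulrC.
Qed.

Lemma momentf_natM m Q :
  momentf (fun k => k%:R * m k) Q = momentf m ('X * Q^`()).
Proof.
have sQ : (size ('X * Q^`())%R <= (size Q).+1)%N.
  apply: (leq_trans (size_polyMleq _ _)); rewrite size_polyX/=.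
  by rewrite ltnS (leq_trans (size_poly _ _))// leq_pred.
rewrite (momentf_widen _ sQ) (momentf_widen _ (leqnSn (size Q))).
apply: eq_bigr => i _.
rewrite coefXM/=; case: (i : nat) => [|k]; first by rewrite !(mul0r, mulr0).
by rewrite /= coef_deriv -[_ *+ _]mulr_natr; ring.
Qed.

Lemma bernoulli_gf1 x : (bernoulli_gf x).[1] = 1.
Proof. by rewrite !hornerE subrK. Qed.

Lemma deriv_bernoulli_gfX x K :
  (bernoulli_gf x ^+ K)^`() = (K%:R * x) *: bernoulli_gf x ^+ K.-1.
Proof.
rewrite deriv_exp {1}/bernoulli_gf derivD derivC derivZ derivX add0r.
by rewrite mulr_algl -scaler_nat scalerA.
Qed.

(** The expansion at [z] of the generating polynomial of a binomial variable
    as its parameter moves to [y]: the first order term is explicit and the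
    remainder is a square times a polynomial with nonnegative coefficients, which
    pairs with second differences. *)
Lemma bernoulli_gf_tangent y z K : 0 <= y <= 1 -> 0 <= z <= 1 ->
  exists2 Q, nonneg_coefs Q &
  bernoulli_gf y ^+ K = bernoulli_gf z ^+ K +
    (K%:R * (y - z)) *: (('X - 1) * bernoulli_gf z ^+ K.-1) + ('X - 1) ^+ 2 * Q.
Proof.
move=> y01 z01; have ha := bernoulli_gf_ge0 y01; have hb := bernoulli_gf_ge0 z01.
have E : bernoulli_gf y = bernoulli_gf z + (y - z) *: ('X - 1).
  by rewrite /bernoulli_gf -!mul_polyC !polyCB polyC1; ring.
elim: K => [|K [Q hQ IH]].
  exists 0; first by move=> k; rewrite coef0.
  by rewrite !expr0 mul0r scale0r addr0 mulr0 addr0.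
exists (bernoulli_gf y * Q + (K%:R * (y - z) ^+ 2) *: bernoulli_gf z ^+ K.-1).
  apply: nonneg_coefsD; first exact: nonneg_coefsM.
  move=> k; rewrite coefZ mulr_ge0//; first by rewrite mulr_ge0// sqr_ge0.
  exact: nonneg_coefsX.
rewrite exprS {}IH E /=; move: (bernoulli_gf z) (y - z) => b w.
rewrite -!mul_polyC -[K.+1%:R]natr1 !(polyCM, polyCD, polyC_exp, polyC1).
by case: K => [|K]; rewrite /= ?expr0 ?exprS; ring.
Qed.

Lemma momentf_second_difference m Q : nonneg_coefs Q ->
  (forall k, 0 <= m k.+2 - m k.+1 *+ 2 + m k) ->
  0 <= momentf m (('X - 1) ^+ 2 * Q).
Proof.
move=> hQ hm; rewrite -[Q]coefK poly_def mulr_sumr momentf_sum sumr_ge0// => i _.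
rewrite -scalerAr momentfZ mulr_ge0//.
have -> : ('X - 1) ^+ 2 * 'X^i = 'X^(i.+2) + (- 2) *: 'X^(i.+1) + 'X^i :> {poly R}.
  by rewrite -mul_polyC !exprS polyCN; ring.
by rewrite !momentfD momentfZ !momentf_Xn mulNr mulr_natl.
Qed.

End bernstein.

Section bernstein_approximation.
Context {R : realType}.
Implicit Types (f : R -> R).

(** By [bernoulli_gf_tangent] the graph lies above its tangent at every point
    of [0, 1]. *)
Lemma bernstein_convex f K : convex_fun f -> convex_on 1 (horner (bernstein f K)).
Proof.
move=> cf x y t x01 y01 t01; rewrite !horner_bernstein.
set m := fun k => f (k%:R / K%:R).
have m2 k : 0 <= m k.+2 - m k.+1 *+ 2 + m k.
  have h : 0 <= (2^-1 : R) <= 1 by apply/andP; split; lra.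
  have := cf (k.+2%:R / K%:R) (k%:R / K%:R) _ h.
  have -> : 2^-1 * (k.+2%:R / K%:R) + (1 - 2^-1) * (k%:R / K%:R) = k.+1%:R / K%:R :> R.
    by rewrite -!natr1; move: (K%:R^-1 : R) => v; field.
  by rewrite -[m k.+1 *+ 2]mulr_natl -/(m k.+2) -/(m k.+1) -/(m k); lra.
set z := t * x + (1 - t) * y.
have /andP[t0 t1] := t01.
have z01 : 0 <= z <= 1.
  move: x01 y01 => /andP[x0 x1] /andP[y0 y1].
  rewrite addr_ge0 ?mulr_ge0 ?subr_ge0//=.
  have -> : 1 = t * 1 + (1 - t) * 1 :> R by ring.
  by rewrite lerD// ler_wpM2l// subr_ge0.
pose S := K%:R * momentf m (('X - 1) * bernoulli_gf z ^+ K.-1).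
have tangent w : 0 <= w <= 1 ->
    momentf m (bernoulli_gf z ^+ K) + (w - z) * S <= momentf m (bernoulli_gf w ^+ K).
  move=> w01; have [Q hQ ->] := bernoulli_gf_tangent K w01 z01.
  rewrite !momentfD momentfZ -addrA lerD2l.
  have -> : (w - z) * S = K%:R * (w - z) * momentf m (('X - 1) * bernoulli_gf z ^+ K.-1).
    by rewrite /S; ring.
  by rewrite lerDl momentf_second_difference.
have hx := ler_wpM2l t0 (tangent x x01).
have t1' : 0 <= 1 - t by rewrite subr_ge0.
have hy := ler_wpM2l t1' (tangent y y01).
apply: le_trans (lerD hx hy).
rewrite le_eqVlt; apply/orP; left; apply/eqP; rewrite /z; ring.
Qed.

Lemma momentf_variance (x : R) K : (0 < K)%N ->
  momentf (fun k => (k%:R / K%:R - x) ^+ 2) (bernoulli_gf x ^+ K) = x * (1 - x) / K%:R.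
Proof.
move=> K0; set Q := bernoulli_gf x ^+ K.
have K0' : K%:R != 0 :> R by rewrite pnatr_eq0 -lt0n.
have Q1 : Q.[1] = 1 by rewrite horner_exp bernoulli_gf1 expr1n.
have one : momentf (fun=> 1) Q = 1 by rewrite momentf_cst Q1 mul1r.
have first : momentf (fun k => k%:R * 1) Q = K%:R * x.
  rewrite momentf_natM momentf_cst mul1r hornerM hornerX mul1r.
  by rewrite deriv_bernoulli_gfX hornerZ horner_exp bernoulli_gf1 expr1n mulr1.
have second : momentf (fun k => k%:R * (k%:R * 1)) Q =
    K%:R * x * (1 + K.-1%:R * x).
  rewrite !momentf_natM momentf_cst mul1r hornerM hornerX mul1r.
  rewrite derivM derivX mul1r deriv_bernoulli_gfX derivZ deriv_bernoulli_gfX.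
  rewrite !hornerD hornerM hornerX mul1r !hornerZ !horner_exp bernoulli_gf1 !expr1n.
  by ring.
have E : momentf (fun k => (k%:R / K%:R - x) ^+ 2) Q =
    K%:R ^- 2 * momentf (fun k => k%:R * (k%:R * 1)) Q
    - 2 * x / K%:R * momentf (fun k => k%:R * 1) Q + x ^+ 2 * momentf (fun=> 1) Q.
  rewrite /momentf !mulr_sumr -sumrB -big_split/=; apply: eq_bigr => i _.
  by field.
rewrite E first second one.
have -> : K.-1%:R = K%:R - 1 :> R by rewrite -subn1 natrB.
by field.
Qed.

(** Chebyshev in the form [`|d| <= e + e^-1 * d ^+ 2], with the variance of the
    binomial variable. *)
Lemma bernstein_approx f (L x e : R) K : 0 <= x <= 1 -> 0 < e -> (0 < K)%N -> 0 <= L ->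
  (forall y, 0 <= y <= 1 -> `|f y - f x| <= L * `|y - x|) ->
  `|(bernstein f K).[x] - f x| <= L * (e + (e * K%:R)^-1).
Proof.
move=> x01 e0 K0 L0 fL; rewrite horner_bernstein; set Q := bernoulli_gf x ^+ K.
have hQ : nonneg_coefs Q by apply/nonneg_coefsX/bernoulli_gf_ge0.
have Q1 : Q.[1] = 1 by rewrite horner_exp bernoulli_gf1 expr1n.
have sQ : (size Q <= K.+1)%N.
  rewrite (leq_trans (size_poly_exp_leq _ _))// ltnS.
  have : (size (bernoulli_gf x) <= 2)%N.
    rewrite (leq_trans (size_polyD _ _))// geq_max size_polyC (leq_trans (leq_b1 _))//=.
    by rewrite (leq_trans (size_scale_leq _ _))// size_polyX.
  by case: (size _) => [|[|[|]]]// _; rewrite ?mul0n ?mul1n.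
have -> : f x = momentf (fun=> f x) Q by rewrite momentf_cst Q1 mulr1.
rewrite /momentf -sumrB.
apply: (le_trans (ler_norm_sum _ _ _)).
have K0' : 0 < K%:R :> R by rewrite ltr0n.
apply: (@le_trans _ _ (momentf (fun k => L * (e + e^-1 * (k%:R / K%:R - x) ^+ 2)) Q)).
  apply: ler_sum => i _; rewrite -mulrBr normrM (ger0_norm (hQ i)) ler_wpM2l//.
  apply: (le_trans (fL _ _)).
    rewrite divr_ge0//= ler_pdivrMr// mul1r ler_nat -ltnS.
    exact: leq_trans (ltn_ord i) sQ.
  rewrite ler_wpM2l//; set d := _ - x.
  rewrite -(ler_pM2l e0) mulrDr mulrA divff ?gt_eqF// mul1r.
  rewrite -[d ^+ 2]real_normK ?num_real//; have := normr_ge0 d.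
  move: `|d| => w w0; have := sqr_ge0 (e - w); nra.
have -> : momentf (fun k => L * (e + e^-1 * (k%:R / K%:R - x) ^+ 2)) Q =
   L * (momentf (fun=> e) Q + e^-1 * momentf (fun k => (k%:R / K%:R - x) ^+ 2) Q).
  rewrite /momentf mulr_sumr -big_split mulr_sumr/=; apply: eq_bigr => i _; ring.
rewrite momentf_cst Q1 mulr1 momentf_variance// ler_wpM2l// lerD2l.
rewrite invfM ler_wpM2l ?invr_ge0 ?(ltW e0)//.
rewrite -[leRHS]mul1r ler_wpM2r ?invr_ge0//.
by move: x01 => /andP[x0 x1]; nra.
Qed.

(** Bernstein polynomials of [f] rescaled from [0, M] to [0, 1]. The convexity
    of the approximants is what the moment argument requires of them. *)
Lemma convex_poly_approx f (M e : R) : convex_fun f -> 0 < M -> 0 < e ->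
  exists P : {poly R}, convex_on M (horner P) /\
    forall x, 0 <= x <= M -> `|P.[x] - f x| <= e.
Proof.
move=> cf M0 e0; pose g x := f (M * x).
have cg : convex_fun g.
  move=> x y t t01; rewrite /g (_ : M * _ = t * (M * x) + (1 - t) * (M * y)); last by ring.
  exact: cf.
have [L L0 fL] := convex_lipschitz cf M.
(* A Lipschitz constant of [g], made positive to allow the division in [h]. *)
pose L' := L * M + 1.
have L'0 : 0 < L' by rewrite ltr_wpDl// mulr_ge0// ltW.
(* The parameter of [bernstein_approx]; for [K] of order [h ^- 2] both terms of
   its error bound are at most [h]. *)
pose h := e / L' / 2.
have h0 : 0 < h by rewrite !divr_gt0.
pose K := (Num.truncn (h^-1 / h)).+1.
have K0 : 0 < K%:R :> R by rewrite ltr0n.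
have hK : (h * K%:R)^-1 <= h.
  rewrite invfM ler_pdivrMr// mulrC -ler_pdivrMr//; apply: ltW.
  have hh : 0 <= h^-1 / h by rewrite divr_ge0 ?invr_ge0 ?(ltW h0).
  by have /andP[_] := truncn_itv hh.
exists (bernstein g K \Po (M^-1 *: 'X)).
have PE x : (bernstein g K \Po (M^-1 *: 'X)).[x] = (bernstein g K).[x / M].
  by rewrite horner_comp hornerZ hornerX mulrC.
have xM x : 0 <= x <= M -> 0 <= x / M <= 1.
  by move=> /andP[x0 xM]; rewrite divr_ge0 ?(ltW M0)//= ler_pdivrMr// mul1r.
split=> [x y t x0 y0 t0|x x0].
  rewrite !PE (_ : _ / M = t * (x / M) + (1 - t) * (y / M)); last by rewrite mulrDl -!mulrA.
  by apply: bernstein_convex => //; exact: xM.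
rewrite PE; have -> : f x = g (x / M) by rewrite /g mulrCA divff ?mulr1// gt_eqF.
have gL y : 0 <= y <= 1 -> `|g y - g (x / M)| <= L' * `|y - x / M|.
  move=> /andP[y0 y1]; rewrite /g.
  have -> : M * (x / M) = x by rewrite mulrCA divff ?mulr1// gt_eqF.
  apply: (le_trans (fL _ _ _ x0)).
    by rewrite mulr_ge0 ?(ltW M0)//= -[leRHS]mulr1 ler_pM2l.
  have -> : M * y - x = M * (y - x / M).
    by rewrite mulrBr mulrCA divff ?mulr1// gt_eqF.
  rewrite normrM (gtr0_norm M0) mulrA ler_wpM2r// /L'; lra.
apply: (le_trans (bernstein_approx (xM _ x0) h0 _ (ltW L'0) gL)) => //.
apply: (@le_trans _ _ (L' * (h + h))).
  by rewrite ler_pM2l// lerD2l.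
rewrite le_eqVlt; apply/orP; left; apply/eqP.
by rewrite /h; field; rewrite gt_eqF.
Qed.

End bernstein_approximation.

(** * Lebesgue integration on tuples *)

Section tonelli_tuple.
Context {R : realType}.
Local Open Scope ereal_scope.

Lemma ge0_integral_tuple_cons n (f : n.+1.-tuple R -> \bar R) :
  measurable_fun [set: _] f -> (forall x, 0 <= f x) ->
  \int[lebesgue_tuple R n.+1]_x f x =
  \int[lebesgue_measure]_x \int[lebesgue_tuple R n]_t f (tuple_cons (x, t)).
Proof.
move=> mf f0.
have mc := @measurable_tuple_cons R n.
have -> : \int[lebesgue_tuple R n.+1]_x f x =
    \int[(@lebesgue_measure R \x lebesgue_tuple R n)%E]_z f (tuple_cons z).
  rewrite /= /cons_measure.
  by rewrite (ge0_integral_pushforward mc).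
rewrite fubini_tonelli1//.
exact: measurableT_comp mf mc.
Qed.

Lemma measurable_tuple_cons1 n (x : R) :
  measurable_fun setT (fun t : n.-tuple R => tuple_cons ((x : measurableTypeR R), t)).
Proof.
apply/measurable_fun_tnthP => i.
have [j ->|->] := unliftP ord0 i.
  apply: (@eq_measurable_fun _ _ _ _ _ (fun t : n.-tuple R => tnth t j)).
    by move=> t _; rewrite /= tnthS.
  exact: measurable_tnth.
apply: (@eq_measurable_fun _ _ _ _ _ (cst x)).
  by move=> t _; rewrite /= tnth0.
exact: measurable_cst.
Qed.

Lemma integral_tuple0 (f : 0.-tuple R -> \bar R) :
  measurable_fun setT f -> \int[lebesgue_tuple R 0]_x f x = f [tuple].
Proof. by move=> mf; rewrite /= integral_dirac// diracT mul1e. Qed.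

Lemma integral_tuple1 (f : 1.-tuple R -> \bar R) :
  measurable_fun [set: _] f -> (forall x, 0 <= f x) ->
  \int[lebesgue_tuple R 1]_x f x =
  \int[lebesgue_measure]_x f (tuple_cons (x, [tuple])).
Proof.
move=> mf f0; rewrite ge0_integral_tuple_cons//; apply: eq_integral => x _.
rewrite integral_tuple0//.
exact: measurableT_comp mf (@measurable_tuple_cons1 0 x).
Qed.

End tonelli_tuple.

Section line_invariance.
Context {R : realType}.
Local Open Scope ereal_scope.
Local Notation mu := (@lebesgue_measure R).

Lemma ge0_integralN (f : R -> \bar R) : measurable_fun setT f ->
  (forall x, 0 <= f x) -> \int[mu]_x f (- x)%R = \int[mu]_x f x.
Proof.
move=> mf f0.
have mN : measurable_fun setT (-%R : measurableTypeR R -> measurableTypeR R) by [].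
transitivity (\int[pushforward mu (-%R : measurableTypeR R -> measurableTypeR R)]_x f x).
  by rewrite (ge0_integral_pushforward mN).
by apply: eq_measure_integral => A mA _; exact: lebesgue_measureN.
Qed.

Lemma ge0_integral_shift (f : R -> \bar R) (a : R) : measurable_fun setT f ->
  (forall x, 0 <= f x) -> \int[mu]_x f (x + a)%R = \int[mu]_x f x.
Proof.
move=> mf f0.
pose phi (x : measurableTypeR R) : measurableTypeR R := (x + a)%R.
have mphi : measurable_fun setT phi by apply: measurable_funD.
transitivity (\int[pushforward mu phi]_x f x).
  by rewrite (ge0_integral_pushforward mphi).
apply: eq_measure_integral => A mA _; apply/esym/lebesgue_measure_unique => //= _ [[x y]] _ <-.
rewrite /pushforward.
have -> : phi @^-1` `]x, y]%classic = `](x - a)%R, (y - a)%R]%classic.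
  by apply/seteqP; split => z /=; rewrite !in_itv/= ltrBlDr lerBrDr.
rewrite !lebesgue_measure_itv/= !lte_fin ltrD2r.
by case: ifPn => // _; rewrite -!EFinB; congr EFin; ring.
Qed.

(** Uniqueness of Lebesgue measure: the dilated measure, multiplied by the
    factor, gives intervals their length. *)
Lemma ge0_integral_scale (f : R -> \bar R) (a : R) : (0 < a)%R ->
  measurable_fun [set: _] f -> (forall x, 0 <= f x) ->
  \int[mu]_x f (a * x)%R = (a^-1)%:E * \int[mu]_x f x.
Proof.
move=> a0 mf f0.
pose phi (x : measurableTypeR R) : measurableTypeR R := (a * x)%R.
have mphi : measurable_fun setT phi by apply: measurable_funM.
have a0' : (0 <= a^-1)%R by rewrite invr_ge0 ltW.
pose k : {nonneg R} := NngNum a0'.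
transitivity (\int[pushforward mu phi]_x f x).
  by rewrite (ge0_integral_pushforward mphi).
transitivity (\int[mscale k mu]_x f x); last first.
  by rewrite ge0_integral_mscale.
apply: eq_measure_integral => A mA _.
have a0'' : (0 <= a)%R by exact: ltW.
pose k' : {nonneg R} := NngNum a0''.
pose nu : {measure set (measurableTypeR R) -> \bar R} :=
  @measure_function_pushforward__canonical__measure_function_Measure _ _ _ _ _ mu phi mphi.
suff H : mu A = mscale k' nu A.
  transitivity ((a^-1)%:E * mu A); last by [].
  rewrite H; transitivity ((a^-1)%:E * (a%:E * pushforward mu phi A)); last by [].
  by rewrite muleA -EFinM mulVf ?gt_eqF// mul1e.
apply: lebesgue_measure_unique => //= _ [[x y]] _ <-.
transitivity (a%:E * mu (phi @^-1` `]x, y]%classic)); last by [].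
have -> : phi @^-1` `]x, y]%classic = `](x / a)%R, (y / a)%R]%classic.
  by apply/seteqP; split => z /=; rewrite !in_itv/= ltr_pdivrMr// ler_pdivlMr// mulrC.
rewrite !lebesgue_measure_itv/= !lte_fin ltr_pM2r ?invr_gt0//.
case: ifPn => // _; last by rewrite mule0.
by rewrite -!EFinB -EFinM; congr EFin; field; rewrite gt_eqF.
Qed.

End line_invariance.

Section tuple_scaling.
Context {R : realType}.

Lemma measurable_tnth_tuple n (i : 'I_n) :
  measurable_fun setT (fun x : n.-tuple R => tnth x i).
Proof. exact: measurable_tnth. Qed.

Lemma measurable_scale_tuple n (r : R) :
  measurable_fun setT (@scale_tuple R n r).
Proof.
apply/measurable_fun_tnthP => i.
apply: (@eq_measurable_fun _ _ _ _ _ (fun x : n.-tuple R => r * tnth x i)).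
  by move=> x _; rewrite /= tnth_mktuple.
by apply: measurable_funM => //; exact: measurable_tnth.
Qed.

Lemma tnth_scale n (r : R) (x : n.-tuple R) i : tnth (scale_tuple r x) i = r * tnth x i.
Proof. by rewrite tnth_mktuple. Qed.

Lemma scale_tuple_cons n (r x : R) (t : n.-tuple R) :
  scale_tuple r (tuple_cons ((x : measurableTypeR R), t)) =
  tuple_cons ((r * x : measurableTypeR R), scale_tuple r t).
Proof.
apply: eq_from_tnth => i; rewrite tnth_scale.
by have [j ->|->] := unliftP ord0 i; rewrite ?tnth0// !tnthS tnth_scale.
Qed.

Lemma ge0_integral_tuple_scale n (f : n.-tuple R -> \bar R) (r : R) : 0 < r ->
  measurable_fun setT f -> (forall x, 0 <= f x)%E ->
  (\int[lebesgue_tuple R n]_x f (scale_tuple r x) =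
   (r ^- n)%:E * \int[lebesgue_tuple R n]_x f x)%E.
Proof.
move=> r0; elim: n f => [|n IH] f mf f0.
  rewrite expr0 invr1 mul1e !integral_tuple0//; last first.
    exact: measurableT_comp mf (measurable_scale_tuple _).
  by congr f; apply: eq_from_tnth => -[].
rewrite ge0_integral_tuple_cons//; last first.
  exact: measurableT_comp mf (measurable_scale_tuple _).
under eq_integral => x _.
  under eq_integral do rewrite scale_tuple_cons.
  rewrite (IH (fun t => f (tuple_cons ((r * x : measurableTypeR R), t))))//; last first.
    exact: measurableT_comp mf (measurable_tuple_cons1 _).
  over.
have mF : measurable_fun setT (fun x : measurableTypeR R =>
    \int[lebesgue_tuple R n]_t f (tuple_cons (x, t)))%E.
  have mc := @measurable_tuple_cons R n.
  by apply: (measurable_fun_fubini_tonelli_F (f \o @tuple_cons R n)) => //=; exact: measurableT_comp mf mc.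
have rn0 : 0 <= r ^- n by rewrite invr_ge0 exprn_ge0// ltW.
have mr : measurable_fun setT (fun x : measurableTypeR R => (r * x : measurableTypeR R)).
  exact: measurable_funM.
rewrite ge0_integralZl_EFin//; last 2 first.
- by move=> x _; apply: integral_ge0.
- exact: measurableT_comp mF mr.
have F0 (x : R) : (0 <= \int[lebesgue_tuple R n]_t f (tuple_cons ((x : measurableTypeR R), t)))%E.
  exact: integral_ge0.
transitivity ((r ^- n)%:E * (r^-1%:E * \int[lebesgue_measure]_x
    \int[lebesgue_tuple R n]_t f (tuple_cons ((x : measurableTypeR R), t))))%E.
  by congr (_ * _)%E; exact: (ge0_integral_scale r0 mF F0).
rewrite -ge0_integral_tuple_cons// muleA -EFinM; congr (_%:E * _)%E.
by rewrite exprSr invfM mulrC.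
Qed.

End tuple_scaling.

(** * The Gamma integral and Jensen bounds *)

Section real_integrands.
Context d (T : measurableType d) (R : realType) (mu : {measure set T -> \bar R}).
Implicit Types (f g : T -> R).

Lemma ge0_integral_mulr f (k : R) : measurable_fun setT f ->
  (forall x, 0 <= f x) -> 0 <= k ->
  (\int[mu]_x (k * f x)%:E = k%:E * \int[mu]_x (f x)%:E)%E.
Proof.
move=> mf f0 k0.
rewrite -(ge0_integralZl_EFin mu measurableT (f1 := EFin \o f) _ _ k0)//.
  by move=> x _; rewrite /= lee_fin.
exact/measurable_EFinP.
Qed.

Lemma ge0_integral_addr f g : measurable_fun setT f -> measurable_fun setT g ->
  (forall x, 0 <= f x) -> (forall x, 0 <= g x) ->
  (\int[mu]_x (f x + g x)%:E = \int[mu]_x (f x)%:E + \int[mu]_x (g x)%:E)%E.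
Proof.
move=> mf mg f0 g0.
rewrite -(ge0_integralD mu measurableT (f1 := EFin \o f) (f2 := EFin \o g))//.
- by move=> x _; rewrite /= lee_fin.
- exact/measurable_EFinP.
- by move=> x _; rewrite /= lee_fin.
- exact/measurable_EFinP.
Qed.

Lemma ge0_integral_sumr n (f : 'I_n -> T -> R) :
  (forall i, measurable_fun setT (f i)) -> (forall i x, 0 <= f i x) ->
  (\int[mu]_x (\sum_(i < n) f i x)%:E = \sum_(i < n) \int[mu]_x (f i x)%:E)%E.
Proof.
move=> mf f0.
rewrite -(ge0_integral_sum mu measurableT (f := fun i => EFin \o f i)).
- by apply: eq_integral => x _; rewrite sumEFin.
- by move=> i; exact/measurable_EFinP.
- by move=> i x _; rewrite /= lee_fin.
Qed.

Lemma ge0_le_integralr f g : measurable_fun setT f -> measurable_fun setT g ->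
  (forall x, 0 <= f x) -> (forall x, f x <= g x) ->
  (\int[mu]_x (f x)%:E <= \int[mu]_x (g x)%:E)%E.
Proof.
move=> mf mg f0 fg; apply: ge0_le_integral => //.
- by move=> x _; rewrite lee_fin.
- exact/measurable_EFinP.
- exact/measurable_EFinP.
- by move=> x _; rewrite lee_fin.
Qed.

End real_integrands.

Section gamma_integral.
Context {R : realType}.
Local Notation mu := (@lebesgue_measure R).
Implicit Types (s t c : R).

Lemma ge0_integral_except (a : R) (f g : R -> \bar R) :
  measurable_fun setT f -> measurable_fun setT g ->
  (forall x, 0 <= f x)%E -> (forall x, 0 <= g x)%E ->
  (forall x, x != a -> f x = g x) ->
  (\int[mu]_x f x = \int[mu]_x g x)%E.
Proof.
move=> mf mg f0 g0 fg; apply: ge0_ae_eq_integral => //.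
exists [set a]; split; [exact: measurable_set1|exact: lebesgue_measure_set1|].
by move=> x /= H; apply: contrapT => /eqP xa; apply: H => _; exact: fg.
Qed.

Lemma integral_powR s c : 1 <= s -> 0 < c ->
  (\int[mu]_t (if (0 < t) && (t < c) then t `^ (s - 1) else 0)%:E = (c `^ s / s)%:E)%E.
Proof.
move=> s1 c0; have s0 : 0 < s by rewrite (lt_le_trans ltr01).
have E (t : R) : (if (0 < t) && (t < c) then t `^ (s - 1) else 0)%:E =
    ((fun t => (t `^ (s - 1))%:E) \_ `]0, c[%classic) t.
  by rewrite patchE mem_setE in_itv/=; case: ifP.
under eq_integral do rewrite E.
rewrite -integral_mkcond.
rewrite -(@integral_itv_bndoo _ 0 c _ true false); last first.
  by apply/measurable_EFinP; apply: measurable_funTS; exact: measurable_powR.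
rewrite (@continuous_FTC2 _ _ (fun t => t `^ s / s))//.
- by rewrite powR0 ?gt_eqF// mul0r sube0.
- apply/continuous_within_itvP => //; split.
  + move=> x; rewrite in_itv/= => /andP[x0 _].
    have : derivable (fun x => x `^ (s - 1)) x 1.
      by apply: derivable_powR; rewrite in_itv/= x0.
    by move=> /derivable1_diffP/differentiable_continuous.
  + have [->|s1'] := eqVneq s 1.
      by rewrite subrr; under eq_cvg do rewrite powRr0; rewrite powRr0; exact: cvg_cst.
    rewrite powR0 ?subr_eq0//; apply: powR_cvg0.
    by rewrite subr_gt0 lt_neqAle eq_sym s1'.
  + apply: cvg_at_left_filter.
    have : derivable (fun x => x `^ (s - 1)) c 1.
      by apply: derivable_powR; rewrite in_itv/= c0.
    by move=> /derivable1_diffP/differentiable_continuous.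
- have dF x : 0 < x -> derivable (fun t => t `^ s / s) x 1.
    move=> x0; apply: derivableM => //.
    by apply: derivable_powR; rewrite in_itv/= x0.
  split.
  + by move=> x; rewrite in_itv/= => /andP[x0 _]; exact: dF.
  + rewrite powR0 ?gt_eqF// mul0r -[X in _ --> X](mul0r s^-1).
    by apply: cvgM; [exact: powR_cvg0|exact: cvg_cst].
  + by apply: cvg_at_left_filter; have /derivable1_diffP/differentiable_continuous := dF _ c0.
- move=> x; rewrite in_itv/= => /andP[x0 _].
  rewrite derive1Mr; last by apply: derivable_powR; rewrite in_itv/= x0.
  rewrite powR_derive1 ?in_itv/= ?x0//.
  by rewrite mulrAC divff ?mul1r// gt_eqF.
Qed.

(** The density of the Gamma integral, in which [s] is the usual exponent
    parameter. *)
Definition gfun s c : R := if 0 < c then expR (- c) * c `^ (s - 1) else 0.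

Lemma gfun_ge0 s c : 0 <= gfun s c.
Proof. by rewrite /gfun; case: ifP => // _; rewrite mulr_ge0 ?expR_ge0 ?powR_ge0. Qed.

Lemma measurable_pos_bool : measurable_fun setT (fun c : R => 0 < c).
Proof. by apply: measurable_fun_ltr => //; exact: measurable_cst. Qed.

Lemma measurable_gfun s : measurable_fun setT (gfun s).
Proof.
apply: measurable_fun_ifT => //; first exact: measurable_pos_bool.
apply: measurable_funM; last exact: measurable_powR.
exact: measurableT_comp.
Qed.

Definition egamma s : \bar R := (\int[mu]_c (gfun s c)%:E)%E.

Lemma egamma_ge0 s : (0 <= egamma s)%E.
Proof. by apply: integral_ge0 => c _; rewrite lee_fin gfun_ge0. Qed.

Lemma egamma1 : egamma 1 = 1%E.
Proof.
rewrite /egamma -(@integral_exponential_pdf R 1 ltr01).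
apply: (@ge0_integral_except 0).
- by apply/measurable_EFinP; exact: measurable_gfun.
- by apply/measurable_EFinP; exact: measurable_exponential_pdf.
- by move=> c; rewrite lee_fin gfun_ge0.
- by move=> c; rewrite lee_fin exponential_pdf_ge0.
- move=> c c0; rewrite /gfun; case: ltP => [c0'|].
    by rewrite exponential_pdfE ?(ltW c0')// subrr powRr0 mulr1 mul1r mulN1r.
  rewrite le_eqVlt (negbTE c0)/= => c0'.
  by rewrite lt0_exponential_pdf.
Qed.

Lemma integral_expR_tail t :
  (\int[mu]_c (if (t < c) then expR (- c) else 0)%:E = (expR (- t))%:E)%E.
Proof.
have m c : measurable_fun setT (fun c' => if c < c' then expR (- c') else 0).
  apply: measurable_fun_ifT => //; last exact: measurableT_comp.
  by apply: measurable_fun_ltr => //; exact: measurable_cst.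
have p (c c' : R) : 0 <= (if c < c' then expR (- c') else 0).
  by case: ifP => // _; exact: expR_ge0.
rewrite -(@ge0_integral_shift _ _ t); last 2 first.
- exact/measurable_EFinP.
- by move=> c; rewrite lee_fin.
rewrite -[RHS]mule1 -egamma1.
rewrite -(ge0_integral_mulr mu (measurable_gfun 1) (gfun_ge0 1) (expR_ge0 _)).
apply: eq_integral => c _; congr EFin; rewrite /gfun ltrDr.
case: ifP => _; last by rewrite mulr0.
by rewrite subrr powRr0 mulr1 -expRD; congr expR; ring.
Qed.

(** Write [c `^ s] as the integral of its derivative and exchange the two
    integrals. *)
Lemma egammaS s : 1 <= s -> egamma (s + 1) = (s%:E * egamma s)%E.
Proof.
move=> s1; have s0 : 0 < s by rewrite (lt_le_trans ltr01).
pose h (z : measurableTypeR R * measurableTypeR R) : \bar R :=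
  (if (0 < z.2) && (z.2 < z.1) then expR (- z.1) * (s * z.2 `^ (s - 1)) else 0)%:E.
have h0 z : (0 <= h z)%E.
  rewrite lee_fin; case: ifP => // _.
  by rewrite !mulr_ge0 ?expR_ge0 ?powR_ge0 ?(ltW s0).
have m1 : measurable_fun setT (fun z : measurableTypeR R * measurableTypeR R => z.1 : R).
  exact: measurable_fst.
have m2 : measurable_fun setT (fun z : measurableTypeR R * measurableTypeR R => z.2 : R).
  exact: measurable_snd.
have mh : measurable_fun setT h.
  apply/measurable_EFinP; apply: measurable_fun_ifT => //.
    apply: measurable_and; last exact: measurable_fun_ltr.
    by apply: measurable_fun_ltr => //; exact: measurable_cst.
  apply: measurable_funM.
    by apply: measurableT_comp => //; exact: measurableT_comp.
  apply: measurable_funM; first exact: measurable_cst.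
  exact: (measurableT_comp (measurable_powR _) m2).
have mtail (a : R) : measurable_fun setT (fun c => if a < c then expR (- c) else 0).
  apply: measurable_fun_ifT => //; last exact: measurableT_comp.
  by apply: measurable_fun_ltr => //; exact: measurable_cst.
have ptail (a c : R) : 0 <= (if a < c then expR (- c) else 0).
  by case: ifP => // _; exact: expR_ge0.
have mpow (c : R) : measurable_fun setT
    (fun t => if (0 < t) && (t < c) then t `^ (s - 1) else 0).
  apply: measurable_fun_ifT => //.
  by apply: measurable_and; apply: measurable_fun_ltr => //; exact: measurable_cst.
have ppow (c t : R) : 0 <= (if (0 < t) && (t < c) then t `^ (s - 1) else 0).
  by case: ifP => // _; exact: powR_ge0.
have H := @fubini_tonelli _ _ (measurableTypeR R) (measurableTypeR R) R mu mu h mh h0.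
rewrite -(ge0_integral_mulr mu (measurable_gfun s) (gfun_ge0 s) (ltW s0)).
transitivity (\int[mu]_x \int[mu]_y h (x, y))%E.
  apply: eq_integral => c _; rewrite /gfun addrK.
  have [c0|c0] := ltP 0 c; last first.
    apply/esym; apply: integral0_eq => t _; rewrite /h/=.
    have [t0|//] := ltP 0 t.
    by have /negbTE -> : ~~ (t < c) by rewrite -leNgt (le_trans c0 (ltW t0)).
  have es : 0 <= expR (- c) * s := mulr_ge0 (expR_ge0 _) (ltW s0).
  transitivity ((expR (- c) * s)%:E * (c `^ s / s)%:E)%E.
    by rewrite -EFinM; congr EFin; field; rewrite gt_eqF.
  rewrite -(integral_powR s1 c0) -(ge0_integral_mulr mu (mpow c) (ppow c) es).
  apply: eq_integral => t _; rewrite /h/=; congr EFin.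
  by case: ifP => _; [rewrite mulrA|rewrite mulr0].
rewrite H; apply: eq_integral => t _; rewrite /h/= /gfun.
have [t0|t0] := ltP 0 t; last by rewrite mulr0; exact: integral0.
have es : 0 <= s * t `^ (s - 1) := mulr_ge0 (ltW s0) (powR_ge0 _ _).
transitivity ((s * t `^ (s - 1))%:E * (expR (- t))%:E)%E; last first.
  by rewrite -EFinM; congr EFin; ring.
rewrite -integral_expR_tail -(ge0_integral_mulr mu (mtail t) (ptail t) es).
apply: eq_integral => c _; congr EFin; rewrite /=.
by case: ifP => _; [rewrite mulrC|rewrite mulr0].
Qed.

End gamma_integral.

Section gamma_function.
Context {R : realType}.
Local Notation mu := (@lebesgue_measure R).
Implicit Types (s t c : R).

Lemma egamma_nat n : (@egamma R n.+1%:R < +oo)%E.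
Proof.
elim: n => [|n IH]; first by rewrite egamma1 ltry.
rewrite -natr1 egammaS ?ler1n//.
by rewrite lte_mul_pinfty// lee_fin.
Qed.

(** The density is dominated by the sum of two densities with integer
    parameters, one for [c <= 1] and one for [1 < c]. *)
Lemma egamma_lty s : 1 <= s -> (egamma s < +oo)%E.
Proof.
move=> s1; have s0 : 0 <= s - 1 by rewrite subr_ge0.
pose N := Num.truncn (s - 1).
have sN : s - 1 <= N.+1%:R by have /andP[_ /ltW] := truncn_itv s0.
apply: (@le_lt_trans _ _ (egamma 1 + egamma N.+2%:R)%E); last first.
  by rewrite egamma1 lte_add_pinfty// ?ltry// egamma_nat.
rewrite /egamma -ge0_integral_addr; last 4 first.
- exact: measurable_gfun.
- exact: measurable_gfun.
- exact: gfun_ge0.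
- exact: gfun_ge0.
apply: ge0_le_integralr.
- exact: measurable_gfun.
- by apply: measurable_funD; exact: measurable_gfun.
- exact: gfun_ge0.
move=> c; rewrite /gfun; case: ifP => [c0|_]; last by rewrite addr0.
rewrite -mulrDr ler_wpM2l ?expR_ge0// subrr powRr0.
have [c1|c1] := leP c 1.
  apply: (@le_trans _ _ 1); last by rewrite lerDl powR_ge0.
  by rewrite -[leRHS](powRr0 c) ger_powR ?c0.
apply: (@le_trans _ _ (c `^ (N.+2%:R - 1))); last by rewrite lerDr.
by rewrite ler_powR ?(ltW c1)// -natr1 addrK.
Qed.

Lemma egamma_gt0 s : 1 <= s -> (0 < egamma s)%E.
Proof.
move=> s1; apply: (@lt_le_trans _ _ (expR (- 1))%:E); first by rewrite lte_fin expR_gt0.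
rewrite -integral_expR_tail; apply: ge0_le_integralr.
- apply: measurable_fun_ifT => //; last exact: measurableT_comp.
  by apply: measurable_fun_ltr => //; exact: measurable_cst.
- exact: measurable_gfun.
- by move=> c; case: ifP => // _; exact: expR_ge0.
move=> c; rewrite /gfun; case: ifP => [c1|_]; last exact: gfun_ge0.
rewrite (lt_trans ltr01 c1) ler_peMr ?expR_ge0//.
by rewrite -[leLHS](powRr0 c) ler_powR ?subr_ge0// ltW.
Qed.

Lemma egamma_fin s : 1 <= s -> egamma s \is a fin_num.
Proof. by move=> s1; rewrite ge0_fin_numE ?egamma_ge0// egamma_lty. Qed.

(** The Gamma function. Dividing the integral at [s + 1] by [s] covers [0 < s]
    with integrands that are bounded near 0. *)
Definition rgamma s : R := fine (egamma (s + 1)) / s.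

Lemma rgammaE s : 1 <= s -> (rgamma s)%:E = egamma s.
Proof.
move=> s1; have s0 : 0 < s by rewrite (lt_le_trans ltr01).
rewrite -(fineK (egamma_fin s1)) /rgamma egammaS// -(fineK (egamma_fin s1)).
by rewrite -EFinM/= mulrAC divff ?mul1r// gt_eqF.
Qed.

Lemma rgamma_gt0 s : 0 < s -> 0 < rgamma s.
Proof.
move=> s0; have s1 : 1 <= s + 1 by rewrite lerDr ltW.
by rewrite divr_gt0// fine_gt0// egamma_gt0//= egamma_lty.
Qed.

Lemma rgammaS s : 0 < s -> rgamma (s + 1) = s * rgamma s.
Proof.
move=> s0; have s1 : 1 <= s + 1 by rewrite lerDr ltW.
apply: EFin_inj; rewrite rgammaE// /rgamma mulrCA divff ?gt_eqF// mulr1.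
by rewrite fineK// egamma_fin.
Qed.

Lemma powRN_tangent (v t : R) : 0 < v -> 0 <= t -> 1 - t * (v - 1) <= v `^ (- t).
Proof.
move=> v0 t0; rewrite /powR gt_eqF//.
apply: (@le_trans _ _ (1 + - t * ln v)); last exact: expR_ge1Dx.
rewrite mulNr lerD2l lerN2 ler_wpM2l//.
have := @le_ln1Dx R (v - 1); rewrite [1 + _]addrC subrK; apply.
by rewrite ltrBrDr addrC subrr.
Qed.

Lemma gfun_shift s t c : gfun (s + t) c = c `^ t * gfun s c.
Proof.
rewrite /gfun; case: ifP => [c0|_]; last by rewrite mulr0.
rewrite mulrCA; congr (_ * _); rewrite -powRD; last by rewrite (gt_eqF c0) implybT.
by congr (_ `^ _); ring.
Qed.

Lemma measurable_gfunZ (k s : R) : measurable_fun setT (fun c => k * gfun s c).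
Proof. by apply: measurable_funM; [exact: measurable_cst|exact: measurable_gfun]. Qed.

(** Jensen for the probability density proportional to [gfun s] and the convex
    function [v |-> v `^ (- t)] of [v = c^-1], whose mean is [(s - 1)^-1]; the
    inequality is integrated from the tangent at that mean. *)
Lemma rgamma_lo s t : 2 < s -> 0 <= t -> (s - 1) `^ t * rgamma s <= rgamma (s + t).
Proof.
move=> s2 t0; have s1 : 1 < s by rewrite (lt_trans _ s2)// ltr1n.
have u0 : 0 < s - 1 by rewrite subr_gt0.
have s11 : 1 <= s - 1 by lra.
set K := (s - 1) `^ t.
have K0 : 0 <= K by exact: powR_ge0.
have kt0 : 0 <= K * t * (s - 1) by rewrite !mulr_ge0// ltW.
have kt1 : 0 <= K * (1 + t) by rewrite mulr_ge0// addr_ge0.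
have key : ((K * (1 + t))%:E * egamma s <=
    egamma (s + t) + (K * t * (s - 1))%:E * egamma (s - 1))%E.
  rewrite /egamma -!(ge0_integral_mulr mu (measurable_gfun _) (gfun_ge0 _))//.
  rewrite -ge0_integral_addr; last 4 first.
  - exact: measurable_gfun.
  - exact: measurable_gfunZ.
  - exact: gfun_ge0.
  - by move=> c; rewrite mulr_ge0// gfun_ge0.
  apply: ge0_le_integralr.
  - exact: measurable_gfunZ.
  - by apply: measurable_funD; [exact: measurable_gfun|exact: measurable_gfunZ].
  - by move=> c; rewrite mulr_ge0// gfun_ge0.
  move=> c; rewrite gfun_shift.
  have [c0|c0] := ltP 0 c; last first.
    by rewrite /gfun ltNge c0 /= !mulr0 addr0.
  have -> : gfun (s - 1) c = c^-1 * gfun s c.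
    by rewrite gfun_shift -powR_inv1// ltW.
  have v0 : 0 < (s - 1) / c by rewrite divr_gt0.
  have := powRN_tangent v0 t0.
  have -> : ((s - 1) / c) `^ (- t) = c `^ t / K.
    rewrite powRN powRM ?invr_ge0 ?(ltW u0) ?(ltW c0)// invfM mulrC; congr (_ * _).
    by rewrite -[c^-1]powR_inv1 ?(ltW c0)// -powRrM mulN1r powRN invrK.
  have K1 : 0 < K by rewrite powR_gt0.
  rewrite ler_pdivlMr// => H.
  have g0 : 0 <= gfun s c := gfun_ge0 _ _.
  have := ler_wpM2r g0 H; rewrite -subr_ge0 => H'; rewrite -subr_ge0.
  apply: le_trans H' _; rewrite le_eqVlt; apply/orP; left; apply/eqP; ring.
have e1 : (egamma s = (s - 1)%:E * egamma (s - 1))%E.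
  by rewrite -[in LHS](subrK 1 s) egammaS.
move: key; rewrite !EFinM -!muleA -e1 -!rgammaE ?(ltW s1)//; last first.
  by rewrite (le_trans (ltW s1))// lerDl.
rewrite -!EFinM -EFinD lee_fin => H; rewrite -subr_ge0; move: H; rewrite -subr_ge0.
move=> H; apply: le_trans H _; rewrite le_eqVlt; apply/orP; left; apply/eqP; ring.
Qed.

(** Jensen as in [rgamma_lo], now for the density proportional to
    [gfun (s + t)] and the variable [c], whose mean is [s + t]. *)
Lemma rgamma_hi s t : 2 < s -> 0 <= t -> rgamma (s + t) <= (s + t) `^ t * rgamma s.
Proof.
move=> s2 t0; have s1 : 1 < s by rewrite (lt_trans _ s2)// ltr1n.
set r := s + t.
have r1 : 1 < r by rewrite (lt_le_trans s1)// lerDl.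
have r0 : 0 < r by rewrite (lt_trans ltr01).
set K := r `^ t.
have K1 : 0 < K by exact: powR_gt0.
have k1 : 0 <= 1 + t by rewrite addr_ge0.
have k2 : 0 <= t / r by rewrite divr_ge0// ltW.
have key : ((1 + t)%:E * egamma r <=
    K%:E * egamma s + (t / r)%:E * egamma (r + 1))%E.
  rewrite /egamma -!(ge0_integral_mulr mu (measurable_gfun _) (gfun_ge0 _)) ?(ltW K1)//.
  rewrite -ge0_integral_addr; last 4 first.
  - exact: measurable_gfunZ.
  - exact: measurable_gfunZ.
  - by move=> c; rewrite mulr_ge0 ?(ltW K1)// gfun_ge0.
  - by move=> c; rewrite mulr_ge0// gfun_ge0.
  apply: ge0_le_integralr.
  - exact: measurable_gfunZ.
  - by apply: measurable_funD; exact: measurable_gfunZ.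
  - by move=> c; rewrite mulr_ge0// gfun_ge0.
  move=> c.
  have [c0|c0] := ltP 0 c; last first.
    by rewrite /gfun ltNge c0 /= !mulr0 addr0.
  have -> : gfun (r + 1) c = c * gfun r c by rewrite gfun_shift powRr1// ltW.
  have -> : gfun s c = c `^ (- t) * gfun r c.
    by rewrite -gfun_shift; congr (gfun _ _); rewrite /r; ring.
  have v0 : 0 < c / r by rewrite divr_gt0.
  have := powRN_tangent v0 t0.
  have -> : (c / r) `^ (- t) = c `^ (- t) * K.
    rewrite powRM ?invr_ge0 ?(ltW r0) ?(ltW c0)//; congr (_ * _).
    by rewrite -[r^-1]powR_inv1 ?(ltW r0)// -powRrM mulN1r opprK.
  move=> H.
  have g0 : 0 <= gfun r c := gfun_ge0 _ _.
  have := ler_wpM2r g0 H; rewrite -subr_ge0 => H'; rewrite -subr_ge0.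
  apply: le_trans H' _; rewrite le_eqVlt; apply/orP; left; apply/eqP; ring.
move: key; rewrite egammaS ?(ltW r1)// muleA -EFinM divfK ?gt_eqF//.
rewrite -!rgammaE ?(ltW s1) ?(ltW r1)//.
rewrite -!EFinM -EFinD lee_fin => H; rewrite -subr_ge0; move: H; rewrite -subr_ge0.
move=> H; apply: le_trans H _; rewrite le_eqVlt; apply/orP; left; apply/eqP; ring.
Qed.

Lemma hausdorff_rgamma (b : R) : 1 < b -> b <= 2 ->
  exists2 D, 0 <= D & hausdorff D (gamma_seq rgamma b).
Proof.
exact: (hausdorff_gamma rgamma_gt0 rgammaS rgamma_lo rgamma_hi).
Qed.

End gamma_function.

(** * From exponential weights to the ball *)

Section layer_cake.
Context {R : realType}.
Variable p : R.
Hypothesis p0 : 0 < p.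
Local Notation mu := (@lebesgue_measure R).

(** The [p]-th power of [lp_norm]. *)
Definition Np n (x : n.-tuple R) : R := \sum_(i < n) `|tnth x i| `^ p.

Lemma Np_ge0 n (x : n.-tuple R) : 0 <= Np x.
Proof. by apply: sumr_ge0 => i _; exact: powR_ge0. Qed.

Lemma measurable_abs_powR (q : R) : measurable_fun setT (fun x : R => `|x| `^ q).
Proof.
apply: (measurableT_comp (measurable_powR q)).
exact: normr_measurable.
Qed.

Lemma measurable_Np n : measurable_fun setT (@Np n).
Proof.
apply: measurable_sum => i.
exact: (measurableT_comp (measurable_abs_powR p) (measurable_tnth_tuple i)).
Qed.

Lemma Np_scale n (r : R) (x : n.-tuple R) : 0 <= r ->
  Np (scale_tuple r x) = r `^ p * Np x.
Proof.
move=> r0; rewrite /Np mulr_sumr; apply: eq_bigr => i _.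
by rewrite tnth_scale normrM (ger0_norm r0) powRM.
Qed.

Lemma Np_cons n (x : R) (t : n.-tuple R) :
  Np (tuple_cons ((x : measurableTypeR R), t)) = `|x| `^ p + Np t.
Proof.
by rewrite /Np big_ord_recl tnth0; congr (_ + _); apply: eq_bigr => i _; rewrite tnthS.
Qed.

Definition ball_weight n k (x : n.-tuple R) : R :=
  if Np x <= 1 then (1 - Np x) ^+ k else 0.

Lemma ball_weight_ge0 n k (x : n.-tuple R) : 0 <= ball_weight k x.
Proof. by rewrite /ball_weight; case: ifP => // N1; rewrite exprn_ge0// subr_ge0. Qed.

Lemma measurable_ball_weight n k : measurable_fun setT (@ball_weight n k).
Proof.
apply: measurable_fun_ifT => //.
  by apply: measurable_fun_ler; [exact: measurable_Np|exact: measurable_cst].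
apply: measurable_funX.
by apply: measurable_funB; [exact: measurable_cst|exact: measurable_Np].
Qed.

Lemma powR_inv_exp (c : R) : 0 < c -> (c `^ (- p^-1)) `^ p = c^-1.
Proof.
by move=> c0; rewrite -powRrM mulNr mulVf ?gt_eqF// powR_inv1// ltW.
Qed.

(** Write [expR (- Np x)] as a multiple of the integral over [c > Np x] of
    [expR (- c) * (c - Np x) ^+ k] and exchange the integrals. By homogeneity
    the inner integral over [Np x <= c] is its value at [c = 1], an integral
    over the ball, times a power of [c]. *)
Lemma layer_cake n k (d : R) (F : n.-tuple R -> R) :
  measurable_fun setT F -> (forall x, 0 <= F x) ->
  (forall r x, 0 < r -> F (scale_tuple r x) = r `^ d * F x) ->
  (egamma (k%:R + 1) * \int[lebesgue_tuple R n]_x (expR (- Np x) * F x)%:E =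
   egamma (k%:R + (n%:R + d) / p + 1) *
     \int[lebesgue_tuple R n]_x (ball_weight k x * F x)%:E)%E.
Proof.
move=> mF F0 Fhom.
pose lam := lebesgue_tuple R n.
pose g (z : measurableTypeR R * n.-tuple R) : R :=
  if (0 < z.1) && (Np z.2 <= z.1) then expR (- z.1) * ((z.1 - Np z.2) ^+ k * F z.2) else 0.
have g0 z : 0 <= g z.
  rewrite /g; case: ifP => // /andP[_ Nz].
  by apply: mulr_ge0; [exact: expR_ge0|apply: mulr_ge0 => //; rewrite exprn_ge0// subr_ge0].
have m1 : measurable_fun setT (fun z : measurableTypeR R * n.-tuple R => z.1 : R).
  exact: measurable_fst.
have m2 : measurable_fun setT (fun z : measurableTypeR R * n.-tuple R => z.2).
  exact: measurable_snd.
have mN2 : measurable_fun setT (fun z : measurableTypeR R * n.-tuple R => Np z.2).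
  exact: (measurableT_comp (@measurable_Np n) m2).
have mF2 : measurable_fun setT (fun z : measurableTypeR R * n.-tuple R => F z.2).
  exact: (measurableT_comp mF m2).
have mg : measurable_fun setT g.
  apply: measurable_fun_ifT; last exact: measurable_cst.
    apply: measurable_and; last exact: measurable_fun_ler.
    by apply: measurable_fun_ltr => //; exact: measurable_cst.
  apply: measurable_funM.
    by apply: measurableT_comp => //; exact: measurableT_comp.
  apply: measurable_funM => //; apply: measurable_funX.
  exact: measurable_funB.
have FT := @fubini_tonelli _ _ (measurableTypeR R) (n.-tuple R) R mu lam (EFin \o g)
  (proj2 (measurable_EFinP _ _) mg) (fun z => g0 z).
pose J := (\int[lam]_x (ball_weight k x * F x)%:E)%E.
have J0 : (0 <= J)%E.
  by apply: integral_ge0 => x _; rewrite lee_fin; apply: mulr_ge0 => //; exact: ball_weight_ge0.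
have mE : measurable_fun setT (fun x : n.-tuple R => expR (- Np x) * F x).
  apply: measurable_funM => //; apply: measurableT_comp => //.
  by apply: measurableT_comp => //; exact: measurable_Np.
have E0 (x : n.-tuple R) : 0 <= expR (- Np x) * F x by apply: mulr_ge0 => //; exact: expR_ge0.
transitivity (\int[mu]_c \int[lam]_x (g (c, x))%:E)%E; last first.
  rewrite -/lam -/J.
  transitivity (\int[mu]_c (J * (gfun (k%:R + (n%:R + d) / p + 1) c)%:E))%E; last first.
    rewrite (ge0_integralZl mu measurableT _ _ J0); first by rewrite muleC.
      by apply/measurable_EFinP; exact: measurable_gfun.
    by move=> c _; rewrite lee_fin gfun_ge0.
  apply: eq_integral => c _; rewrite /gfun addrK.
  have [c0|c0] := ltP 0 c; last first.
    by rewrite mule0; apply: integral0_eq => x _; rewrite /g/= ltNge c0.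
  (* The dilation by [r] maps [Np x <= c] onto the unit ball. *)
  pose r := c `^ (- p^-1).
  have r0 : 0 < r by exact: powR_gt0.
  pose K := expR (- c) * (c ^+ k * c `^ (d / p)).
  have K0 : 0 <= K.
    by apply: mulr_ge0; [exact: expR_ge0|apply: mulr_ge0; [rewrite exprn_ge0// ltW|exact: powR_ge0]].
  pose f x := ball_weight k x * F x.
  have f0 (x : n.-tuple R) : 0 <= f x by apply: mulr_ge0 => //; exact: ball_weight_ge0.
  have mf : measurable_fun setT f.
    by apply: measurable_funM => //; exact: measurable_ball_weight.
  transitivity (\int[lam]_x (K * f (scale_tuple r x))%:E)%E.
    apply: eq_integral => x _; congr EFin; rewrite /g /f /K/= c0 /=.
    rewrite Fhom// /ball_weight Np_scale ?(ltW r0)// powR_inv_exp//.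
    have -> : (c^-1 * Np x <= 1) = (Np x <= c).
      by rewrite mulrC ler_pdivrMr// mul1r.
    case: ifP => _; last by rewrite mul0r mulr0.
    have rd : r `^ d * c `^ (d / p) = 1.
      rewrite /r -powRrM -powRD; last by rewrite (gt_eqF c0) implybT.
      by rewrite mulNr [p^-1 * d]mulrC addrC subrr powRr0.
    have ck : (1 - c^-1 * Np x) ^+ k * c ^+ k = (c - Np x) ^+ k.
      by rewrite -exprMn mulrBl mul1r mulrAC mulVf ?gt_eqF// mul1r.
    transitivity (expR (- c) * ((1 - c^-1 * Np x) ^+ k * c ^+ k * ((r `^ d * c `^ (d / p)) * F x))).
      by rewrite ck rd mul1r.
    by ring.
  have mfs : measurable_fun setT (fun x => f (scale_tuple r x)).
    exact: (measurableT_comp mf (measurable_scale_tuple _)).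
  rewrite (ge0_integral_mulr lam mfs _ K0)//.
  rewrite (@ge0_integral_tuple_scale _ _ (EFin \o f) r r0); last 2 first.
  - exact/measurable_EFinP.
  - by move=> x; rewrite lee_fin.
  rewrite -/lam -/J muleA -EFinM muleC; congr (_ * _%:E)%E.
  have rn : r ^- n = c `^ (n%:R / p).
    rewrite -powR_mulrn ?(ltW r0)// -powRN /r -powRrM; congr (_ `^ _); ring.
  rewrite rn /K -!mulrA; congr (_ * _).
  rewrite -powR_mulrn ?(ltW c0)// -powRD; last by rewrite (gt_eqF c0) implybT.
  rewrite -powRD; last by rewrite (gt_eqF c0) implybT.
  by congr (_ `^ _); ring.
transitivity (\int[lam]_x \int[mu]_c (g (c, x))%:E)%E; last by rewrite FT.
have [ek0 ekfin] : 0 <= rgamma (k%:R + 1 : R) /\ egamma (k%:R + 1 : R) = (rgamma (k%:R + 1))%:E.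
  have k1 : 1 <= k%:R + 1 :> R by rewrite lerDr.
  by rewrite rgammaE// ltW// rgamma_gt0// (lt_le_trans ltr01).
rewrite ekfin -(ge0_integral_mulr lam mE E0 ek0).
apply: eq_integral => x _.
have N0 := Np_ge0 x; set N := Np x in N0 *.
pose f1 c := if N < c then expR (- c) * ((c - N) ^+ k * F x) else 0.
have mB : measurable_fun setT (fun c : R => expR (- c) * ((c - N) ^+ k * F x)).
  apply: measurable_funM; first exact: measurableT_comp.
  apply: measurable_funM; last exact: measurable_cst.
  by apply: measurable_funX; apply: measurable_funB => //; exact: measurable_cst.
have mf1 : measurable_fun setT f1.
  apply: measurable_fun_ifT => //.
  by apply: measurable_fun_ltr => //; exact: measurable_cst.
have f10 (c : R) : 0 <= f1 c.
  rewrite /f1; case: ifP => // Nc.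
  apply: mulr_ge0; [exact: expR_ge0|apply: mulr_ge0 => //].
  by rewrite exprn_ge0// subr_ge0 ltW.
transitivity (\int[mu]_c (f1 c)%:E)%E; last first.
  apply: (@ge0_integral_except _ N).
  - exact/measurable_EFinP.
  - apply/measurable_EFinP; apply: measurable_fun_ifT; last exact: measurable_cst.
      apply: measurable_and; first exact: measurable_pos_bool.
      by apply: (@measurable_fun_ler _ _ _ _ (cst N) id) => //; exact: measurable_cst.
    exact: mB.
  - by move=> c; rewrite lee_fin.
  - by move=> c; rewrite lee_fin.
  - move=> c cN; congr EFin; rewrite /f1 /g/= -/N.
    suff -> : (0 < c) && (N <= c) = (N < c) by [].
    rewrite [N < c]lt_neqAle eq_sym cN /=.
    apply/andP/idP => [[]//|Nc]; split => //.
    by rewrite lt_neqAle (le_trans N0 Nc) andbT eq_sym; apply: contra cN => /eqP c0; rewrite eq_le Nc c0 N0.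
rewrite -(@ge0_integral_shift _ (EFin \o f1) N); last 2 first.
- exact/measurable_EFinP.
- by move=> c; rewrite lee_fin.
have K0 : 0 <= expR (- N) * F x by apply: mulr_ge0 => //; exact: expR_ge0.
transitivity ((expR (- N) * F x)%:E * egamma (k%:R + 1))%E.
  by rewrite ekfin -EFinM; congr EFin; rewrite mulrC.
rewrite /egamma -(ge0_integral_mulr mu (measurable_gfun _) (gfun_ge0 _) K0).
apply: eq_integral => c _; congr EFin; rewrite /f1 /gfun/= ltrDr addrK addrK.
have [c0|_] := ltP 0 c; last by rewrite mulr0.
rewrite powR_mulrn ?(ltW c0)// opprD expRD; ring.
Qed.

End layer_cake.

Section absolute_moments.
Context {R : realType}.
Variable p : R.
Hypothesis p0 : 0 < p.
Local Notation mu := (@lebesgue_measure R).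

Lemma integral_abs_powR_unit (s : R) : 0 <= s ->
  (\int[mu]_x (if `|x| `^ p <= 1 then `|x| `^ s else 0)%:E = (2 / (s + 1))%:E)%E.
Proof.
move=> s0.
have s1 : 1 <= s + 1 by rewrite lerDr.
pose f (t : R) : R := if (0 < t) && (t < 1) then t `^ s else 0.
have f0 t : 0 <= f t by rewrite /f; case: ifP => // _; exact: powR_ge0.
have mf : measurable_fun setT f.
  apply: measurable_fun_ifT; [|exact: measurable_powR|exact: measurable_cst].
  by apply: measurable_and; [exact: measurable_pos_bool|apply: measurable_fun_ltr => //; exact: measurable_cst].
have mfN : measurable_fun setT (fun x : R => f (- x)) by exact: measurableT_comp.
have If : (\int[mu]_t (f t)%:E = ((s + 1)^-1)%:E)%E.
  have := @integral_powR R (s + 1) 1 s1 ltr01.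
  by rewrite addrK powR1 mul1r.
transitivity (\int[mu]_x (f x + f (- x))%:E)%E; last first.
  rewrite (ge0_integral_addr mu mf mfN f0 (fun x => f0 _)).
  rewrite (@ge0_integralN _ (EFin \o f)).
  - by rewrite /= If -EFinD; congr EFin; rewrite mulrDl mul1r.
  - exact/measurable_EFinP.
  - by move=> x; rewrite lee_fin.
apply: ge0_ae_eq_integral => //.
- apply/measurable_EFinP; apply: measurable_fun_ifT => //.
    by apply: measurable_fun_ler; [exact: measurable_abs_powR|exact: measurable_cst].
  exact: measurable_abs_powR.
- by apply/measurable_EFinP; apply: measurable_funD.
- by move=> x _; rewrite lee_fin; case: ifP => // _; exact: powR_ge0.
- by move=> x _; rewrite lee_fin addr_ge0.
have mS : measurable ([set 0] `|` ([set 1] `|` [set -1]) : set R).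
  by apply: measurableU; [|apply: measurableU]; exact: measurable_set1.
exists ([set 0] `|` ([set 1] `|` [set -1])); split.
- exact: mS.
- apply: countable_lebesgue_measure0; apply: finite_set_countable.
  by rewrite !finite_setU; do !split; exact: finite_set1.
move=> x /= H; apply: contrapT => /not_orP[/eqP x0 /not_orP[/eqP x1 /eqP xN1]].
apply: H => _; congr EFin; rewrite /f.
have -> : (`|x| `^ p <= 1) = (`|x| < 1).
  have nx : `|x| != 1.
    by rewrite eqr_norml ?ler01 ?andbT// negb_or x1 xN1.
  rewrite lt_neqAle nx /=; apply/idP/idP => h.
    rewrite leNgt; apply/negP => x1'.
    have := @gt0_ltr_powR R p p0 1 `|x|; rewrite !nnegrE ler01 normr_ge0 => /(_ isT isT x1').
    by rewrite powR1 ltNge h.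
  have := @ge0_ler_powR R p (ltW p0) `|x| 1; rewrite !nnegrE ler01 normr_ge0 => /(_ isT isT h).
  by rewrite powR1.
have [xp|xn|xE] := ltgtP x 0.
- rewrite ltr0_norm// oppr_gt0 xp /=add0r; by case: ifP.
- rewrite gtr0_norm// oppr_gt0 (lt_gtF xn)/= addr0; by case: ifP.
- by rewrite xE eqxx in x0.
Qed.

(** The absolute moment [\int `|x| `^ s * expR (- `|x| `^ p)] over the line; see
    [absmomE]. *)
Definition absmom (s : R) : R := 2 / p * rgamma ((s + 1) / p).

(** The case [n = 1], [k = 0] of [layer_cake] reduces it to the integral of
    [`|x| `^ s] over [-1, 1]. *)
Lemma absmomE (s : R) : 0 <= s -> 
  (\int[mu]_x (expR (- `|x| `^ p) * `|x| `^ s)%:E = (absmom s)%:E)%E.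
Proof.
move=> s0.
pose F (x : 1.-tuple R) : R := `|tnth x ord0| `^ s.
have mF : measurable_fun setT F.
  exact: (measurableT_comp (measurable_abs_powR s) (measurable_tnth_tuple ord0)).
have F0 x : 0 <= F x by exact: powR_ge0.
have Fh (r : R) x : 0 < r -> F (scale_tuple r x) = r `^ s * F x.
  by move=> r0; rewrite /F tnth_scale normrM (gtr0_norm r0) powRM// ltW.
have := layer_cake p0 0 mF F0 Fh.
rewrite add0r egamma1 mul1e !integral_tuple1; first last.
- by move=> x; rewrite lee_fin mulr_ge0// expR_ge0.
- apply/measurable_EFinP; apply: measurable_funM => //; apply: measurableT_comp => //.
  by apply: measurableT_comp => //; exact: measurable_Np.
- by move=> x; rewrite lee_fin mulr_ge0// ball_weight_ge0.
- by apply/measurable_EFinP; apply: measurable_funM => //; exact: measurable_ball_weight.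
have NpE (x : R) : Np p (tuple_cons ((x : measurableTypeR R), [tuple])) = `|x| `^ p.
  by rewrite Np_cons /Np big_ord0 addr0.
under eq_integral => x _ do rewrite NpE {1}/F tnth0.
move=> ->.
under eq_integral => x _.
  rewrite /ball_weight NpE expr0 {1}/F tnth0 (_ : _ * _ = if `|x| `^ p <= 1 then `|x| `^ s else 0); last first.
    by case: ifP; rewrite ?mul1r ?mul0r.
  over.
rewrite integral_abs_powR_unit// add0r.
have s1 : 0 < s + 1 by rewrite ltr_wpDl.
have e1 : 1 <= (1 + s) / p + 1 by rewrite lerDr divr_ge0 ?(ltW p0)// addrC ltW.
rewrite -rgammaE// rgammaS ?divr_gt0// 1?addrC// /absmom -EFinM; congr EFin.
rewrite [s + 1]addrC; field; rewrite (gt_eqF p0) /= addrC gt_eqF//.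
Qed.
End absolute_moments.

(** * Moments of linear forms under the exponential weight *)

Section even_binomial.
Context {R : realType}.

Lemma sum_parity (f : nat -> R) j : \sum_(i < j.*2.+1) f i =
  \sum_(i < j.+1) f i.*2 + \sum_(i < j) f i.*2.+1.
Proof.
elim: j => [|j IH]; first by rewrite double0 !big_ord1 big_ord0 addr0.
have -> : \sum_(i < j.+1.*2.+1) f i = \sum_(i < j.*2.+1) f i + f j.*2.+1 + f j.*2.+2.
  by rewrite doubleS 2!big_ord_recr.
have -> : \sum_(i < j.+2) f i.*2 = \sum_(i < j.+1) f i.*2 + f j.*2.+2.
  by rewrite big_ord_recr/= doubleS.
have -> : \sum_(i < j.+1) f i.*2.+1 = \sum_(i < j) f i.*2.+1 + f j.*2.+1.
  by rewrite big_ord_recr.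
by rewrite IH; ring.
Qed.

Lemma even_binomial (u v : R) j :
  2^-1 * ((u + v) ^+ j.*2 + (- u + v) ^+ j.*2) =
  \sum_(i < j.+1) 'C(j.*2, i.*2)%:R * u ^+ i.*2 * v ^+ (j - i).*2.
Proof.
rewrite ![_ + v]addrC !exprDn -big_split/= mulr_sumr.
rewrite (sum_parity (fun i => 2^-1 * (v ^+ (j.*2 - i) * u ^+ i *+ 'C(j.*2, i) +
  v ^+ (j.*2 - i) * (- u) ^+ i *+ 'C(j.*2, i)))).
rewrite [X in _ + X]big1 ?addr0; last first.
  move=> i _; rewrite [(- u) ^+ _]exprNn -signr_odd /= odd_double expr1.
  by rewrite mulN1r mulrN mulNrn subrr mulr0.
apply: eq_bigr => i _; rewrite [(- u) ^+ _]exprNn -signr_odd odd_double expr0 mul1r.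
by rewrite doubleB -mulr_natl; field.
Qed.

Lemma fact_double m : m.*2`!%:R = 4 ^+ m * m`!%:R * rise (2^-1 : R) m :> R.
Proof.
elim: m => [|m IH]; first by rewrite rise0 !mulr1.
rewrite doubleS !factS !natrM IH riseS exprS -!natr1 -mul2n natrM; field; done.
Qed.

(** The shape in which [(2 m)! = 4 ^ m * m! * (1/2) (3/2) ... (m - 1/2)] enters
    the expansion of even powers of linear forms. *)
Lemma bin_rise i j : (i <= j)%N ->
  'C(j.*2, i.*2)%:R * rise (2^-1 : R) i * rise 2^-1 (j - i) = 'C(j, i)%:R * rise 2^-1 j.
Proof.
move=> ij.
have h : (i.*2 <= j.*2)%N by rewrite leq_double.
have /(congr1 (fun k => k%:R : R)) := bin_fact h.
rewrite -doubleB !natrM !fact_double -(bin_fact ij) !natrM => e.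
have i0 : i`!%:R != 0 :> R by rewrite pnatr_eq0 -lt0n fact_gt0.
have ji0 : (j - i)`!%:R != 0 :> R by rewrite pnatr_eq0 -lt0n fact_gt0.
have e4 : 4 ^+ j = 4 ^+ i * 4 ^+ (j - i) :> R by rewrite -exprD subnKC.
have n4 k : 4 ^+ k != 0 :> R by rewrite expf_neq0.
apply: (mulfI (mulf_neq0 (n4 j) (mulf_neq0 i0 ji0))).
transitivity ('C(j.*2, i.*2)%:R * (4 ^+ i * i`!%:R * rise (2^-1 : R) i *
  (4 ^+ (j - i) * (j - i)`!%:R * rise 2^-1 (j - i)))); first by rewrite e4; ring.
by rewrite e; ring.
Qed.

End even_binomial.

Section moment_identities.
Context {R : realType}.
Variable p : R.
Hypothesis p0 : 0 < p.
Local Notation mu := (@lebesgue_measure R).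
Local Notation lam := (lebesgue_tuple R).

Lemma measurable_expN n : measurable_fun setT (fun x : n.-tuple R => expR (- Np p x)).
Proof.
apply: measurableT_comp => //.
by apply: measurableT_comp => //; exact: measurable_Np.
Qed.

(** The induction step shared by the two moment formulas below, where the
    integrand has been expanded in powers of the first coordinate. *)
Lemma integral_sum_mono n K (c s I : 'I_K -> R) (G : 'I_K -> n.-tuple R -> R) :
  (forall i, 0 <= c i) -> (forall i, 0 <= s i) ->
  (forall i, measurable_fun setT (G i)) -> (forall i t, 0 <= G i t) ->
  (forall i, (\int[lam n]_t (expR (- Np p t) * G i t)%:E = (I i)%:E)%E) ->
  (\int[mu]_x \int[lam n]_t
     (expR (- Np p (tuple_cons ((x : measurableTypeR R), t))) *
      \sum_(i < K) c i * `|x| `^ s i * G i t)%:E =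
   (\sum_(i < K) c i * absmom p (s i) * I i)%:E)%E.
Proof.
move=> c0 s0 mG G0 GI.
have I0 i : 0 <= I i.
  rewrite -lee_fin -GI; apply: integral_ge0 => t _; rewrite lee_fin.
  by rewrite mulr_ge0// expR_ge0.
have mW i (x : R) : measurable_fun setT (fun t : n.-tuple R => expR (- Np p t) * G i t).
  by apply: measurable_funM => //; exact: measurable_expN.
have W0 i (t : n.-tuple R) : 0 <= expR (- Np p t) * G i t by rewrite mulr_ge0// expR_ge0.
have k0 i (x : R) : 0 <= c i * (expR (- `|x| `^ p) * `|x| `^ s i).
  by rewrite !mulr_ge0// ?expR_ge0// powR_ge0.
transitivity (\int[mu]_x (\sum_(i < K) (c i * I i) * (expR (- `|x| `^ p) * `|x| `^ s i))%:E)%E.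
  apply: eq_integral => x _.
  transitivity (\int[lam n]_t (\sum_(i < K) (c i * (expR (- `|x| `^ p) * `|x| `^ s i)) *
      (expR (- Np p t) * G i t))%:E)%E.
    apply: eq_integral => t _; congr EFin; rewrite Np_cons opprD expRD mulr_sumr.
    by apply: eq_bigr => i _; ring.
  rewrite ge0_integral_sumr.
  - rewrite -sumEFin; apply: eq_bigr => i _.
    by rewrite (ge0_integral_mulr (lam n) (mW i x) (W0 i) (k0 i x)) GI -EFinM; congr EFin; ring.
  - by move=> i; apply: measurable_funM; [exact: measurable_cst|exact: mW].
  - by move=> i t; rewrite mulr_ge0.
have mE i : measurable_fun setT (fun x : R => expR (- `|x| `^ p) * `|x| `^ s i).
  apply: measurable_funM; last exact: measurable_abs_powR.
  apply: measurableT_comp => //.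
  by apply: measurableT_comp => //; exact: measurable_abs_powR.
have E0 i (x : R) : 0 <= expR (- `|x| `^ p) * `|x| `^ s i.
  by rewrite mulr_ge0// ?expR_ge0// powR_ge0.
rewrite ge0_integral_sumr.
- rewrite -sumEFin; apply: eq_bigr => i _.
  rewrite (ge0_integral_mulr mu (mE i) (E0 i) (mulr_ge0 (c0 i) (I0 i))) absmomE//.
  by rewrite -EFinM; congr EFin; ring.
- by move=> i; apply: measurable_funM; [exact: measurable_cst|exact: mE].
- by move=> i t; rewrite mulr_ge0// mulr_ge0.
Qed.

(** The odd part in the first coordinate integrates to 0. *)
Lemma ge0_integral_tuple_sym n (F : n.+1.-tuple R -> R) :
  measurable_fun setT F -> (forall x, 0 <= F x) ->
  (\int[lam n.+1]_x (F x)%:E = \int[mu]_x \int[lam n]_t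
    (2^-1 * (F (tuple_cons ((x : measurableTypeR R), t)) +
             F (tuple_cons (((- x)%R : measurableTypeR R), t))))%:E)%E.
Proof.
move=> mF F0.
pose h (x : R) := (\int[lam n]_t (F (tuple_cons ((x : measurableTypeR R), t)))%:E)%E.
have mh : measurable_fun setT h.
  apply: (@measurable_fun_fubini_tonelli_F _ _ (measurableTypeR R) _ R (lam n)
    (EFin \o F \o @tuple_cons R n)) => /=.
    apply: (measurableT_comp _ (@measurable_tuple_cons R n)); exact/measurable_EFinP.
  by move=> z; rewrite /= lee_fin.
have mFx (x : R) : measurable_fun setT (fun t : n.-tuple R => F (tuple_cons ((x : measurableTypeR R), t))).
  exact: measurableT_comp mF (@measurable_tuple_cons1 _ n x).
have h0 x : (0 <= h x)%E by apply: integral_ge0 => t _; rewrite lee_fin.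
have mhN : measurable_fun setT (fun x : R => h (- x)) by exact: measurableT_comp.
have half0 : 0 <= 2^-1 :> R by rewrite invr_ge0.
have half0E : (0 <= (2^-1 : R)%:E)%E by rewrite lee_fin.
transitivity (\int[mu]_x ((2^-1 : R)%:E * (h x + h (- (x : R))%R)))%E; last first.
  apply: eq_integral => x _.
  rewrite ge0_integral_mulr//; last first.
  - by move=> t; rewrite addr_ge0.
  - by apply: measurable_funD; exact: mFx.
  by rewrite (ge0_integral_addr (lam n) (mFx x) (mFx (- x))).
rewrite ge0_integralZl//; last first.
- by move=> x _; rewrite adde_ge0.
- by apply: emeasurable_funD.
rewrite ge0_integralD// ge0_integralN//.
rewrite (@ge0_integral_tuple_cons _ n (EFin \o F))//; last exact/measurable_EFinP.
have J0 : (0 <= \int[mu]_x h x)%E by exact: integral_ge0.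
rewrite ge0_muleDr// -ge0_muleDl// -EFinD (_ : 2^-1 + 2^-1 = 1 :> R) ?mul1e//.
by field.
Qed.

End moment_identities.

Section summom_facts.
Context {R : realType}.
Implicit Types (l : nat -> R) (s : seq R).

Lemma summom_Xn_ge0 l j s : (forall i, 0 <= l i) -> (forall c, c \in s -> 0 <= c) ->
  0 <= summom l 'X^j s.
Proof.
move=> l0; elim: s j => [|c s IH] j s0.
  by rewrite /= hornerXn exprn_ge0.
rewrite summom_Xn_cons; apply: sumr_ge0 => i _.
have c0 : 0 <= c by apply: s0; rewrite mem_head.
apply: mulr_ge0; last by apply: IH => d ds; apply: s0; rewrite in_cons ds orbT.
by apply: mulr_ge0 => //; apply: mulr_ge0 => //; exact: exprn_ge0.
Qed.

Lemma measurable_summom d (T : measurableType d) (I : Type) (r : seq I) l j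
    (f : I -> T -> R) : (forall i, measurable_fun setT (f i)) ->
  measurable_fun setT (fun x => summom l 'X^j [seq f i x | i <- r]).
Proof.
move=> mf; elim: r j => [|i r IH] j; first exact: measurable_cst.
apply: (@eq_measurable_fun _ _ _ _ _ (fun x => \sum_(k < j.+1)
  'C(j, k)%:R * f i x ^+ k * l k * summom l 'X^(j - k) [seq f i0 x | i0 <- r])).
  by move=> x _; rewrite map_cons summom_Xn_cons.
apply: measurable_sum => k; apply: measurable_funM => //.
apply: measurable_funM; last exact: measurable_cst.
by apply: measurable_funM; [exact: measurable_cst|exact: measurable_funX].
Qed.

End summom_facts.

Section two_moments.
Context {R : realType}.
Variable p : R.
Hypothesis p0 : 0 < p.
Local Notation lam := (lebesgue_tuple R).

(** These are the moments that turn the moments of a linear form under the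
    exponential weight into those of a sum of independent variables, up to the
    factor [rise 2^-1 j]; see [inner_moment]. *)
Definition gmom i : R := absmom p i.*2%:R / rise 2^-1 i.

Lemma inner_cons n (c x : R) (a t : n.-tuple R) :
  inner [tuple of c :: a] (tuple_cons ((x : measurableTypeR R), t)) = c * x + inner a t.
Proof.
rewrite /inner big_ord_recl !tnth0; congr (_ + _).
by apply: eq_bigr => i _; rewrite !tnthS.
Qed.

Lemma measurable_inner n (a : n.-tuple R) : measurable_fun setT (inner a).
Proof.
apply: measurable_sum => i; apply: measurable_funM; first exact: measurable_cst.
exact: measurable_tnth_tuple.
Qed.

Lemma expr_double_ge0 (x : R) j : 0 <= x ^+ j.*2.
Proof. by rewrite -mul2n exprM exprn_ge0// sqr_ge0. Qed.

Lemma expr_double_abs (x : R) j : x ^+ j.*2 = `|x| `^ j.*2%:R.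
Proof. by rewrite powR_mulrn// -[in RHS]mul2n -mul2n !exprM real_normK// num_real. Qed.

(** Symmetrizing in the first coordinate leaves the even powers of the binomial
    expansion; the factors [rise 2^-1] then change the coefficients
    ['C(2 j, 2 i)] into ['C(j, i)], those of [summom]. *)
Lemma inner_moment n (a : n.-tuple R) j :
  (\int[lam n]_x (expR (- Np p x) * inner a x ^+ j.*2)%:E =
   (rise 2^-1 j * summom gmom 'X^j [seq c ^+ 2 | c <- a])%:E)%E.
Proof.
have half0 : 0 < 2^-1 :> R by rewrite invr_gt0.
elim: n a j => [|n IH] a j.
  rewrite integral_tuple0; last first.
    apply/measurable_EFinP; apply: measurable_funM; first exact: measurable_expN.
    by apply: measurable_funX; exact: measurable_inner.
  have -> : (a : seq R) = [::] by case: a => -[].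
  rewrite /= hornerXn /Np /inner !big_ord0 oppr0 expR0 mul1r; congr EFin.
  by case: j => [|j]; rewrite ?rise0 ?mul1r// doubleS !expr0n mulr0.
case/tupleP: a => c a; rewrite ge0_integral_tuple_sym; first last.
- by move=> x; rewrite mulr_ge0 ?expR_ge0// expr_double_ge0.
- apply: measurable_funM; first exact: measurable_expN.
  by apply: measurable_funX; exact: measurable_inner.
pose C (i : 'I_j.+1) := 'C(j.*2, i.*2)%:R * c ^+ i.*2.
transitivity (\int[lebesgue_measure]_x \int[lam n]_t
     (expR (- Np p (tuple_cons ((x : measurableTypeR R), t))) *
      \sum_(i < j.+1) C i * `|x| `^ i.*2%:R * inner a t ^+ (j - i).*2)%:E)%E.
  apply: eq_integral => x _; apply: eq_integral => t _; congr EFin.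
  rewrite !Np_cons normrN -mulrDr mulrCA; congr (_ * _).
  rewrite !inner_cons mulrN even_binomial; apply: eq_bigr => i _.
  by rewrite /C -expr_double_abs exprMn mulrA.
rewrite (@integral_sum_mono _ _ p0 n j.+1 C _
  (fun i => rise 2^-1 (j - i) * summom gmom 'X^(j - i) [seq c ^+ 2 | c <- a])).
- congr EFin; rewrite map_cons summom_Xn_cons mulr_sumr; apply: eq_bigr => i _.
  have ij : (i <= j)%N by rewrite -ltnS.
  have r0 := gt_eqF (rise_gt0 i half0).
  have -> : absmom p i.*2%:R = gmom i * rise 2^-1 i by rewrite /gmom divfK// r0.
  rewrite /C -exprM mul2n.
  transitivity ('C(j.*2, i.*2)%:R * rise 2^-1 i * rise 2^-1 (j - i) *
     (c ^+ i.*2 * gmom i * summom gmom 'X^(j - i) [seq c ^+ 2 | c <- a])); first by ring.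
  by rewrite bin_rise//; ring.
- by move=> i; rewrite mulr_ge0// expr_double_ge0.
- by [].
- by move=> i; apply: measurable_funX; exact: measurable_inner.
- by move=> i t; exact: expr_double_ge0.
- by move=> i; exact: IH.
Qed.

(** The coefficients [A_i * `|x_i| `^ (2 - p)] of the variables [L_i] in the
    representation of the squared linear form. *)
Definition wvec (A : seq R) n (x : n.-tuple R) : seq R :=
  [seq A`_i * `|tnth x i| `^ (2 - p) | i : 'I_n <- enum 'I_n].

Lemma wvec_cons c (A : seq R) n (x : R) (t : n.-tuple R) :
  wvec (c :: A) (tuple_cons ((x : measurableTypeR R), t)) =
  c * `|x| `^ (2 - p) :: wvec A t.
Proof.
rewrite /wvec enum_ordSl map_cons tnth0; congr (_ :: _).
by rewrite -map_comp; apply: eq_map => i /=; rewrite tnthS.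
Qed.

Lemma measurable_summom_wvec (l : nat -> R) j (A : seq R) n :
  measurable_fun setT (fun x : n.-tuple R => summom l 'X^j (wvec A x)).
Proof.
apply: measurable_summom => i; apply: measurable_funM; first exact: measurable_cst.
exact: (measurableT_comp (measurable_abs_powR _) (measurable_tnth_tuple i)).
Qed.

Lemma summom_wvec_ge0 (l : nat -> R) j (A : seq R) n (x : n.-tuple R) :
  (forall i, 0 <= l i) -> (forall c, c \in A -> 0 <= c) ->
  0 <= summom l 'X^j (wvec A x).
Proof.
move=> l0 A0; apply: summom_Xn_ge0 => // _ /mapP[i _ ->].
rewrite mulr_ge0 ?powR_ge0//; have [iA|iA] := ltnP i (size A).
  by apply: A0; rewrite mem_nth.
by rewrite nth_default.
Qed.

Hypothesis p2 : p <= 2.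

(** Integrating the first coordinate multiplies the moments of the
    corresponding variable by absolute moments of order [(2 - p) * i]. *)
Lemma weight_moment (l : nat -> R) n (A : seq R) j :
  (forall i, 0 <= l i) -> (forall c, c \in A -> 0 <= c) -> size A = n ->
  (\int[lam n]_x (expR (- Np p x) * summom l 'X^j (wvec A x))%:E =
   (summom (fun i => l i * absmom p ((2 - p) * i%:R)) 'X^j A)%:E)%E.
Proof.
move=> l0; elim: n A j => [|n IH] A j A0.
  move=> /eqP; rewrite size_eq0 => /eqP ->.
  rewrite integral_tuple0; last first.
    apply/measurable_EFinP; apply: measurable_funM; first exact: measurable_expN.
    exact: measurable_summom_wvec.
  by rewrite /wvec enum_ord0 /= /Np big_ord0 oppr0 expR0 mul1r.
case: A A0 => [//|c A] A0 [An].
have c0 : 0 <= c by apply: A0; rewrite mem_head.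
have A0' d : d \in A -> 0 <= d by move=> dA; apply: A0; rewrite in_cons dA orbT.
rewrite (@ge0_integral_tuple_cons _ n (fun x => (expR (- Np p x) * summom l 'X^j (wvec (c :: A) x))%:E)); first last.
- by move=> x; rewrite lee_fin mulr_ge0 ?expR_ge0// summom_wvec_ge0.
- apply/measurable_EFinP; apply: measurable_funM; first exact: measurable_expN.
  exact: measurable_summom_wvec.
pose C (i : 'I_j.+1) := 'C(j, i)%:R * c ^+ i * l i.
transitivity (\int[lebesgue_measure]_x \int[lam n]_t
     (expR (- Np p (tuple_cons ((x : measurableTypeR R), t))) *
      \sum_(i < j.+1) C i * `|x| `^ ((2 - p) * i%:R) * summom l 'X^(j - i) (wvec A t))%:E)%E.
  apply: eq_integral => x _; apply: eq_integral => t _; congr EFin; congr (_ * _).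
  rewrite wvec_cons summom_Xn_cons; apply: eq_bigr => i _.
  by rewrite /C exprMn powRrM powR_mulrn ?powR_ge0//; ring.
rewrite (@integral_sum_mono _ _ p0 n j.+1 C _
  (fun i => summom (fun i => l i * absmom p ((2 - p) * i%:R)) 'X^(j - i) A)).
- by congr EFin; rewrite summom_Xn_cons; apply: eq_bigr => i _; rewrite /C; ring.
- by move=> i; rewrite !mulr_ge0// exprn_ge0.
- by move=> i; rewrite mulr_ge0// subr_ge0.
- by move=> i; exact: measurable_summom_wvec.
- by move=> i t; exact: summom_wvec_ge0.
- by move=> i; exact: IH.
Qed.

End two_moments.

(** * Moments of linear forms on the ball *)

Section signed_combinations.
Context d (T : measurableType d) {R : realType} (m : {measure set T -> \bar R}).

(** Only nonnegative functions are integrated: the terms with negative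
    coefficients are moved to the other side. *)
Lemma integral_signed_sum (I : finType) (c U : I -> R) (u : I -> T -> R) :
  (forall i, measurable_fun setT (u i)) -> (forall i x, 0 <= u i x) ->
  (forall i, (\int[m]_x (u i x)%:E = (U i)%:E)%E) ->
  (forall x, 0 <= \sum_i c i * u i x) ->
  (\int[m]_x (\sum_i c i * u i x)%:E = (\sum_i c i * U i)%:E)%E.
Proof.
move=> mu u0 uU cu0.
pose cp i := Num.max (c i) 0; pose cn i := Num.max (- c i) 0.
have cp0 i : 0 <= cp i by rewrite le_max lexx orbT.
have cn0 i : 0 <= cn i by rewrite le_max lexx orbT.
have cE i : c i = cp i - cn i.
  rewrite /cp /cn; case/orP: (le_total 0 (c i)) => h.
    by rewrite max_l// max_r ?subr0// oppr_le0.
  by rewrite max_r// max_l ?sub0r ?opprK// oppr_ge0.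
have S (k : I -> R) : (forall i, 0 <= k i) ->
    (\int[m]_x (\sum_i k i * u i x)%:E = (\sum_i k i * U i)%:E)%E.
  move=> k0.
  transitivity (\int[m]_x (\sum_(i <- index_enum I) (k i * u i x)%:E))%E.
    by apply: eq_integral => x _; rewrite sumEFin.
  rewrite ge0_integral_sum//.
  - rewrite -sumEFin; apply: eq_bigr => i _.
    by rewrite (ge0_integral_mulr m (mu i) (u0 i) (k0 i)) uU.
  - move=> i; apply/measurable_EFinP; apply: measurable_funM => //.
  - by move=> i x _; rewrite lee_fin mulr_ge0.
have mS (k : I -> R) : measurable_fun setT (fun x => \sum_i k i * u i x).
  by apply: measurable_sum => i; apply: measurable_funM.
have n0 x : 0 <= \sum_i cn i * u i x by apply: sumr_ge0 => i _; rewrite mulr_ge0.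
have := ge0_integral_addr m (mS c) (mS cn) cu0 n0.
have -> : (\int[m]_x (\sum_i c i * u i x + \sum_i cn i * u i x)%:E =
    (\sum_i cp i * U i)%:E)%E.
  rewrite -S//; apply: eq_integral => x _; congr EFin.
  by rewrite -big_split/=; apply: eq_bigr => i _; rewrite -mulrDl cE subrK.
rewrite (S cn cn0); set J := (\int[m]_x (\sum_i c i * u i x)%:E)%E; case: J => [r|//|//]; rewrite -EFinD => e0; have e := EFin_inj e0.
congr EFin; apply: (addIr (\sum_i cn i * U i)); rewrite -e -big_split/=.
by apply: eq_bigr => i _; rewrite -mulrDl cE subrK.
Qed.

Lemma le_integral_signed_sum (I : finType) (c U V : I -> R) (u v : I -> T -> R) :
  (forall i, measurable_fun setT (u i)) -> (forall i x, 0 <= u i x) ->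
  (forall i, (\int[m]_x (u i x)%:E = (U i)%:E)%E) ->
  (forall i, measurable_fun setT (v i)) -> (forall i x, 0 <= v i x) ->
  (forall i, (\int[m]_x (v i x)%:E = (V i)%:E)%E) ->
  (forall x, \sum_i c i * u i x <= \sum_i c i * v i x) ->
  \sum_i c i * U i <= \sum_i c i * V i.
Proof.
move=> mu u0 uU mv v0 vV uv.
pose c' (k : I + I) := match k with inl i => c i | inr i => - c i end.
pose w (k : I + I) := match k with inl i => v i | inr i => u i end.
pose W (k : I + I) := match k with inl i => V i | inr i => U i end.
have E (f g : I -> R) (h : I + I -> R) : (forall i, h (inl i) = f i) ->
    (forall i, h (inr i) = g i) -> \sum_k c' k * h k = \sum_i c i * f i - \sum_i c i * g i.
  move=> hf hg; rewrite big_sumType/=; congr (_ + _).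
    by apply: eq_bigr => i _; rewrite hf.
  by rewrite -sumrN; apply: eq_bigr => i _; rewrite hg mulNr.
have w0 x : 0 <= \sum_k c' k * w k x.
  by rewrite (E (v ^~ x) (u ^~ x))// subr_ge0.
have h : (\int[m]_x (\sum_k c' k * w k x)%:E = (\sum_k c' k * W k)%:E)%E.
  by apply: integral_signed_sum => //; case.
rewrite -subr_ge0 -(E V U W)// -lee_fin -h.
by apply: integral_ge0 => x _; rewrite lee_fin.
Qed.

End signed_combinations.

Section ball_moments.
Context {R : realType}.
Variable p : R.
Hypothesis p1 : 1 <= p.
Hypothesis p2 : p <= 2.
Local Notation lam := (lebesgue_tuple R).

Let p0 : 0 < p. Proof. exact: lt_le_trans p1. Qed.

(** The moments of the [L_i]. This is the only choice for which [weight_moment]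
    produces [gmom], that is, for which [ball_weighted] agrees with [ball_inner]. *)
Definition lseq i : R := gmom p i / absmom p ((2 - p) * i%:R).

Lemma absmom_gt0 (s : R) : 0 <= s -> 0 < absmom p s.
Proof.
move=> s0; apply: mulr_gt0; first by rewrite divr_gt0.
by rewrite rgamma_gt0// divr_gt0// ltr_wpDl.
Qed.

Lemma weight_exponent_ge0 i : 0 <= (2 - p) * i%:R.
Proof. by rewrite mulr_ge0// subr_ge0. Qed.

Lemma lseq_ge0 i : 0 <= lseq i.
Proof.
have half0 : 0 < 2^-1 :> R by rewrite invr_gt0.
rewrite divr_ge0 ?(ltW (absmom_gt0 (weight_exponent_ge0 i)))//.
by rewrite divr_ge0 ?(ltW (rise_gt0 _ half0))// ltW// absmom_gt0.
Qed.

Lemma lseq_gamma i : lseq i = gamma_seq (@rgamma R) (2 / p) i.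
Proof.
have half0 : 0 < 2^-1 :> R by rewrite invr_gt0.
rewrite /lseq /gmom /absmom /gamma_seq.
have -> : (i.*2%:R + 1) / p = 2 / p * (i%:R + 2^-1).
  by rewrite -mul2n natrM; field; rewrite gt_eqF.
have -> : ((2 - p) * i%:R + 1) / p = (2 / p - 1) * (i%:R + 2^-1) + 2^-1.
  by field; rewrite gt_eqF.
have g0 : 0 < rgamma ((2 / p - 1) * (i%:R + 2^-1) + 2^-1).
  apply: rgamma_gt0; apply: ltr_wpDl => //; apply: mulr_ge0; last by rewrite addr_ge0// ltW.
  by rewrite subr_ge0 ler_pdivlMr// mul1r.
field; rewrite (gt_eqF g0) (gt_eqF p0) (gt_eqF (rise_gt0 _ half0))/=.
done.
Qed.

(** For [p < 2] this is a quotient of Gamma functions with [b = 2 / p] in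
    ]1, 2]; for [p = 2] the sequence is constant. *)
Lemma hausdorff_lseq : exists2 D, 0 <= D & hausdorff D lseq.
Proof.
have half0 : 0 < 2^-1 :> R by rewrite invr_gt0.
have [pE|pN] := eqVneq p 2.
  exists 1 => //; apply: (@hausdorff_eq _ 1 (fun i => 1 * 1 ^+ i)); last first.
    by apply: hausdorff_pow; rewrite ?ler01 ?lexx.
  move=> i; rewrite lseq_gamma; have -> : 2 / p = 1 :> R by rewrite pE divff.
  rewrite /gamma_seq subrr mul0r add0r !mul1r.
  rewrite addrC (gamma_rise (@rgammaS R))// expr1n [rise _ _ * _]mulrC divff//.
  by rewrite mulf_neq0// gt_eqF// ?rgamma_gt0// rise_gt0.
have [D D0 h] : exists2 D, 0 <= D & hausdorff D (gamma_seq (@rgamma R) (2 / p)).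
  apply: hausdorff_rgamma.
    by rewrite ltr_pdivlMr// mul1r lt_neqAle pN.
  by rewrite ler_pdivrMr// ler_peMr.
by exists D => //; apply: hausdorff_eq h => i; rewrite lseq_gamma.
Qed.

(** The moments of the squared cosine of a uniform angle. *)
Definition tau j : R := rise 2^-1 j / j`!%:R.

Lemma tau_ge0 j : 0 <= tau j.
Proof. by rewrite divr_ge0// ltW// rise_gt0// invr_gt0. Qed.

(** The common value of [ball_inner] and [ball_weighted]. *)
Definition ballmom n (A : seq R) j : R :=
  rise 2^-1 j * summom (gmom p) 'X^j A / rgamma ((n%:R + j.*2%:R) / p + 1).

(** [layer_cake] for the homogeneous function [inner a x ^+ j.*2] and [k = 0]. *)
Lemma ball_inner n (a : n.-tuple R) j :
  (\int[lam n]_x (ball_weight p 0 x * inner a x ^+ j.*2)%:E =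
   (ballmom n [seq c ^+ 2 | c <- a] j)%:E)%E.
Proof.
have mF : measurable_fun setT (fun x : n.-tuple R => inner a x ^+ j.*2).
  by apply: measurable_funX; exact: measurable_inner.
have Fh (r : R) x : 0 < r -> inner a (scale_tuple r x) ^+ j.*2 = r `^ j.*2%:R * inner a x ^+ j.*2.
  move=> r0; rewrite powR_mulrn ?(ltW r0)// -exprMn; congr (_ ^+ _).
  by rewrite /inner mulr_sumr; apply: eq_bigr => i _; rewrite tnth_scale; ring.
have := layer_cake p0 0 mF (fun x => expr_double_ge0 _ _) Fh.
rewrite add0r egamma1 mul1e add0r inner_moment//.
set e := (n%:R + j.*2%:R) / p + 1.
have e1 : 1 <= e by rewrite lerDr divr_ge0// ltW.
have g0 : rgamma e != 0 by rewrite gt_eqF// rgamma_gt0// (lt_le_trans ltr01).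
rewrite -(rgammaE e1).
have : (0 <= \int[lam n]_x (ball_weight p 0 x * inner a x ^+ j.*2)%:E)%E.
  by apply: integral_ge0 => x _; rewrite lee_fin mulr_ge0 ?ball_weight_ge0// expr_double_ge0.
set J := (\int[lam n]_x (ball_weight p 0 x * inner a x ^+ j.*2)%:E)%E.
case: J => [r| |]// _.
  by rewrite -EFinM => -[h]; congr EFin; rewrite /ballmom -/e h mulrAC divff// mul1r.
by rewrite gt0_muley// lte_fin rgamma_gt0// (lt_le_trans ltr01).
Qed.

(** The term of degree [j] in the expectation of a polynomial at
    [(1 - Np p x) * C * \sum_i A_i * `|x_i| `^ (2 - p) * L_i] for fixed [x]. *)
Definition wball n (A : seq R) j (x : n.-tuple R) : R :=
  tau j * (ball_weight p j x * summom lseq 'X^j (wvec p A x)).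

Lemma wball_ge0 n (A : seq R) j (x : n.-tuple R) :
  (forall c, c \in A -> 0 <= c) -> 0 <= wball A j x.
Proof.
move=> A0; rewrite mulr_ge0 ?tau_ge0// mulr_ge0 ?ball_weight_ge0//.
by apply: summom_wvec_ge0 => //; exact: lseq_ge0.
Qed.

Lemma measurable_wball n (A : seq R) j : measurable_fun setT (@wball n A j).
Proof.
apply: measurable_funM => //; apply: measurable_funM.
  exact: measurable_ball_weight.
exact: measurable_summom_wvec.
Qed.

(** [layer_cake] with [k = j] for a function homogeneous of degree
    [(2 - p) * j]: the Gamma factors have the same argument as in [ball_inner],
    because [j + (2 - p) j / p = 2 j / p]. Comparing the two computations is what
    proves that [<a, X>^2] has the law of
    [(1 - Np X) * C * \sum_i a_i ^+ 2 * `|X_i| `^ (2 - p) * L_i]. *)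
Lemma ball_weighted n (A : seq R) j : (forall c, c \in A -> 0 <= c) -> size A = n ->
  (\int[lam n]_x (wball A j x)%:E = (ballmom n A j)%:E)%E.
Proof.
move=> A0 An.
pose F (x : n.-tuple R) := summom lseq 'X^j (wvec p A x).
have mF : measurable_fun setT F by exact: measurable_summom_wvec.
have F0 x : 0 <= F x by apply: summom_wvec_ge0 => //; exact: lseq_ge0.
have Fh (r : R) x : 0 < r -> F (scale_tuple r x) = r `^ ((2 - p) * j%:R) * F x.
  move=> r0; rewrite powRrM powR_mulrn ?powR_ge0// -summom_Xn_scale /F; congr summom.
  rewrite /wvec -map_comp; apply: eq_map => i /=.
  by rewrite tnth_scale normrM (gtr0_norm r0) powRM ?(ltW r0)//; ring.
have := layer_cake p0 j mF F0 Fh.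
rewrite (weight_moment p0 p2 j lseq_ge0 A0 An).
have -> : (fun i => lseq i * absmom p ((2 - p) * i%:R)) = gmom p.
  by apply/funext => i; rewrite /lseq divfK// gt_eqF// absmom_gt0// weight_exponent_ge0.
have -> : j%:R + (n%:R + (2 - p) * j%:R) / p + 1 = (n%:R + j.*2%:R) / p + 1.
  by rewrite -mul2n natrM; field; rewrite gt_eqF.
set e := (n%:R + j.*2%:R) / p + 1.
have e1 : 1 <= e by rewrite lerDr divr_ge0 ?(ltW p0)// addr_ge0.
have g0 : rgamma e != 0 by rewrite gt_eqF// rgamma_gt0// (lt_le_trans ltr01).
have j1 : 1 <= j%:R + 1 :> R by rewrite lerDr.
have jE : rgamma (j%:R + 1 : R) = j`!%:R.
  rewrite addrC (gamma_rise (@rgammaS R))// rise1_fact.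
  suff -> : rgamma (1 : R) = 1 by rewrite mulr1.
  by apply: EFin_inj; rewrite rgammaE// egamma1.
rewrite -(rgammaE e1) -(rgammaE j1) jE.
have mbF : measurable_fun setT (fun x => ball_weight p j x * F x).
  by apply: measurable_funM => //; exact: measurable_ball_weight.
have bF0 (x : n.-tuple R) : 0 <= ball_weight p j x * F x.
  by rewrite mulr_ge0// ball_weight_ge0.
rewrite (ge0_integral_mulr (lam n) mbF bF0 (tau_ge0 j)).
have : (0 <= \int[lam n]_x (ball_weight p j x * F x)%:E)%E.
  by apply: integral_ge0 => x _; rewrite lee_fin.
set J := (\int[lam n]_x (ball_weight p j x * F x)%:E)%E.
case: J => [r| |]// _.
  rewrite -!EFinM => -[h]; congr EFin.
  have -> : r = j`!%:R * summom (gmom p) 'X^j A / rgamma e by rewrite h mulrAC divff// mul1r.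
  rewrite /ballmom -/e /tau; field; rewrite g0 /= pnatr_eq0 -lt0n.
  by rewrite fact_gt0.
by rewrite gt0_muley// lte_fin rgamma_gt0// (lt_le_trans ltr01).
Qed.

Lemma ballmom_perm n (A B : seq R) j : perm_eq A B -> ballmom n A j = ballmom n B j.
Proof. by move=> AB; rewrite /ballmom (summom_perm _ _ AB). Qed.

End ball_moments.

(** * Linear forms on the ball in the convex order *)

Section ball_schur.
Context {R : realType}.
Variable p : R.
Hypothesis p1 : 1 <= p.
Hypothesis p2 : p <= 2.
Local Notation lam := (lebesgue_tuple R).

Let p0 : 0 < p. Proof. exact: lt_le_trans p1. Qed.

(** The integral over the ball of [P.[inner a x ^+ 2]], as a function of the
    squares [A] of the entries of [a]; see [ball_poly_integral]. *)
Definition ballpoly n (P : {poly R}) (A : seq R) : R :=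
  \sum_(j < size P) P`_j * ballmom p n A j.

Lemma ballpoly_perm n P (A B : seq R) : perm_eq A B -> ballpoly n P A = ballpoly n P B.
Proof. by move=> AB; apply: eq_bigr => j _; rewrite (ballmom_perm _ _ _ AB). Qed.

Lemma mkseq_ge0 n (f : nat -> R) : (forall i, (i < n)%N -> 0 <= f i) ->
  forall c, c \in mkseq f n -> 0 <= c.
Proof. by move=> f0 c /mapP[i]; rewrite mem_iota /= add0n => ni ->; exact: f0. Qed.

(** The factor [(1 - Np p x) ^+ j] is absorbed into the coefficients of the
    independent variables. *)
Lemma sum_wball n (P : {poly R}) (f : nat -> R) (x : n.-tuple R) : Np p x <= 1 ->
  \sum_(j < size P) P`_j * wball p (mkseq f n) j x =
  mixmom (@tau R) (lseq p) P
    [seq (1 - Np p x) * (f i * `|tnth x i| `^ (2 - p)) | i : 'I_n <- enum 'I_n].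
Proof.
move=> N1; rewrite mixmomE; apply: eq_bigr => j _.
have -> : [seq (1 - Np p x) * (f i * `|tnth x i| `^ (2 - p)) | i : 'I_n <- enum 'I_n] =
    [seq (1 - Np p x) * c | c <- wvec p (mkseq f n) x].
  by rewrite /wvec -[RHS]map_comp; apply: eq_map => i /=; rewrite nth_mkseq.
by rewrite summom_Xn_scale /wball /ball_weight N1; ring.
Qed.

Lemma coord_le1 n (x : n.-tuple R) i : Np p x <= 1 -> `|tnth x i| <= 1.
Proof.
move=> N1; rewrite leNgt; apply/negP => xi.
have := @gt0_ltr_powR R p p0 1 `|tnth x i|; rewrite !nnegrE ler01 normr_ge0 => /(_ isT isT xi).
rewrite powR1 ltNge => /negP; apply; apply: le_trans N1.
rewrite /Np (bigD1 i)//= lerDl; apply: sumr_ge0 => j _; exact: powR_ge0.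
Qed.

(** For each [x] in the ball the integrand is convex in [A] by [mixmom_convex];
    the weights [(1 - Np p x) * `|x_i| `^ (2 - p)] are at most 1, so that the
    argument of [P] stays in [0, M]. *)
Lemma ballpoly_convex n (P : {poly R}) (D M : R) (f g : nat -> R) (t : R) : 0 <= D ->
  hausdorff D (lseq p) -> convex_on M (horner P) ->
  (forall i, (i < n)%N -> 0 <= f i) -> (forall i, (i < n)%N -> 0 <= g i) ->
  D * \sum_(i < n) f i <= M -> D * \sum_(i < n) g i <= M -> 0 <= t <= 1 ->
  ballpoly n P (mkseq (fun i => t * f i + (1 - t) * g i) n) <=
  t * ballpoly n P (mkseq f n) + (1 - t) * ballpoly n P (mkseq g n).
Proof.
move=> D0 hl cP f0 g0 fM gM t01; have /andP[t0 t1] := t01.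
have t0' : 0 <= 1 - t by rewrite subr_ge0.
have mf0 := mkseq_ge0 f0; have mg0 := mkseq_ge0 g0.
have mh0 : forall c, c \in mkseq (fun i => t * f i + (1 - t) * g i) n -> 0 <= c.
  by apply: mkseq_ge0 => i ni; rewrite addr_ge0// mulr_ge0// ?f0// g0.
have -> : t * ballpoly n P (mkseq f n) + (1 - t) * ballpoly n P (mkseq g n) =
    \sum_(j < size P) P`_j *
      (t * ballmom p n (mkseq f n) j + (1 - t) * ballmom p n (mkseq g n) j).
  by rewrite /ballpoly !mulr_sumr -big_split/=; apply: eq_bigr => j _; ring.
have mw (A : seq R) j : measurable_fun setT (@wball R p n A j) := measurable_wball p A j.
have wf0 j (x : n.-tuple R) := wball_ge0 p1 p2 (n := n) j x mf0.
have wg0 j (x : n.-tuple R) := wball_ge0 p1 p2 (n := n) j x mg0.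
apply: (@le_integral_signed_sum _ _ R (lam n) 'I_(size P) _ _ _
  (fun j => wball p (mkseq (fun i => t * f i + (1 - t) * g i) n) j)
  (fun j x => t * wball p (mkseq f n) j x + (1 - t) * wball p (mkseq g n) j x)).
- by move=> j; exact: mw.
- by move=> j x; exact: wball_ge0.
- by move=> j; apply: ball_weighted => //; rewrite size_mkseq.
- by move=> j; apply: measurable_funD; apply: measurable_funM => //; exact: mw.
- by move=> j x; rewrite addr_ge0// mulr_ge0.
- move=> j.
  rewrite (ge0_integral_addr (lam n)) //.
  + rewrite (ge0_integral_mulr (lam n) (mw _ j) (wf0 j) t0).
    rewrite (ge0_integral_mulr (lam n) (mw _ j) (wg0 j) t0').
    by rewrite !ball_weighted// ?size_mkseq.
  + by apply: measurable_funM => //; exact: mw.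
  + by apply: measurable_funM => //; exact: mw.
  + by move=> x; rewrite mulr_ge0.
  + by move=> x; rewrite mulr_ge0.
move=> x.
have -> : \sum_(j < size P) P`_j * (t * wball p (mkseq f n) j x + (1 - t) * wball p (mkseq g n) j x) =
    t * (\sum_(j < size P) P`_j * wball p (mkseq f n) j x) +
    (1 - t) * (\sum_(j < size P) P`_j * wball p (mkseq g n) j x).
  by rewrite !mulr_sumr -big_split/=; apply: eq_bigr => j _; ring.
have [N1|N1] := leP (Np p x) 1; last first.
  have z A : \sum_(j < size P) P`_j * wball p A j x = 0.
    by apply: big1 => j _; rewrite /wball /ball_weight leNgt N1/= mul0r !mulr0.
  by rewrite !z !mulr0 addr0.
rewrite !sum_wball//.
set w := 1 - Np p x.
have w0 : 0 <= w by rewrite subr_ge0.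
have w1 : w <= 1 by rewrite gerBl Np_ge0.
have y01 i : 0 <= w * `|tnth x i| `^ (2 - p) <= 1.
  rewrite mulr_ge0 ?powR_ge0//= mulr_ile1 ?powR_ge0//.
  have := @ge0_ler_powR R (2 - p) _ `|tnth x i| 1.
  rewrite subr_ge0 p2 !nnegrE ler01 normr_ge0 powR1 => /(_ isT isT isT); apply.
  exact: coord_le1.
have bnd (h : nat -> R) : (forall i, (i < n)%N -> 0 <= h i) -> D * \sum_(i < n) h i <= M ->
    D * \sum_(i <- enum 'I_n) (w * (h i * `|tnth x i| `^ (2 - p))) <= M.
  move=> h0; apply: le_trans; apply: ler_wpM2l => //.
  rewrite big_enum/=; apply: ler_sum => i _; rewrite mulrCA.
  by apply: ler_piMr; [exact: h0|case/andP: (y01 i)].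
have nn (h : nat -> R) : (forall i, (i < n)%N -> 0 <= h i) ->
    forall i : 'I_n, 0 <= w * (h i * `|tnth x i| `^ (2 - p)).
  by move=> h0 i; rewrite mulr_ge0// mulr_ge0 ?powR_ge0// h0.
have := @mixmom_convex R 'I_n (@tau R) (lseq p) P D M (enum 'I_n)
  (fun i => w * (f i * `|tnth x i| `^ (2 - p)))
  (fun i => w * (g i * `|tnth x i| `^ (2 - p))) t
  hausdorff_arcsine hl cP (nn f f0) (nn g g0) (bnd f f0 fM) (bnd g g0 gM) t01.
apply: le_trans; rewrite le_eqVlt; apply/orP; left; apply/eqP; congr mixmom.
by apply: eq_map => i; ring.
Qed.

End ball_schur.

Section ball_convex_order.
Context {R : realType}.
Variable p : R.
Hypothesis p1 : 1 <= p.
Hypothesis p2 : p <= 2.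
Local Notation lam := (lebesgue_tuple R).

Let p0 : 0 < p. Proof. exact: lt_le_trans p1. Qed.

Lemma sqr_tupleE n (a : n.-tuple R) : sqr_tuple a = [seq c ^+ 2 | c <- a] :> seq R.
Proof.
apply: (@eq_from_nth _ 0); first by rewrite size_tuple size_map size_tuple.
move=> i; rewrite size_tuple => ni.
rewrite -(tnth_nth 0 _ (Ordinal ni)) tnth_mktuple (nth_map 0) ?size_tuple//; congr (_ ^+ 2).
by rewrite (tnth_nth 0).
Qed.

Lemma sum_nth_seq n (s : seq R) : size s = n -> \sum_(i < n) s`_i = \sum_(c <- s) c.
Proof. by move=> <-; rewrite (big_nth 0) big_mkord. Qed.

(** [ballpoly] is convex by [ballpoly_convex], and symmetric because [summom] is
    invariant under permutations. *)
Lemma ballpoly_le n (P : {poly R}) (a b : n.-tuple R) (D M : R) :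
  0 <= D -> hausdorff D (lseq p) -> convex_on M (horner P) ->
  D * \sum_(i < n) tnth a i ^+ 2 <= M ->
  majorizes (sqr_tuple a) (sqr_tuple b) ->
  ballpoly p n P [seq c ^+ 2 | c <- b] <= ballpoly p n P [seq c ^+ 2 | c <- a].
Proof.
move=> D0 hl cP aM [eqS maj].
have sE (a' : n.-tuple R) : ballpoly p n P [seq c ^+ 2 | c <- a'] =
    ballpoly p n P (mkseq (nth 0 (sort >=%R (sqr_tuple a'))) n).
  apply: ballpoly_perm; rewrite -sqr_tupleE.
  have -> : mkseq (nth 0 (sort >=%R (sqr_tuple a'))) n = sort >=%R (sqr_tuple a').
    by rewrite -[n in mkseq _ n](size_tuple (sqr_tuple a')) -(size_sort >=%R) mkseq_nth.
  by rewrite perm_sym perm_sort.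
have sz (a' : n.-tuple R) : size (sort >=%R (sqr_tuple a')) = n.
  by rewrite size_sort size_tuple.
have nn (a' : n.-tuple R) i : (i < n)%N -> 0 <= (sort >=%R (sqr_tuple a'))`_i.
  move=> ni; have : (sort >=%R (sqr_tuple a'))`_i \in sqr_tuple a'.
    by rewrite -(mem_sort >=%R) mem_nth// sz.
  by move=> /tnthP[k ->]; rewrite tnth_mktuple sqr_ge0.
have sumE (a' : n.-tuple R) : \sum_(i < n) (sort >=%R (sqr_tuple a'))`_i =
    \sum_(i < n) tnth (sqr_tuple a') i.
  have <- : \sum_(c <- sqr_tuple a') c = \sum_(i < n) tnth (sqr_tuple a') i by rewrite big_tuple.
  by rewrite sum_nth_seq//; apply: perm_big; rewrite perm_sort.
rewrite !sE.
apply: (@majorize_le R n (ballpoly p n P) (\sum_(i < n) tnth (sqr_tuple a) i)).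
- by move=> s t st; apply: ballpoly_perm.
- move=> f g t f0 g0 fC gC t01.
  have CE : \sum_(i < n) tnth (sqr_tuple a) i = \sum_(i < n) tnth a i ^+ 2.
    by apply: eq_bigr => i _; rewrite tnth_mktuple.
  by apply: (ballpoly_convex p1 p2 D0 hl cP) => //; rewrite ?fC ?gC CE.
- exact: nn.
- exact: nn.
- move=> i j /andP[ij jn].
  have srt : sorted >=%R (sort >=%R (sqr_tuple b)).
    by apply: sort_sorted => x y; exact: le_total.
  apply: (sorted_leq_nth _ _ _ srt) => //.
  + by move=> x y z h1 h2; exact: le_trans h2 h1.
  + by move=> x; exact: lexx.
  + by rewrite inE sz; exact: leq_ltn_trans jn.
  + by rewrite inE sz.
- exact: sumE.
- by rewrite sumE.
- move=> q; rewrite leq_eqVlt => /orP[/eqP ->|qn]; first by rewrite !sumE eqS.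
  by case: q qn => [|q] qn; [rewrite !big_ord0|exact: maj].
Qed.

Lemma ball_poly_integral n (P : {poly R}) (a : n.-tuple R) :
  (forall x : n.-tuple R, Np p x <= 1 -> 0 <= P.[inner a x ^+ 2]) ->
  (\int[lam n]_x (ball_weight p 0 x * P.[inner a x ^+ 2])%:E =
   (ballpoly p n P [seq c ^+ 2 | c <- a])%:E)%E.
Proof.
move=> P0.
have E (x : n.-tuple R) : ball_weight p 0 x * P.[inner a x ^+ 2] =
    \sum_(j < size P) P`_j * (ball_weight p 0 x * inner a x ^+ j.*2).
  rewrite horner_coef mulr_sumr; apply: eq_bigr => j _.
  by rewrite -exprM mul2n; ring.
under eq_integral => x _ do rewrite E.
apply: integral_signed_sum.
- move=> j; apply: measurable_funM; first exact: measurable_ball_weight.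
  by apply: measurable_funX; exact: measurable_inner.
- by move=> j x; rewrite mulr_ge0 ?ball_weight_ge0// expr_double_ge0.
- by move=> j; exact: ball_inner.
- move=> x; rewrite -E /ball_weight; case: ifP => N1; last by rewrite mul0r.
  by rewrite mul1r P0.
Qed.

Lemma inner_sqr_le n (a x : n.-tuple R) : Np p x <= 1 ->
  0 <= inner a x ^+ 2 <= (\sum_(i < n) `|tnth a i|) ^+ 2.
Proof.
move=> N1; rewrite sqr_ge0/= -real_normK ?num_real// lerXn2r// ?nnegrE//.
  by apply: sumr_ge0.
apply: le_trans (ler_norm_sum _ _ _) _; apply: ler_sum => i _.
by rewrite normrM ler_piMr// (coord_le1 p1).
Qed.

(** The sets where a convex function is below a constant are intervals. *)
Lemma measurable_convex (f : R -> R) : convex_fun f -> measurable_fun setT f.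
Proof.
move=> cf mD; apply: (measurability _ (RGenInftyO.measurableE R)) => //.
move=> _ [_ [c ->] <-]; rewrite setTI; apply: is_interval_measurable.
move=> x y /=; rewrite !in_itv/= => fx fy z /andP[xz zy].
have [xy|xy] := eqVneq x y.
  by have -> : z = x by apply/eqP; rewrite eq_le xz xy zy.
have yx : 0 < y - x by rewrite subr_gt0 lt_neqAle xy (le_trans xz).
pose t := (y - z) / (y - x).
have t01 : 0 <= t <= 1.
  apply/andP; split; first by apply: divr_ge0; [rewrite subr_ge0|exact: ltW].
  by rewrite /t ler_pdivrMr// mul1r; lra.
have -> : z = t * x + (1 - t) * y by rewrite /t; field; rewrite gt_eqF.
apply: le_lt_trans (cf _ _ _ t01) _.
case/andP: t01 => t0 t1; rewrite [ltRHS](_ : c = t * c + (1 - t) * c); last by ring.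
have [->|tn] := eqVneq t 0; first by rewrite !mul0r !add0r subr0 !mul1r.
apply: ltr_leD; first by rewrite ltr_pM2l// lt_neqAle eq_sym tn.
by apply: ler_wpM2l; [rewrite subr_ge0|exact: ltW].
Qed.

(** A convex function is approximated from above on [0, M] by a convex
    polynomial, nonnegative there, for which [ballpoly_le] applies; the error is
    at most a multiple of the volume of the ball. *)
Lemma ball_convex_le n (a b : n.-tuple R) (f : R -> R) :
  majorizes (sqr_tuple a) (sqr_tuple b) ->
  convex_fun f -> (forall y, 0 <= y -> 0 <= f y) ->
  (\int[lam n]_x (ball_weight p 0 x * f (inner b x ^+ 2))%:E <=
   \int[lam n]_x (ball_weight p 0 x * f (inner a x ^+ 2))%:E)%E.
Proof.
move=> maj cf f0; have mf := measurable_convex cf.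
have [D D0 hl] := hausdorff_lseq p1 p2.
pose Sa := (\sum_(i < n) `|tnth a i|) ^+ 2; pose Sb := (\sum_(i < n) `|tnth b i|) ^+ 2.
pose S2 := D * \sum_(i < n) tnth a i ^+ 2.
have Sa0 : 0 <= Sa by exact: sqr_ge0.
have Sb0 : 0 <= Sb by exact: sqr_ge0.
have S20 : 0 <= S2 by rewrite mulr_ge0// sumr_ge0// => i _; exact: sqr_ge0.
pose M := 1 + Sa + Sb + S2.
have M0 : 0 < M by rewrite /M; lra.
have S2M : S2 <= M by rewrite /M; lra.
have aM x : Np p x <= 1 -> 0 <= inner a x ^+ 2 <= M.
  by move=> /(inner_sqr_le a)/andP[-> h]/=; rewrite (le_trans h)// -/Sa /M; lra.
have bM x : Np p x <= 1 -> 0 <= inner b x ^+ 2 <= M.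
  by move=> /(inner_sqr_le b)/andP[-> h]/=; rewrite (le_trans h)// -/Sb /M; lra.
have msq (a' : n.-tuple R) : measurable_fun setT (fun x => inner a' x ^+ 2).
  by apply: measurable_funX; exact: measurable_inner.
have mw : measurable_fun setT (@ball_weight R p n 0) by exact: measurable_ball_weight.
have mwf (a' : n.-tuple R) : measurable_fun setT (fun x => ball_weight p 0 x * f (inner a' x ^+ 2)).
  by apply: measurable_funM => //; exact: (measurableT_comp mf (msq a')).
have wf0 (a' x : n.-tuple R) : 0 <= ball_weight p 0 x * f (inner a' x ^+ 2).
  by rewrite mulr_ge0 ?ball_weight_ge0// f0// sqr_ge0.
pose V := ballmom p n [seq c ^+ 2 | c <- a] 0.
have VE : (\int[lam n]_x (ball_weight p 0 x)%:E = V%:E)%E.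
  rewrite /V -ball_inner//; apply: eq_integral => x _.
  by rewrite double0 expr0 mulr1.
have V0 : 0 <= V.
  by rewrite -lee_fin -VE; apply: integral_ge0 => x _; rewrite lee_fin ball_weight_ge0.
apply/lee_addgt0Pr => e e0.
(* The total error is [2 * e' * V]; adding 1 covers the case [V = 0]. *)
pose e' := e / (2 * (V + 1)).
have e'0 : 0 < e' by rewrite divr_gt0// mulr_gt0// ltr_wpDl.
have [P0 [cP0 P0f]] := convex_poly_approx cf M0 e'0.
(* The shift makes the approximation one-sided, hence nonnegative. *)
pose P := P0 + e'%:P.
have PE y : P.[y] = P0.[y] + e' by rewrite hornerD hornerC.
have cP : convex_on M (horner P).
  move=> x y t xM yM t01; rewrite !PE.
  apply: le_trans (lerD (cP0 x y t xM yM t01) (lexx _)) _.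
  by rewrite le_eqVlt; apply/orP; left; apply/eqP; ring.
have fP y : 0 <= y <= M -> f y <= P.[y] /\ P.[y] <= f y + 2 * e'.
  by move=> /P0f; rewrite PE ler_norml => /andP[h1 h2]; split; lra.
have Ppos (a' : n.-tuple R) : (forall x, Np p x <= 1 -> 0 <= inner a' x ^+ 2 <= M) ->
    forall x, Np p x <= 1 -> 0 <= P.[inner a' x ^+ 2].
  move=> h x /h xM; have [h1 _] := fP _ xM; apply: le_trans h1.
  by apply: f0; case/andP: xM.
have mP (a' : n.-tuple R) : measurable_fun setT (fun x => ball_weight p 0 x * P.[inner a' x ^+ 2]).
  apply: measurable_funM => //.
  apply: (@eq_measurable_fun _ _ _ _ _ (fun x => \sum_(i < size P) P`_i * (inner a' x ^+ 2) ^+ i)).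
    by move=> x _; rewrite horner_coef.
  by apply: measurable_sum => i; apply: measurable_funM => //; exact: measurable_funX.
apply: (@le_trans _ _ (\int[lam n]_x (ball_weight p 0 x * P.[inner b x ^+ 2])%:E)%E).
  apply: ge0_le_integralr => // x.
  rewrite /ball_weight; case: ifP => N1; last by rewrite !mul0r.
  by rewrite !mul1r; case: (fP _ (bM _ N1)).
rewrite (ball_poly_integral (Ppos b bM)).
apply: (@le_trans _ _ (ballpoly p n P [seq c ^+ 2 | c <- a])%:E).
  by rewrite lee_fin; exact: ballpoly_le D0 hl cP S2M maj.
rewrite -(ball_poly_integral (Ppos a aM)).
apply: (@le_trans _ _ (\int[lam n]_x (ball_weight p 0 x * f (inner a x ^+ 2) + 2 * e' * ball_weight p 0 x)%:E)%E).
  apply: ge0_le_integralr => //.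
  - by apply: measurable_funD => //; apply: measurable_funM.
  - move=> x; rewrite /ball_weight; case: ifP => N1; last by rewrite mul0r.
    by rewrite expr0 mul1r (Ppos a aM).
  - move=> x; rewrite /ball_weight; case: ifP => N1; last by rewrite !mul0r mulr0 addr0.
    by rewrite !mul1r mulr1; case: (fP _ (aM _ N1)).
have e20 : 0 <= 2 * e' by rewrite mulr_ge0// ltW.
rewrite ge0_integral_addr//; last 2 first.
- exact: measurable_funM.
- by move=> x; rewrite mulr_ge0// ball_weight_ge0.
rewrite leeD2l// (ge0_integral_mulr (lam n) mw (@ball_weight_ge0 _ p n 0) e20) VE.
rewrite -EFinM lee_fin /e'.
have -> : 2 * (e / (2 * (V + 1))) * V = e * (V / (V + 1)).
  by field; rewrite gt_eqF// ltr_wpDl.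
rewrite ler_piMr ?(ltW e0)// ler_pdivrMr ?ltr_wpDl// mul1r lerDl.
exact: ler01.
Qed.

End ball_convex_order.

(** * Integrals against densities, perturbed integrands and independent pairs *)

Section densities.
Context d (T : measurableType d) {R : realType}.

(** The density agrees almost everywhere with the Radon-Nikodym derivative. *)
Lemma ge0_integral_density (m : {sigma_finite_measure set T -> \bar R})
    (mu : {finite_measure set T -> \bar R}) (g f : T -> R) :
  measurable_fun setT g -> (forall x, 0 <= g x) ->
  (forall A, measurable A -> mu A = (\int[m]_(x in A) (g x)%:E)%E) ->
  measurable_fun setT f -> (forall x, 0 <= f x) ->
  (\int[mu]_x (f x)%:E = \int[m]_x (f x * g x)%:E)%E.
Proof.
move=> mg g0 muE mf f0.
have dom : mu `<< m.
  move=> N nN A mA AN; rewrite muE//; apply: null_set_integral => //.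
    by apply/measurable_EFinP; exact: measurable_funTS.
  exact: nN.
have mr := Radon_Nikodym_SigmaFinite.f_integrable dom.
have mEf : measurable_fun setT (EFin \o f) by exact/measurable_EFinP.
rewrite -(Radon_Nikodym_SigmaFinite.change_of_variables dom (f := EFin \o f))//.
apply: ge0_ae_eq_integral => //.
- by apply: emeasurable_funM => //; exact: measurable_int mr.
- by apply/measurable_EFinP; exact: measurable_funM.
- by move=> x _; rewrite mule_ge0// ?lee_fin//; exact: Radon_Nikodym_SigmaFinite.f_ge0.
- by move=> x _; rewrite lee_fin mulr_ge0.
have : ae_eq m setT (Radon_Nikodym_SigmaFinite.f mu m) (EFin \o g).
  apply: integral_ae_eq => //; first exact/measurable_EFinP.
  by move=> E _ mE; rewrite -Radon_Nikodym_SigmaFinite.f_integral// muE.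
by apply: filterS => x /(_ I) e _; rewrite /= e.
Qed.

End densities.

Section affine_part.
Context d (T : measurableType d) {R : realType} (m : {measure set T -> \bar R}).

(** Additivity when the integral of [f] may be infinite: then the positive part of
    [f + l] has infinite integral, while the negative part is dominated by
    [`|l|]. *)
Lemma integral_add_integrable (f l : T -> R) : measurable_fun setT f ->
  (forall x, 0 <= f x) -> m.-integrable setT (EFin \o l) ->
  (\int[m]_x (f x + l x)%:E = \int[m]_x (f x)%:E + \int[m]_x (l x)%:E)%E.
Proof.
move=> mf f0 il.
have ml : measurable_fun setT l by apply/measurable_EFinP; exact: measurable_int il.
have mEf : measurable_fun setT (EFin \o f) by exact/measurable_EFinP.
have lfin : (\int[m]_x (l x)%:E)%E \is a fin_num by exact: integrable_fin_num.
have If0 : (0 <= \int[m]_x (f x)%:E)%E by apply: integral_ge0 => x _; rewrite lee_fin.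
have [ffin|] := boolP ((\int[m]_x (f x)%:E)%E \is a fin_num).
  rewrite (_ : (\int[m]_x (f x + l x)%:E = \int[m]_x ((EFin \o f) x + (EFin \o l) x))%E)//.
  rewrite integralD//.
  apply/integrableP; split => //.
  under eq_integral => x _ do rewrite /= ger0_norm//.
  by rewrite -ge0_fin_numE.
rewrite ge0_fin_numE// -leNgt leye_eq => /eqP foo; rewrite foo.
rewrite addye; last by move: lfin; rewrite fin_numE => /andP[].
pose h x := f x + l x.
have mh : measurable_fun setT (EFin \o h).
  by apply/measurable_EFinP; exact: measurable_funD.
have labs := integrable_abse il.
have labsf : (\int[m]_x `|(l x)%:E| < +oo)%E.
  by case/integrableP: il.
have mla : measurable_fun setT (fun x => `|(l x)%:E|%E).
  by apply/measurable_EFinP; exact: measurableT_comp.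
have mhp : measurable_fun setT (EFin \o h)^\+%E by exact: measurable_funepos.
have mhn : measurable_fun setT (EFin \o h)^\-%E by exact: measurable_funeneg.
have posE : (\int[m]_x ((EFin \o h)^\+ x) = +oo)%E.
  have h1 : (\int[m]_x (f x)%:E <= \int[m]_x ((EFin \o h)^\+ x + `|(l x)%:E|))%E.
    apply: ge0_le_integral => //.
    - by move=> x _; rewrite lee_fin.
    - exact: emeasurable_funD.
    - move=> x _; rewrite funeposE /= -EFin_max -EFinD lee_fin /h.
      apply: (@le_trans _ _ (f x + l x + `|l x|)).
        by have := ler_norm (- l x); rewrite normrN; lra.
      by rewrite lerD2r le_max lexx.
  rewrite ge0_integralD// foo leye_eq in h1.
  move: h1 labsf; set p := integral _ _ (_^\+)%E; set q := integral _ _ _.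
  by case: p => //; case: q.
have negE : (\int[m]_x ((EFin \o h)^\- x) < +oo)%E.
  apply: le_lt_trans labsf; apply: ge0_le_integral => //.
  move=> x _; rewrite funenegE /= -EFin_max lee_fin /h ge_max normr_ge0 andbT.
  by have := ler_norm (- l x); have := f0 x; rewrite normrN; lra.
rewrite [LHS]integralE posE.
by move: negE; set q := integral _ _ _; case: q.
Qed.

End affine_part.

Section independence.
Context d d1 d2 (T : measurableType d) (T1 : measurableType d1) (T2 : measurableType d2)
  {R : realType} (P : probability T R) (X : {RV P >-> T1}) (Y : {RV P >-> T2}).

Lemma ge0_integral_indep (f : T1 * T2 -> \bar R) : independent_RVs X Y ->
  measurable_fun setT f -> (forall z, 0 <= f z)%E ->
  (\int[P]_w f (X w, Y w) =
   \int[distribution P X]_x \int[distribution P Y]_y f (x, y))%E.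
Proof.
move=> ind mf f0.
pose XY (w : T) := (X w, Y w).
have mXY : measurable_fun setT XY by apply/measurable_fun_pairP; split.
transitivity (\int[pushforward P XY]_z f z)%E.
  by rewrite (ge0_integral_pushforward mXY).
transitivity (\int[(distribution P X \x distribution P Y)%E]_z f z)%E.
  apply: eq_measure_integral => A mA _; apply/esym.
  pose m' := @measure_function_pushforward__canonical__measure_function_Measure _ _ _ _ _ P XY mXY.
  have rect B C : measurable B -> measurable C ->
      m' (B `*` C) = (distribution P X B * distribution P Y C)%E.
    by move=> mB mC; exact: (ind B C mB mC).
  exact: (product_measure_unique rect mA).
by rewrite fubini_tonelli1.
Qed.

End independence.

(** * Nonincreasing radial densities as mixtures of balls *)

Section initial_segments.
Context {R : realType}.

(** An initial segment of [0, +oo[ is the union of an increasing sequence of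
    closed intervals [0, r k]: constant if it has a maximum, the integers if it
    is unbounded, and a sequence tending to its supremum otherwise. *)
Lemma initial_segment_cofinal (J : set R) : J !=set0 -> (forall t, J t -> 0 <= t) ->
  (forall s t : R, 0 <= s -> s <= t -> J t -> J s) ->
  exists r : nat -> R, [/\ forall i j, (i <= j)%N -> r i <= r j,
    forall k, J (r k) & forall t, J t -> exists k, t <= r k].
Proof.
move=> [t0 Jt0] J0 Jd.
have [[m Jm mmax]|nomax] := pselect (exists2 m, J m & forall t, J t -> t <= m).
  by exists (fun=> m); split => // t Jt; exists 0%N; exact: mmax.
have [ubJ|nub] := pselect (has_ubound J); last first.
  exists (fun k => k%:R); split => [i j ij|k|t Jt].
  - by rewrite ler_nat.
  - apply: contrapT => nJ; apply: nub; exists k%:R => t Jt.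
    rewrite leNgt; apply/negP => kt; apply: nJ; exact: (Jd _ t _ (ltW kt)).
  - by exists (Num.trunc t).+1; rewrite ltW// truncnS_gt.
have supJ : has_sup J by split => //; exists t0.
pose S := sup J.
have tS t : J t -> t < S.
  move=> Jt; rewrite lt_neqAle (ub_le_sup ubJ Jt) andbT; apply/eqP => tE.
  by apply: nomax; exists t => // u Ju; rewrite tE; exact: ub_le_sup.
have S0 : 0 < S by exact: le_lt_trans (J0 _ Jt0) (tS _ Jt0).
have k0 (k : nat) : 0 < k.+1%:R :> R by [].
exists (fun k => S - S / k.+1%:R); split => [i j ij|k|t Jt].
- by rewrite lerB// ler_wpM2l ?(ltW S0)// lef_pV2 ?posrE// ler_nat.
- have [t Jt] := sup_adherent (divr_gt0 S0 (k0 k)) supJ.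
  move=> h; apply: (Jd _ t _ (ltW h)) => //.
  by rewrite subr_ge0 ler_pdivrMr// ler_peMr ?(ltW S0)// ler1n.
- have d0 : 0 < S - t by rewrite subr_gt0 tS.
  exists (Num.trunc (S / (S - t))).
  by rewrite lerBrDr -lerBrDl ler_pdivrMr// mulrC -ler_pdivrMr// ltW// truncnS_gt.
Qed.

End initial_segments.

Section radial_densities.
Context {R : realType}.
Variable p : R.
Hypothesis p0 : 0 < p.
Variable n : nat.
Local Notation lam := (lebesgue_tuple R n).
Local Notation mu := (@lebesgue_measure R).

Lemma lp_norm_ge0 (x : n.-tuple R) : 0 <= lp_norm p x.
Proof. exact: powR_ge0. Qed.

Lemma lp_norm_le (x : n.-tuple R) (r : R) : 0 <= r -> (lp_norm p x <= r) = (Np p x <= r `^ p).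
Proof.
move=> r0; have N0 := Np_ge0 p x.
have E : lp_norm p x `^ p = Np p x by rewrite /lp_norm -powRrM mulVf ?gt_eqF// powRr1.
apply/idP/idP => h.
  by rewrite -E ge0_ler_powR ?nnegrE ?lp_norm_ge0// ltW.
rewrite leNgt; apply/negP => rx.
have := @gt0_ltr_powR R p p0 r (lp_norm p x); rewrite !nnegrE r0 lp_norm_ge0 => /(_ isT isT rx).
by rewrite E ltNge h.
Qed.

Lemma measurable_lp_norm : measurable_fun setT (@lp_norm R n p).
Proof. exact: (measurableT_comp (measurable_powR _) (@measurable_Np _ p n)). Qed.

Variables fb fa : n.-tuple R -> R.
Hypotheses (mfb : measurable_fun setT fb) (mfa : measurable_fun setT fa).
Hypotheses (fb0 : forall x, 0 <= fb x) (fa0 : forall x, 0 <= fa x).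
Hypothesis fba : forall r : R,
  (\int[lam]_x (ball_weight p 0 x * fb (scale_tuple r x))%:E <=
   \int[lam]_x (ball_weight p 0 x * fa (scale_tuple r x))%:E)%E.
Hypothesis fba0 : forall x, Np p x <= 0 -> fb x <= fa x.

Local Notation cball r := [set x : n.-tuple R | lp_norm p x <= r].

Lemma measurable_cball r : measurable (cball r).
Proof.
have -> : cball r = (fun x => lp_norm p x <= r) @^-1` [set true].
  by apply/seteqP; split => x /=.
rewrite -[X in measurable X]setTI.
have : measurable_fun setT (fun x : n.-tuple R => lp_norm p x <= r).
  by apply: measurable_fun_ler; [exact: measurable_lp_norm|exact: measurable_cst].
exact.
Qed.

Lemma integral_cball (f : n.-tuple R -> R) r : 0 < r -> measurable_fun setT f ->
  (forall x, 0 <= f x) ->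
  (\int[lam]_(x in cball r) (f x)%:E =
   (r ^+ n)%:E * \int[lam]_x (ball_weight p 0 x * f (scale_tuple r x))%:E)%E.
Proof.
move=> r0 mf f0.
have rV0 : 0 < r^-1 by rewrite invr_gt0.
pose h x := ball_weight p 0 x * f (scale_tuple r x).
have mh : measurable_fun setT (EFin \o h).
  apply/measurable_EFinP; apply: measurable_funM; first exact: measurable_ball_weight.
  exact: (measurableT_comp mf (measurable_scale_tuple _)).
have h0 x : (0 <= (EFin \o h) x)%E by rewrite lee_fin mulr_ge0// ball_weight_ge0.
have := ge0_integral_tuple_scale rV0 mh h0.
rewrite exprVn invrK => <-.
rewrite integral_mkcond; apply: eq_integral => x _.
rewrite patchE /= /h /ball_weight Np_scale ?(ltW rV0)//.
have -> : scale_tuple r (scale_tuple r^-1 x) = x.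
  by apply: eq_from_tnth => i; rewrite !tnth_scale mulrA divff ?mul1r// gt_eqF.
have -> : (r^-1 `^ p * Np p x <= 1) = (Np p x <= r `^ p).
  rewrite -powR_inv1 ?(ltW r0)// -powRrM mulN1r powRN mulrC ler_pdivrMr ?powR_gt0//.
  by rewrite mul1r.
rewrite -lp_norm_le ?(ltW r0)//.
have [xr|xr] := boolP (lp_norm p x <= r).
  by rewrite mem_set// expr0 mul1r.
by rewrite memNset ?mul0r//; exact/negP.
Qed.

(** The radius 0 is separate because dilations only reach positive radii. *)
Lemma cball_le r : 0 <= r ->
  (\int[lam]_(x in cball r) (fb x)%:E <= \int[lam]_(x in cball r) (fa x)%:E)%E.
Proof.
rewrite le_eqVlt => /orP[/eqP <-|r0]; last first.
  by rewrite !integral_cball// lee_wpmul2l// lee_fin exprn_ge0// ltW.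
apply: ge0_le_integral => //.
- exact: measurable_cball.
- by move=> x _; rewrite lee_fin.
- by apply/measurable_EFinP; exact: measurable_funTS.
- by apply/measurable_EFinP; exact: measurable_funTS.
- move=> x /=; rewrite lp_norm_le// powR0 ?gt_eqF// lee_fin => N0.
  exact: fba0.
Qed.

(** Monotone convergence along the balls of radii [r k]. *)
Lemma radial_set_le (J : set R) : (forall t, J t -> 0 <= t) ->
  (forall s t : R, 0 <= s -> s <= t -> J t -> J s) ->
  (\int[lam]_(x in [set x | J (lp_norm p x)]) (fb x)%:E <=
   \int[lam]_(x in [set x | J (lp_norm p x)]) (fa x)%:E)%E.
Proof.
move=> J0 Jd.
have [JN|] := pselect (J !=set0); last first.
  move=> /set0P/negP/negPn/eqP ->; rewrite (_ : [set x | set0 (lp_norm p x)] = set0).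
    by rewrite !integral_set0.
  by apply/seteqP; split.
have [r [rn rJ rc]] := initial_segment_cofinal JN J0 Jd.
have -> : [set x | J (lp_norm p x)] = \bigcup_k cball (r k).
  apply/seteqP; split => x /=; first by move=> /rc[k h]; exists k.
  by move=> [k _ /= h]; apply: Jd h (rJ k); exact: lp_norm_ge0.
have nd : nondecreasing_seq (fun k => cball (r k)).
  by move=> i j ij; apply/subsetPset => x /= h; exact: le_trans h (rn _ _ ij).
have mF k := measurable_cball (r k).
have mfT (f : n.-tuple R -> R) (A : set (n.-tuple R)) : measurable_fun setT f -> measurable_fun A (EFin \o f).
  by move=> mf; apply/measurable_EFinP; exact: measurable_funTS.
have cb := @ge0_nondecreasing_set_cvg_integral _ _ R (fun k => cball (r k)) (EFin \o fb) lam nd mF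
  (fun k => mfT fb _ mfb) (fun k x _ => fb0 x).
apply: (cvge_to_le cb); apply: nearW => k.
apply: le_trans (cball_le (J0 _ (rJ k))) _.
apply: ge0_subset_integral => //.
- exact: bigcup_measurable.
- exact: mfT.
- by move=> x _; rewrite lee_fin.
- by move=> x h; exists k.
Qed.

(** The layer cake in the value of the density: the level sets
    [s < rho (lp_norm p x)] are sets of [radial_set_le] because [rho] is
    nonincreasing. *)
Lemma radial_density_le (rho : R -> R) :
  (forall t : R, 0 <= t -> 0 <= rho t) ->
  (forall s t : R, 0 <= s -> s <= t -> rho t <= rho s) ->
  measurable_fun setT (fun x : n.-tuple R => rho (lp_norm p x)) ->
  (\int[lam]_x (fb x * rho (lp_norm p x))%:E <=
   \int[lam]_x (fa x * rho (lp_norm p x))%:E)%E.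
Proof.
move=> rho0 rhod mrho.
pose N (x : n.-tuple R) := rho (lp_norm p x).
pose F (f : n.-tuple R -> R) (z : measurableTypeR R * n.-tuple R) : R :=
  if (0 < z.1) && (z.1 < N z.2) then f z.2 else 0.
have F0 (f : n.-tuple R -> R) z : (forall x, 0 <= f x) -> 0 <= F f z by move=> f0; rewrite /F; case: ifP.
have m1 : measurable_fun setT (fun z : measurableTypeR R * n.-tuple R => z.1 : R).
  exact: measurable_fst.
have m2 : measurable_fun setT (fun z : measurableTypeR R * n.-tuple R => z.2).
  exact: measurable_snd.
have mF (f : n.-tuple R -> R) : measurable_fun setT f -> measurable_fun setT (F f).
  move=> mf; apply: measurable_fun_ifT; [|exact: measurableT_comp mf m2|exact: measurable_cst].
  apply: measurable_and; first by apply: measurable_fun_ltr => //; exact: measurable_cst.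
  by apply: measurable_fun_ltr => //; exact: measurableT_comp mrho m2.
pose L (f : n.-tuple R -> R) (s : R) := (\int[lam]_x (F f ((s : measurableTypeR R), x))%:E)%E.
have L0 (f : n.-tuple R -> R) (s : R) : (forall x, 0 <= f x) -> (0 <= L f s)%E.
  by move=> f0; apply: integral_ge0 => x _; rewrite lee_fin F0.
have mL (f : n.-tuple R -> R) : measurable_fun setT f -> (forall x, 0 <= f x) -> measurable_fun setT (L f).
  move=> mf f0; apply: (@measurable_fun_fubini_tonelli_F _ _ (measurableTypeR R) _ R lam
    (EFin \o F f)); first exact: (proj2 (measurable_EFinP _ _) (mF f mf)).
  by move=> z; rewrite /= lee_fin F0.
have LE (f : n.-tuple R -> R) : measurable_fun setT f -> (forall x, 0 <= f x) ->
    (\int[lam]_x (f x * N x)%:E = \int[mu]_s L f s)%E.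
  move=> mf f0.
  have FT := @fubini_tonelli _ _ (measurableTypeR R) (n.-tuple R) R mu lam (EFin \o F f)
    (proj2 (measurable_EFinP _ _) (mF f mf)) (fun z => F0 f z f0).
  rewrite /L FT; apply: eq_integral => x _; rewrite /F /=.
  have N0 : 0 <= N x by apply: rho0; exact: lp_norm_ge0.
  (* The indicator of ]0, N x[, in the shape of [integral_powR]. *)
  pose q (t : R) : R := if (0 < t) && (t < N x) then t `^ (1 - 1) else 0.
  have mq : measurable_fun setT q.
    apply: measurable_fun_ifT; [|exact: measurable_powR|exact: measurable_cst].
    apply: measurable_and; first exact: measurable_pos_bool.
    by apply: measurable_fun_ltr => //; exact: measurable_cst.
  have q0 (t : R) : 0 <= q t by rewrite /q; case: ifP => // _; exact: powR_ge0.
  transitivity (\int[mu]_t (f x * q t)%:E)%E; last first.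
    apply: eq_integral => t _; congr EFin; rewrite /q; case: ifP => _; last by rewrite mulr0.
    by rewrite subrr powRr0 mulr1.
  rewrite (ge0_integral_mulr mu mq q0 (f0 x)) EFinM; congr (_ * _)%E.
  move: N0; rewrite le_eqVlt => /orP[/eqP e|N0].
    rewrite -e integral0_eq// => t _; rewrite /q -e; case: ifP => // /andP[t0 /(lt_trans t0)].
    by rewrite ltxx.
  by rewrite integral_powR// powRr1 ?(ltW N0)// divr1.
rewrite (LE fb mfb fb0) (LE fa mfa fa0); apply: ge0_le_integral => //.
- by move=> s _; exact: L0.
- exact: mL.
- exact: mL.
move=> s _.
pose J := [set t : R | 0 <= t /\ 0 < s < rho t].
have LJ (f : n.-tuple R -> R) : L f s = (\int[lam]_(x in [set x | J (lp_norm p x)]) (f x)%:E)%E.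
  rewrite integral_mkcond; apply: eq_integral => x _; rewrite patchE /F /=.
  case: ifPn => h; first by rewrite mem_set//; split => //; exact: lp_norm_ge0.
  by rewrite memNset// => -[_]; exact/negP.
rewrite !LJ; apply: radial_set_le.
- by move=> t [].
- move=> t u t0 tu [u0 /andP[s0 su]]; split => //.
  by rewrite s0 (lt_le_trans su)// rhod.
Qed.

End radial_densities.

(** * Test functions for the convex order *)

Section convex_order.
Context {R : realType}.

Lemma convex_functionE (f : R -> R) : convex_function [set: R^o] f -> convex_fun f.
Proof.
move=> cf x y t /andP[t0 t1].
have := cf (Itv01 t0 t1) x y; rewrite !inE => /(_ I I).
by rewrite !convRE.
Qed.

(** The line through the values at -1 and 0 lies below a convex function to the
    right of 0. *)
Lemma convex_affine_minorant (f : R -> R) y : convex_fun f -> 0 <= y ->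
  f 0 + (f 0 - f (-1)) * y <= f y.
Proof.
move=> cf; rewrite le_eqVlt => /orP[/eqP <-|y0]; first by rewrite mulr0 addr0.
have := @convex_slopes R f cf (-1) 0 y; rewrite oppr_lt0 ltr01 => /(_ isT y0).
by rewrite subr0 opprK add0r mulr1 lerBrDl.
Qed.

(** The means of [U] and [V] agree, so that an affine function can be subtracted
    from a convex one without changing the comparison; subtracting the line of
    [convex_affine_minorant] makes it nonnegative on [0, +oo[, where [U] and [V]
    take their values. *)
Lemma convex_le_nonneg d (T : measurableType d) (P : probability T R) (U V : T -> R) :
  measurable_fun setT U -> measurable_fun setT V ->
  (forall w, 0 <= U w) -> (forall w, 0 <= V w) ->
  (\int[P]_w (V w)%:E < +oo)%E ->
  (\int[P]_w (V w)%:E <= \int[P]_w (U w)%:E)%E ->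
  (forall f : R -> R, convex_fun f -> (forall y, 0 <= y -> 0 <= f y) ->
     (\int[P]_w (f (U w))%:E <= \int[P]_w (f (V w))%:E)%E) ->
  convex_le P U P V.
Proof.
move=> mU mV U0 V0 Voo VU le_psi.
have UV : (\int[P]_w (U w)%:E = \int[P]_w (V w)%:E)%E.
  apply/eqP; rewrite eq_le VU andbT; apply: (le_psi id) => //.
have int (W : T -> R) : measurable_fun setT W -> (forall w, 0 <= W w) ->
    (\int[P]_w (W w)%:E < +oo)%E -> P.-integrable setT (EFin \o W).
  move=> mW W0 Woo; apply/integrableP; split; first exact/measurable_EFinP.
  by under eq_integral => w _ do rewrite /= ger0_norm//.
have iV := int V mV V0 Voo.
have iU : P.-integrable setT (EFin \o U) by apply: int => //; rewrite UV.
split; [exact: iU|exact: iV|move=> f cf _ _].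
have {}cf := convex_functionE cf.
pose s := f 0 - f (-1).
pose g y := f y - (f 0 + s * y).
have cg : convex_fun g.
  move=> x y t t01; rewrite /g.
  apply: le_trans (lerB (cf x y t t01) (lexx _)) _.
  by rewrite le_eqVlt; apply/orP; left; apply/eqP; ring.
have g0 y : 0 <= y -> 0 <= g y by move=> y0; rewrite subr_ge0; exact: convex_affine_minorant.
have icst : P.-integrable setT (EFin \o cst (f 0)) by exact: finite_measure_integrable_cst.
have iZ (W : T -> R) : P.-integrable setT (EFin \o W) ->
    P.-integrable setT (fun w => s%:E * (W w)%:E)%E.
  by move=> iW; apply: integrableZl.
have split_int (W : T -> R) : measurable_fun setT W -> (forall w, 0 <= W w) ->
    P.-integrable setT (EFin \o W) ->
    (\int[P]_w (f (W w))%:E = \int[P]_w (g (W w))%:E +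
      (\int[P]_w (f 0)%:E + s%:E * \int[P]_w (W w)%:E))%E.
  move=> mW W0 iW.
  have iL : P.-integrable setT (EFin \o (fun w => f 0 + s * W w)).
    by apply: eq_integrable (integrableD measurableT icst (iZ W iW)).
  transitivity (\int[P]_w (g (W w) + (f 0 + s * W w))%:E)%E.
    by apply: eq_integral => w _; rewrite /g subrK.
  rewrite (integral_add_integrable _ _ iL).
  - congr (_ + _)%E.
    rewrite -(integralZl measurableT iW).
    rewrite -(integralD measurableT icst (iZ W iW)).
    by apply: eq_integral => w _.
  - by apply: (measurableT_comp _ mW); exact: measurable_convex.
  - by move=> w; exact: g0.
rewrite unlock (split_int U mU U0 iU) (split_int V mV V0 iV) UV.
by apply: leeD => //; exact: le_psi.
Qed.

End convex_order.

Section linear_forms.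
Context {R : realType}.
Variable p : R.
Hypothesis p1 : 1 <= p.
Hypothesis p2 : p <= 2.
Variable n : nat.
Local Notation lam := (lebesgue_tuple R n).

Let p0 : 0 < p. Proof. exact: lt_le_trans p1. Qed.

Lemma inner_scale (a : n.-tuple R) r x : inner a (scale_tuple r x) = r * inner a x.
Proof.
by rewrite /inner mulr_sumr; apply: eq_bigr => i _; rewrite tnth_scale; ring.
Qed.

Lemma inner_Np_le0 (a x : n.-tuple R) : Np p x <= 0 -> inner a x = 0.
Proof.
move=> N0; apply: big1 => i _; suff -> : tnth x i = 0 by rewrite mulr0.
apply/eqP; rewrite -normr_eq0; apply/eqP; apply: (@powR_eq0_eq0 _ _ p).
apply/eqP; rewrite eq_le powR_ge0 andbT; apply: le_trans N0.
by rewrite /Np (bigD1 i)//= lerDl; apply: sumr_ge0 => j _; exact: powR_ge0.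
Qed.

Variables a b : n.-tuple R.
Hypothesis maj : majorizes (sqr_tuple a) (sqr_tuple b).

Lemma ball_dilated_le (f : R -> R) (r : R) : convex_fun f ->
  (forall y, 0 <= y -> 0 <= f y) ->
  (\int[lam]_x (ball_weight p 0 x * f (inner b (scale_tuple r x) ^+ 2))%:E <=
   \int[lam]_x (ball_weight p 0 x * f (inner a (scale_tuple r x) ^+ 2))%:E)%E.
Proof.
move=> cf f0.
have := @ball_convex_le R p p1 p2 n a b (fun y => f (r ^+ 2 * y)) maj.
under eq_integral => x _ do rewrite -exprMn -inner_scale.
under [in X in (_ <= X)%E]eq_integral => x _ do rewrite -exprMn -inner_scale.
apply.
  move=> x y t t01; apply: le_trans (cf _ _ t t01).
  by rewrite le_eqVlt; apply/orP; left; apply/eqP; congr f; ring.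
by move=> y y0; apply: f0; rewrite mulr_ge0// sqr_ge0.
Qed.

(** The polynomial [- 'X] is convex as well, so that [ballpoly_le] also yields the
    inequality between the second moments in this direction. *)
Lemma ball_dilated_ge (r : R) :
  (\int[lam]_x (ball_weight p 0 x * inner a (scale_tuple r x) ^+ 2)%:E <=
   \int[lam]_x (ball_weight p 0 x * inner b (scale_tuple r x) ^+ 2)%:E)%E.
Proof.
have [D D0 hl] := hausdorff_lseq p1 p2.
have key : ballmom p n [seq c ^+ 2 | c <- a] 1 <= ballmom p n [seq c ^+ 2 | c <- b] 1.
  have cX : convex_on (D * \sum_(i < n) tnth a i ^+ 2) (horner (- 'X : {poly R})).
    move=> x y t _ _ _; rewrite !hornerN !hornerX le_eqVlt; apply/orP; left; apply/eqP; ring.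
  have := @ballpoly_le R p p1 p2 n (- 'X) a b D _ D0 hl cX (lexx _) maj.
  rewrite /ballpoly size_polyN size_polyX !big_ord_recl !big_ord0 !coefN !coefX /=.
  by rewrite !oppr0 !mul0r !add0r !addr0 !mulN1r lerN2.
have E (a' : n.-tuple R) : (\int[lam]_x (ball_weight p 0 x * inner a' (scale_tuple r x) ^+ 2)%:E =
    (r ^+ 2)%:E * (ballmom p n [seq c ^+ 2 | c <- a'] 1)%:E)%E.
  rewrite -(ball_inner p1) -ge0_integral_mulr ?sqr_ge0//.
  - by apply: eq_integral => x _; congr EFin; rewrite inner_scale exprMn; ring.
  - apply: measurable_funM; first exact: measurable_ball_weight.
    by apply: measurable_funX; exact: measurable_inner.
  - by move=> x; rewrite mulr_ge0 ?ball_weight_ge0// expr_double_ge0.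
by rewrite !E -!EFinM lee_fin ler_wpM2l// sqr_ge0.
Qed.

End linear_forms.

(** * Uniform laws with an independent radius *)

Section uniform_mixtures.
Context {R : realType}.
Variable p : R.
Hypothesis p1 : 1 <= p.
Variable n : nat.
Local Notation lam := (lebesgue_tuple R n).

Let p0 : 0 < p. Proof. exact: lt_le_trans p1. Qed.

Lemma measurable_lp_ball : measurable (lp_ball n p).
Proof.
have -> : lp_ball n p = [set x | lp_norm p x <= 1].
  by apply/seteqP; split => x /=; rewrite (lp_norm_le p0) ?ler01// powR1.
exact: measurable_cball.
Qed.

Lemma integral_ball_weight (A : set (n.-tuple R)) : measurable A ->
  (\int[lam]_(x in A) (ball_weight p 0 x)%:E = lam (lp_ball n p `&` A))%E.
Proof.
move=> mA; rewrite -(integral_indic lam mA measurable_lp_ball).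
apply: eq_integral => x _; congr EFin; rewrite /ball_weight indicE expr0.
have [N1|N1] := boolP (Np p x <= 1); first by rewrite mem_set.
by rewrite memNset//; exact/negP.
Qed.

Local Notation vol := (fine (lam (lp_ball n p))).

Lemma lam_ball_lty : (lam (lp_ball n p) < +oo)%E.
Proof.
rewrite -[lp_ball n p]setIT -(integral_ball_weight measurableT).
rewrite (_ : integral _ _ _ = (ballmom p n [seq c ^+ 2 | c <- [tuple of nseq n 0]] 0)%:E) ?ltry//.
rewrite -(ball_inner p1); apply: eq_integral => x _.
by rewrite double0 expr0 mulr1.
Qed.

Context d (T : measurableType d) (P : probability T R).
Variables (X : {RV P >-> n.-tuple R}) (Rad : {RV P >-> R}).
Hypothesis X_unif : uniform_on (lp_ball n p) (distribution P X).
Hypothesis Rad_X : independent_RVs Rad X.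

Lemma integral_uniform (f : n.-tuple R -> R) : measurable_fun setT f -> (forall x, 0 <= f x) ->
  (\int[distribution P X]_x (f x)%:E =
   (vol^-1)%:E * \int[lam]_x (ball_weight p 0 x * f x)%:E)%E.
Proof.
move=> mf f0.
have v0 : 0 <= vol^-1 by rewrite invr_ge0 fine_ge0.
have mw : measurable_fun setT (@ball_weight R p n 0) by exact: measurable_ball_weight.
have w0 (x : n.-tuple R) : 0 <= ball_weight p 0 x by exact: ball_weight_ge0.
have dens A : measurable A -> distribution P X A =
    (\int[lam]_(x in A) (vol^-1 * ball_weight p 0 x)%:E)%E.
  move=> mA; rewrite X_unif//.
  under eq_integral => x _ do rewrite EFinM.
  rewrite ge0_integralZl_EFin//.
  - rewrite (integral_ball_weight mA) setIC mulrC EFinM fineK//.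
    rewrite ge0_fin_numE//; apply: le_lt_trans lam_ball_lty.
    apply: le_measure; rewrite ?inE//.
      by apply: measurableI => //; exact: measurable_lp_ball.
    exact: measurable_lp_ball.
  - by move=> x _; rewrite lee_fin.
  - by apply/measurable_EFinP; exact: measurable_funTS.
rewrite (ge0_integral_density _ _ dens mf f0).
- rewrite -(ge0_integral_mulr lam _ _ v0).
  + by apply: eq_integral => x _; congr EFin; ring.
  + exact: measurable_funM.
  + by move=> x; rewrite mulr_ge0.
- exact: measurable_funM.
- by move=> x; rewrite mulr_ge0.
Qed.

(** By independence the integral is iterated, the radius being integrated last. *)
Lemma integral_radius (f : n.-tuple R -> R) : measurable_fun setT f -> (forall x, 0 <= f x) ->
  (\int[P]_w (f (scale_tuple (Rad w) (X w)))%:E =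
   \int[distribution P Rad]_r ((vol^-1)%:E *
     \int[lam]_x (ball_weight p 0 x * f (scale_tuple r x))%:E))%E.
Proof.
move=> mf f0.
have ms : measurable_fun setT (fun z : R * n.-tuple R => scale_tuple z.1 z.2).
  apply/measurable_fun_tnthP => i.
  apply: (@eq_measurable_fun _ _ _ _ _ (fun z : R * n.-tuple R => z.1 * tnth z.2 i)).
    by move=> z _; rewrite /= tnth_scale.
  apply: measurable_funM; first exact: measurable_fst.
  exact: (measurableT_comp (measurable_tnth_tuple i) measurable_snd).
rewrite (@ge0_integral_indep _ _ _ _ _ _ _ P Rad X
  (fun z => (f (scale_tuple z.1 z.2))%:E) Rad_X); last 2 first.
- by apply/measurable_EFinP; exact: (measurableT_comp mf ms).
- by move=> z; rewrite lee_fin.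
apply: eq_integral => r _; apply: integral_uniform => //.
exact: (measurableT_comp mf (measurable_scale_tuple r)).
Qed.

Lemma measurable_radius (f : n.-tuple R -> R) : measurable_fun setT f -> (forall x, 0 <= f x) ->
  measurable_fun setT (fun r : R => (vol^-1)%:E *
     \int[lam]_x (ball_weight p 0 x * f (scale_tuple r x))%:E)%E.
Proof.
move=> mf f0; apply: emeasurable_funM => //.
have ms : measurable_fun setT (fun z : measurableTypeR R * n.-tuple R => scale_tuple z.1 z.2).
  apply/measurable_fun_tnthP => i.
  apply: (@eq_measurable_fun _ _ _ _ _ (fun z : measurableTypeR R * n.-tuple R => (z.1 : R) * tnth z.2 i)).
    by move=> z _; rewrite /= tnth_scale.
  apply: measurable_funM; first exact: measurable_fst.
  exact: (measurableT_comp (measurable_tnth_tuple i) measurable_snd).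
apply: (@measurable_fun_fubini_tonelli_F _ _ (measurableTypeR R) _ R lam
  (fun z => (ball_weight p 0 z.2 * f (scale_tuple (z.1 : R) z.2))%:E)).
  apply/measurable_EFinP; apply: measurable_funM; last exact: (measurableT_comp mf ms).
  exact: (measurableT_comp (measurable_ball_weight p 0) measurable_snd).
by move=> z; rewrite lee_fin mulr_ge0// ball_weight_ge0.
Qed.

Lemma radius_le (fb fa : n.-tuple R -> R) :
  measurable_fun setT fb -> (forall x, 0 <= fb x) ->
  measurable_fun setT fa -> (forall x, 0 <= fa x) ->
  (forall r : R, (\int[lam]_x (ball_weight p 0 x * fb (scale_tuple r x))%:E <=
   \int[lam]_x (ball_weight p 0 x * fa (scale_tuple r x))%:E)%E) ->
  (\int[P]_w (fb (scale_tuple (Rad w) (X w)))%:E <=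
   \int[P]_w (fa (scale_tuple (Rad w) (X w)))%:E)%E.
Proof.
move=> mfb fb0 mfa fa0 h; rewrite !integral_radius//.
have v0 : (0 <= (vol^-1)%:E)%E by rewrite lee_fin invr_ge0 fine_ge0.
have i0 (f : n.-tuple R -> R) r : (forall x, 0 <= f x) ->
    (0 <= (vol^-1)%:E * \int[lam]_x (ball_weight p 0 x * f (scale_tuple r x))%:E)%E.
  move=> f0; apply: mule_ge0 => //; apply: integral_ge0 => x _.
  by rewrite lee_fin mulr_ge0// ball_weight_ge0.
apply: ge0_le_integral => //.
- by move=> r _; exact: i0.
- exact: measurable_radius.
- exact: measurable_radius.
- by move=> r _; exact: lee_wpmul2l.
Qed.

Lemma radius_second_moment (a : n.-tuple R) :
  ('E_P[(fun w => Rad w ^+ 2)%R] < +oo)%E ->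
  (\int[P]_w (inner a (scale_tuple (Rad w) (X w)) ^+ 2)%:E < +oo)%E.
Proof.
rewrite unlock => R2.
have msq : measurable_fun setT (fun x : n.-tuple R => inner a x ^+ 2).
  by apply: measurable_funX; exact: measurable_inner.
rewrite (integral_radius msq (fun x => sqr_ge0 _)).
pose K := vol^-1 * ballmom p n [seq c ^+ 2 | c <- a] 1.
have E (r : R) : ((vol^-1)%:E * \int[lam]_x (ball_weight p 0 x * inner a (scale_tuple r x) ^+ 2)%:E =
    (K * r ^+ 2)%:E)%E.
  transitivity ((vol^-1)%:E * ((r ^+ 2)%:E * \int[lam]_x (ball_weight p 0 x * inner a x ^+ 1.*2)%:E))%E.
    rewrite -(ge0_integral_mulr lam _ _ (sqr_ge0 r)).
    - by congr (_ * _)%E; apply: eq_integral => x _; congr EFin; rewrite inner_scale exprMn; ring.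
    - apply: measurable_funM; first exact: measurable_ball_weight.
      by apply: measurable_funX; exact: measurable_inner.
    - by move=> x; rewrite mulr_ge0 ?ball_weight_ge0// expr_double_ge0.
  by rewrite (ball_inner p1) -!EFinM; congr EFin; rewrite /K; ring.
under eq_integral => r _ do rewrite E.
have K0 : 0 <= K.
  rewrite mulr_ge0 ?invr_ge0 ?fine_ge0//.
  rewrite -lee_fin -(ball_inner p1); apply: integral_ge0 => x _.
  by rewrite lee_fin mulr_ge0 ?ball_weight_ge0// expr_double_ge0.
have mR2 : measurable_fun setT (fun r : R => r ^+ 2) by exact: measurable_funX.
rewrite (ge0_integral_mulr (distribution P Rad) mR2 (fun r => sqr_ge0 r) K0).
rewrite ge0_integral_distribution; last 2 first.
- exact/measurable_EFinP.
- by move=> r; rewrite lee_fin sqr_ge0.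
by rewrite lte_mul_pinfty.
Qed.

End uniform_mixtures.

(** * Radial laws *)

Section radial_laws.
Context {R : realType}.
Variable p : R.
Hypothesis p1 : 1 <= p.
Variable n : nat.
Local Notation lam := (lebesgue_tuple R n).

Let p0 : 0 < p. Proof. exact: lt_le_trans p1. Qed.

Variable rho : R -> R.
Hypothesis rho0 : forall r : R, 0 <= r -> 0 <= rho r.
Hypothesis rho_noninc : forall r s : R, 0 <= r -> r <= s -> rho s <= rho r.

Lemma measurable_rho_norm : measurable_fun setT (fun x : n.-tuple R => rho (lp_norm p x)).
Proof.
(* [rho] is only known to be monotone on [0, +oo[. *)
pose rho' (t : R) := rho (Num.max 0 t).
apply: (@eq_measurable_fun _ _ _ _ _ (rho' \o @lp_norm R n p)).
  by move=> x _; rewrite /= /rho' max_r// lp_norm_ge0.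
have mrho' : measurable_fun setT rho'.
  apply: nonincreasing_measurable => // s t st; apply: rho_noninc.
    by rewrite le_max lexx.
  by rewrite ge_max !le_max lexx st orbT.
exact: (measurableT_comp mrho' (@measurable_lp_norm R p n)).
Qed.

Variable mu : probability (n.-tuple R) R.
Hypothesis mu_density : has_density (fun x => rho (lp_norm p x)) mu.
Context d (T : measurableType d) (P : probability T R).
Variable Y : {RV P >-> n.-tuple R}.
Hypothesis Y_mu : forall A, measurable A -> distribution P Y A = mu A.

Lemma integral_law (f : n.-tuple R -> R) : measurable_fun setT f -> (forall x, 0 <= f x) ->
  (\int[P]_w (f (Y w))%:E = \int[mu]_x (f x)%:E)%E.
Proof.
move=> mf f0; transitivity (\int[distribution P Y]_x (f x)%:E)%E.
  by rewrite ge0_integral_distribution//; exact/measurable_EFinP.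
by apply: eq_measure_integral => A mA _; exact: Y_mu.
Qed.

Lemma radial_law_le (fb fa : n.-tuple R -> R) :
  measurable_fun setT fb -> (forall x, 0 <= fb x) ->
  measurable_fun setT fa -> (forall x, 0 <= fa x) ->
  (forall r : R, (\int[lam]_x (ball_weight p 0 x * fb (scale_tuple r x))%:E <=
   \int[lam]_x (ball_weight p 0 x * fa (scale_tuple r x))%:E)%E) ->
  (forall x, Np p x <= 0 -> fb x <= fa x) ->
  (\int[P]_w (fb (Y w))%:E <= \int[P]_w (fa (Y w))%:E)%E.
Proof.
move=> mfb fb0 mfa fa0 h h0; rewrite !integral_law//.
have dE (f : n.-tuple R -> R) : measurable_fun setT f -> (forall x, 0 <= f x) ->
    (\int[mu]_x (f x)%:E = \int[lam]_x (f x * rho (lp_norm p x))%:E)%E.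
  apply: ge0_integral_density => //; first exact: measurable_rho_norm.
  by move=> x; apply: rho0; exact: lp_norm_ge0.
rewrite !dE//; apply: radial_density_le => //; exact: measurable_rho_norm.
Qed.

(** A crude form of the Cauchy-Schwarz inequality, enough for integrability. *)
Lemma inner_sqr_le_norm (a x : n.-tuple R) :
  inner a x ^+ 2 <= (\sum_(i < n) `|tnth a i|) ^+ 2 * \sum_(i < n) tnth x i ^+ 2.
Proof.
set N2 := \sum_(i < n) tnth x i ^+ 2.
have N20 : 0 <= N2 by apply: sumr_ge0 => i _; exact: sqr_ge0.
have xN i : `|tnth x i| <= Num.sqrt N2.
  rewrite -sqrtr_sqr ler_sqrt// /N2 (bigD1 i)//= lerDl.
  by apply: sumr_ge0 => j _; exact: sqr_ge0.
rewrite -[N2 in leRHS]sqr_sqrtr// -exprMn -real_normK ?num_real// lerXn2r// ?nnegrE//.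
  by rewrite mulr_ge0 ?sqrtr_ge0// sumr_ge0.
apply: le_trans (ler_norm_sum _ _ _) _; rewrite mulr_suml; apply: ler_sum => i _.
by rewrite normrM ler_wpM2l.
Qed.

Lemma radial_second_moment (a : n.-tuple R) :
  (\int[mu]_x (\sum_(i < n) tnth x i ^+ 2)%:E < +oo)%E ->
  (\int[P]_w (inner a (Y w) ^+ 2)%:E < +oo)%E.
Proof.
move=> m2; have msq : measurable_fun setT (fun x : n.-tuple R => inner a x ^+ 2).
  by apply: measurable_funX; exact: measurable_inner.
rewrite (integral_law msq (fun x => sqr_ge0 _)).
have mN : measurable_fun setT (fun x : n.-tuple R => \sum_(i < n) tnth x i ^+ 2).
  by apply: measurable_sum => i; apply: measurable_funX; exact: measurable_tnth_tuple.
have N0 (x : n.-tuple R) : 0 <= \sum_(i < n) tnth x i ^+ 2.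
  by apply: sumr_ge0 => i _; exact: sqr_ge0.
pose K := (\sum_(i < n) `|tnth a i|) ^+ 2.
apply: (@le_lt_trans _ _ (\int[mu]_x (K * \sum_(i < n) tnth x i ^+ 2)%:E)%E).
  apply: ge0_le_integralr => //.
  - exact: measurable_funM.
  - by move=> x; exact: sqr_ge0.
  - by move=> x; exact: inner_sqr_le_norm.
rewrite (ge0_integral_mulr mu mN N0 (sqr_ge0 _)) lte_mul_pinfty//.
by rewrite lee_fin sqr_ge0.
Qed.

End radial_laws.

Theorem corollary1p2 (R : realType) (n : nat) (p : R) (a b : n.-tuple R)
    (n_ge1 : (1 <= n)%N) (p_ge1 : 1 <= p) (p_le2 : p <= 2)
    (a_maj_b : majorizes (sqr_tuple a) (sqr_tuple b)) :
  (forall (d : measure_display) (T : measurableType d) (P : probability T R)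
      (X : {RV P >-> n.-tuple R}) (Rad : {RV P >-> R}),
    uniform_on (lp_ball n p) (distribution P X) ->
    {ae P, forall w, 0 <= Rad w} ->
    independent_RVs Rad X ->
    ('E_P[(fun w => Rad w ^+ 2)%R] < +oo)%E ->
    convex_le P (fun w => inner b (scale_tuple (Rad w) (X w)) ^+ 2)
              P (fun w => inner a (scale_tuple (Rad w) (X w)) ^+ 2))
  /\
  (forall (rho : R -> R) (mu : probability (n.-tuple R) R),
    (forall r, 0 <= r -> 0 <= rho r) ->
    (forall r s, 0 <= r -> r <= s -> rho s <= rho r) ->
    has_density (fun x => rho (lp_norm p x)) mu ->
    (\int[mu]_x (\sum_(i < n) tnth x i ^+ 2)%R%:E < +oo)%E ->
    forall (d : measure_display) (T : measurableType d) (P : probability T R)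
      (Y : {RV P >-> n.-tuple R}),
      (forall A, measurable A -> distribution P Y A = mu A) ->
      convex_le P (fun w => inner b (Y w) ^+ 2)
                P (fun w => inner a (Y w) ^+ 2)).
Proof.
have m_sq (c : n.-tuple R) : measurable_fun setT (fun x => inner c x ^+ 2).
  by apply: measurable_funX; exact: measurable_inner.
have m_cvx (f : R -> R) (c : n.-tuple R) : convex_fun f ->
    measurable_fun setT (fun x => f (inner c x ^+ 2)).
  by move=> cf; exact: (measurableT_comp (measurable_convex cf) (m_sq c)).
split=> [d T P X Rad X_unif _ Rad_X R2|rho mu rho0 rho_noninc mu_dens mu2 d T P Y Y_mu].
- have m_RX (c : n.-tuple R) :
      measurable_fun setT (fun w => inner c (scale_tuple (Rad w) (X w)) ^+ 2).
    apply: (@eq_measurable_fun _ _ _ _ _ (fun w => (Rad w * inner c (X w)) ^+ 2)).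
      by move=> w _; rewrite inner_scale.
    apply: measurable_funX; apply: measurable_funM => //.
    exact: (measurableT_comp (measurable_inner c)).
  apply: convex_le_nonneg => //.
  + by move=> w; exact: sqr_ge0.
  + by move=> w; exact: sqr_ge0.
  + exact: (radius_second_moment p_ge1 X_unif Rad_X a R2).
  + apply: (radius_le p_ge1 X_unif Rad_X (m_sq a) (fun=> sqr_ge0 _) (m_sq b) (fun=> sqr_ge0 _)).
    exact: (ball_dilated_ge p_ge1 p_le2 a_maj_b).
  + move=> f cf f0.
    apply: (radius_le p_ge1 X_unif Rad_X (m_cvx f b cf) _ (m_cvx f a cf)).
    * by move=> x; apply: f0; exact: sqr_ge0.
    * by move=> x; apply: f0; exact: sqr_ge0.
    * by move=> r; exact: (ball_dilated_le p_ge1 p_le2 a_maj_b r cf f0).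
- have m_Y (c : n.-tuple R) : measurable_fun setT (fun w => inner c (Y w) ^+ 2).
    exact: (measurableT_comp (m_sq c)).
  have le_law := radial_law_le p_ge1 rho0 rho_noninc mu_dens Y_mu.
  have inner0 (c x : n.-tuple R) := @inner_Np_le0 R p n c x.
  apply: convex_le_nonneg => //.
  + by move=> w; exact: sqr_ge0.
  + by move=> w; exact: sqr_ge0.
  + exact: (radial_second_moment Y_mu a mu2).
  + apply: (le_law _ _ (m_sq a) (fun=> sqr_ge0 _) (m_sq b) (fun=> sqr_ge0 _)).
      exact: (ball_dilated_ge p_ge1 p_le2 a_maj_b).
    by move=> x N0; rewrite !inner0.
  + move=> f cf f0; apply: (le_law _ _ (m_cvx f b cf) _ (m_cvx f a cf)).
    * by move=> x; apply: f0; exact: sqr_ge0.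
    * by move=> x; apply: f0; exact: sqr_ge0.
    * by move=> r; exact: (ball_dilated_le p_ge1 p_le2 a_maj_b r cf f0).
    * by move=> x N0; rewrite !inner0.
Qed.
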